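(* For an integral dominant weight $\lambda$ of $\mathfrak{sl}_n(\mathbb C)$, the Zariski closure of the set of points $\exp(c)\mathbf v_\lambda^\prec\in\mathbb P(L_\lambda^\prec)$, with $c$ ranging over $\mathbb C^{\{1\le i<j\le n\}}$, is isomorphic to the toric variety associated with the polytope $P_\lambda$.
   Context: Fix $n\ge2$ and $\mathfrak g=\mathfrak{sl}_n(\mathbb C)$ with simple roots $\alpha_1,\dots,\alpha_{n-1}$ and fundamental weights $\omega_k$; $(a_1,\dots,a_{n-1})$ denotes $\sum a_k\omega_k$. $\mathfrak n_-$ is spanned by negative root vectors $f_{i,j}$, $1\le i<j\le n$, of weight $-(\alpha_i+\dots+\alpha_{j-1})$ (matrix units $f_{i,j}e_i=e_j$). $L_\lambda$ is the irreducible representation with highest weight $\lambda$ and highest weight vector $v_\lambda$. $\mathcal F_n$ is the free associative $\mathbb C$-algebra on symbols $\hat f_{i,j}$, $1\le i<j\le n$; $\mathcal I$ is the kernel of the surjection $\mathcal F_n\to\mathcal U(\mathfrak n_-)$, $\hat f_{i,j}\mapsto f_{i,j}$; $\mathcal I_\lambda\subset\mathcal F_n$ is the left ideal of elements whose image in $\mathcal U(\mathfrak n_-)$ annihilates $v_\lambda$. Monomial order $\prec$ on $\mathcal F_n$: for a monomial $x=\hat f_{i_1,j_1}\cdots\hat f_{i_m,j_m}$ put $|x|=\sum_k(j_k-i_k)$. For two monomials $x=\hat f_{i_1,j_1}\cdots\hat f_{i_m,j_m}$ and $y=\hat f_{p_1,q_1}\cdots\hat f_{p_r,q_r}$ set $x\prec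 y$ if $|x|<|y|$; if $|x|=|y|$ and $x\neq y$, take the least $k$ with $(i_k,j_k)\ne(p_k,q_k)$ and set $x\prec y$ if $i_k<p_k$, or $i_k=p_k$ and $j_k<q_k$. For nonzero $f\in\mathcal F_n$, $\mathrm{in}_\prec f$ is the $\prec$-maximal monomial occurring in $f$; $\mathrm{in}_\prec\mathcal I$ (a two-sided ideal) and $\mathrm{in}_\prec\mathcal I_\lambda$ (a left ideal containing $\mathrm{in}_\prec\mathcal I$) are the spans of initial parts of the elements of $\mathcal I$ and $\mathcal I_\lambda$. Put $\mathcal U^\prec=\mathcal F_n/\mathrm{in}_\prec\mathcal I$ and $L_\lambda^\prec=\mathcal F_n/\mathrm{in}_\prec\mathcal I_\lambda$, a left $\mathcal U^\prec$-module generated by the image $v_\lambda^\prec$ of $1$. $\chi_{i,j}\in\mathcal U^\prec$ is the image of $\hat f_{i,j}$. For $c=(c_{i,j})\in\mathbb C^{\{1\le i<j\le n\}}$, $\exp(c)$ is the operator on $L_\lambda^\prec$ given by the product $\exp(c_{1,2}\chi_{1,2})\cdots\exp(c_{1,n}\chi_{1,n})\exp(c_{2,3}\chi_{2,3})\cdots\exp(c_{n-1,n}\chi_{n-1,n})$ (factors ordered first by $i$, then by $j$, increasing from left to right); it is invertible and also acts on $\mathbb P(L_\lambda^\prec)$. $\mathbf v_\lambda^\prec\in\mathbb P(L_\lambda^\prec)$ is the point corresponding to $v_\lambda^\prec$. For $\lambda=(a_1,\dots,a_{n-1})$, $P_\lambda\subset\mathbb R^{\{1\le i<j\le n\}}$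 is the lattice polytope of points $T$ with $T_{i,j}\ge0$ and $\sum_{l=j}^nT_{i,l}-\sum_{l=j+1}^nT_{i+1,l}\le a_i$ for all $1\le i<j\le n$ (the second sum is empty if $j=n$); it is unimodularly equivalent to the Gelfand–Tsetlin polytope of $\lambda$. *)

(* Defs.v *)
From HB Require Import structures.
From mathcomp Require Import all_boot all_order all_algebra.
From mathcomp Require Import finmap.
From mathcomp Require Import mathcomp_extra boolp classical_sets functions.
From mathcomp Require Import cardinality fsbigop reals.
From mathcomp Require Import complex monalg.

Set Implicit Arguments.
Unset Strict Implicit.
Unset Printing Implicit Defensive.

Import Order.TTheory GRing.Theory Num.Theory.
Local Open Scope classical_set_scope.
Local Open Scope quotient_scope.
Local Open Scope ring_scope.

(** * Linear spans and quotient spaces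
   [quo S] is the quotient of V by the linear span of the set S. *)

Definition subspace (K : fieldType) (V : lmodType K) (W : set V) : Prop :=
  W 0 /\ forall a x y, W x -> W y -> W (a *: x + y).

Definition lspan (K : fieldType) (V : lmodType K) (S : set V) : set V :=
  smallest (@subspace K V) S.

Section QuotientSpace.
Variables (K : fieldType) (V : lmodType K) (S : set V).

Definition lspan_pred : {pred V} := fun v => `[< lspan S v >].

Lemma lspan_subspace : subspace (lspan S).
Proof.
split=> [W [[W0 _] _] //|a x y Sx Sy W sW].
by have [[_ WD] _] := sW; apply: WD; [apply: Sx | apply: Sy].
Qed.

Fact lspan_zmod_closed : zmod_closed lspan_pred.
Proof.
have [S0 SD] := lspan_subspace.
split=> [|x y]; rewrite -!topredE /=; first exact/asboolP.
move=> /asboolP Sx /asboolP Sy; apply/asboolP.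
by rewrite addrC -scaleN1r; apply: SD.
Qed.

HB.instance Definition _ := GRing.isZmodClosed.Build V lspan_pred
  lspan_zmod_closed.

Definition quo := @Quotient.quot V (GRing.ZmodClosed.clone V lspan_pred _).

HB.instance Definition _ := EqQuotient.on quo.
HB.instance Definition _ := Choice.on quo.
HB.instance Definition _ := GRing.Zmodule.on quo.

Definition quo_scale (a : K) (q : quo) : quo := \pi_quo (a *: repr q).

Lemma quo_piP (x y : V) : reflect (\pi_quo x = \pi_quo y) (lspan_pred (x - y)).
Proof.
have -> : lspan_pred (x - y) = (x == y %[mod quo]).
  exact: (@Quotient.idealrBE V lspan_pred).
exact: eqP.
Qed.

Lemma quo_piZ a x : \pi_quo (a *: x) = quo_scale a (\pi_quo x).
Proof.
apply/quo_piP; rewrite -scalerBr; apply/asboolP.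
have [S0 SD] := lspan_subspace.
rewrite -[X in lspan S X]addr0; apply: SD => //.
by apply: asboolW; apply/quo_piP; rewrite reprK.
Qed.

Lemma quo_piD x y : \pi_quo (x + y) = \pi_quo x + \pi_quo y :> quo.
Proof.
exact: (@pi_addr _ _ _ _ _
  (Quotient.quot (GRing.ZmodClosed.clone V lspan_pred _))).
Qed.

Fact quo_scaleA a b q : quo_scale a (quo_scale b q) = quo_scale (a * b) q.
Proof. by elim/quotW: q => x; rewrite -(quo_piZ b) -!quo_piZ scalerA. Qed.

Fact quo_scale1 : left_id 1 quo_scale.
Proof. by elim/quotW=> x; rewrite -quo_piZ scale1r. Qed.

Fact quo_scaleDr : right_distributive quo_scale +%R.
Proof.
move=> a; elim/quotW=> x; elim/quotW=> y.
by rewrite -quo_piD -!quo_piZ scalerDr quo_piD.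
Qed.

Fact quo_scaleDl q : {morph quo_scale^~ q : a b / a + b}.
Proof.
by elim/quotW: q => x a b; rewrite /= -!quo_piZ scalerDl quo_piD.
Qed.

HB.instance Definition _ := GRing.Zmodule_isLmodule.Build K quo
  quo_scaleA quo_scale1 quo_scaleDr quo_scaleDl.

End QuotientSpace.

(* A point of P(V) is a line through the origin. No finiteness of V is assumed;
   forms of degree d are finite sums of products of d linear functionals, which
   gives the homogeneous polynomials of degree d in coordinates. *)
Record proj (K : fieldType) (V : lmodType K) := Proj {
  line : set V;
  lineP : exists2 v, v != 0 & line = [set a *: v | a in [set: K]] }.

(* v is a vector of homogeneous coordinates of p, that is p = [v]; the zero
   vector represents no point. *)
Definition hcoord (K : fieldType) (V : lmodType K) (p : proj V) (v : V) : Prop :=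
  v != 0 /\ line p v.

Definition form (K : fieldType) (V : lmodType K) (d : nat) (f : V -> K) : Prop :=
  exists (m : nat) (l : 'I_m -> 'I_d -> {scalar V}),
    f = fun v => \sum_(i < m) \prod_(j < d) l i j v.

Definition form_map (K : fieldType) (V W : lmodType K) (d : nat) (F : V -> W) :
    Prop :=
  exists (m : nat) (f : 'I_m -> V -> K) (w : 'I_m -> W),
    (forall i, form d (f i)) /\ F = fun v => \sum_(i < m) f i v *: w i.

Definition vanishes (K : fieldType) (V : lmodType K) (f : V -> K) (p : proj V) :
    Prop :=
  forall v, line p v -> f v = 0.

Definition zclosed (K : fieldType) (V : lmodType K) (Z : set (proj V)) : Prop :=
  exists S : set (V -> K),
    (forall f, S f -> exists d, form d f) /\
    Z = [set p | forall f, S f -> vanishes f p].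

Definition zclosure (K : fieldType) (V : lmodType K) (X : set (proj V)) :
    set (proj V) :=
  smallest (@zclosed K V) X.

(* Regular maps: locally given by forms of a common degree without common
   zeros *)
Definition regular_map (K : fieldType) (V W : lmodType K) (X : set (proj V))
    (Y : set (proj W)) (phi : X -> Y) : Prop :=
  forall p : X, exists (U : set (proj V)) (d : nat) (F : V -> W),
    [/\ zclosed (~` U), U (\val p), form_map d F &
      forall (q : X) (v : V), U (\val q) -> hcoord (\val q) v ->
        hcoord (\val (phi q)) (F v)].

Definition isomorphic (K : fieldType) (V W : lmodType K) (X : set (proj V))
    (Y : set (proj W)) : Prop :=
  exists (phi : X -> Y) (psi : Y -> X),
    [/\ regular_map phi, regular_map psi, cancel phi psi & cancel psi phi].

(** * The toric variety of a lattice polytope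
   The definition is that of Cox, Little and Schenck, Toric Varieties: X_P is
   the projective toric variety X_A of the set A of lattice points of kP, for
   any k > 0 such that kP is very ample. The lattice is Z^I; when P is not
   full-dimensional, replacing it by its intersection with the linear space
   parallel to P changes neither very ampleness nor X_A. *)

Section Toric.
Variables (R : realType) (I : finType).

Definition lattice := {ffun I -> int}.
HB.instance Definition _ := GRing.Zmodule.on lattice.

Definition realpt (m : lattice) : {ffun I -> R} := [ffun x => (m x)%:~R].

Definition dilate (k : nat) (P : set {ffun I -> R}) : set {ffun I -> R} :=
  [set [ffun x => k%:R * (T : {ffun I -> R}) x] | T in P].

Definition vertex (P : set {ffun I -> R}) (T : {ffun I -> R}) : Prop :=
  P T /\ exists u : {ffun I -> R}, forall T', P T' -> T' != T ->
    \sum_x u x * T x < \sum_x u x * T' x.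

Definition submonoid (N : set lattice) : Prop :=
  N 0 /\ forall m m', N m -> N m' -> N (m + m').

Definition saturated (N : set lattice) : Prop :=
  forall (k : nat) (m : lattice), (0 < k)%N -> N (m *+ k) -> N m.

Definition very_ample (P : set {ffun I -> R}) : Prop :=
  forall m : lattice, vertex P (realpt m) ->
    saturated (smallest submonoid
      [set m' - m | m' in [set m' : lattice | P (realpt m')]]).

Definition lattice_points (P : set {ffun I -> R}) : {fset lattice} :=
  fset_set [set m : lattice | P (realpt m)].

Variable K : fieldType.

Definition torus_point (A : {fset lattice}) (t : {ffun I -> K}) :
    {ffun A -> K^o} :=
  [ffun m : A => \prod_x t x ^ (\val m x)].

Definition projective_toric (A : {fset lattice}) : set (proj {ffun A -> K^o}) :=
  zclosure [set p | exists t : {ffun I -> K},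
    (forall x, t x != 0) /\ hcoord p (torus_point A t)].

Arguments projective_toric : clear implicits.

(* For a lattice polytope such a k exists, so the default value 1 is not used. *)
Definition ample_multiple (P : set {ffun I -> R}) : nat :=
  xget 1%N [set k : nat | (0 < k)%N /\ very_ample (dilate k P)].

Definition toric_variety (P : set {ffun I -> R}) :=
  projective_toric (lattice_points (dilate (ample_multiple P) P)).

End Toric.

Arguments toric_variety {R I} K P.

(* The indices 1..n are represented by 0..n-1. *)

Section Degeneration.
Variables (K : fieldType) (n : nat).

Definition ixpair : Type := {x : 'I_n * 'I_n | (x.1 < x.2)%N}.
HB.instance Definition _ := Finite.on ixpair.

Definition fst_ix (x : ixpair) : 'I_n := (\val x).1.
Definition snd_ix (x : ixpair) : 'I_n := (\val x).2.

Definition bracket (A B : 'M[K]_n) : 'M[K]_n := A *m B - B *m A.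

(* Matrices act on columns, so this is the unit sending e_i to e_j. *)
Definition fneg (x : ixpair) : 'M[K]_n := delta_mx (snd_ix x) (fst_ix x).

Definition sl_rep (L : vectType K) (rho : 'M[K]_n -> 'End(L)) : Prop :=
  (forall a A B, \tr A = 0 -> \tr B = 0 ->
     rho (a *: A + B) = a *: rho A + rho B) /\
  (forall A B, \tr A = 0 -> \tr B = 0 ->
     forall u, rho (bracket A B) u = rho A (rho B u) - rho B (rho A u)).

Definition irreducible_rep (L : vectType K) (rho : 'M[K]_n -> 'End(L)) : Prop :=
  (fullv : {vspace L}) <> 0%VS /\
  forall U : {vspace L},
    (forall A, \tr A = 0 -> (rho A @: U <= U)%VS) -> U = 0%VS \/ U = fullv.

Definition highest_weight_vector (L : vectType K) (rho : 'M[K]_n -> 'End(L))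
    (lam : 'I_n.-1 -> nat) (v : L) : Prop :=
  [/\ v != 0,
    forall x : ixpair, rho (delta_mx (fst_ix x) (snd_ix x)) v = 0 &
    forall (k : 'I_n.-1) (i j : 'I_n), i = k :> nat -> j = k.+1 :> nat ->
      rho (delta_mx i i - delta_mx j j) v = (lam k)%:R *: v].

Definition freealg := {malg K[{fmonom ixpair}]}.
HB.instance Definition _ := GRing.Lalgebra.on freealg.

Definition fhat (x : ixpair) : freealg := << fmu x >>.

(* The two-sided ideal generated by the relations XY - YX - [X,Y] on the basis
   of n_-, which is the kernel of the surjection onto U(n_-) *)
Definition fhat_lin (A : 'M[K]_n) : freealg :=
  \sum_(x : ixpair) A (snd_ix x) (fst_ix x) *: fhat x.

Definition Un_ideal : set freealg :=
  lspan [set f | exists (g h : freealg) (x y : ixpair),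
    f = g * (fhat x * fhat y - fhat y * fhat x
             - fhat_lin (bracket (fneg x) (fneg y))) * h].

Definition free_act (L : vectType K) (rho : 'M[K]_n -> 'End(L)) (f : freealg)
    (u : L) : L :=
  \sum_(m <- msupp f) f@_m *: foldr (fun x => rho (fneg x)) u m.

Definition annihilator (L : vectType K) (rho : 'M[K]_n -> 'End(L)) (v : L) :
    set freealg :=
  [set f | free_act rho f v = 0].

Definition mon_height (m : {fmonom ixpair}) : nat :=
  (\sum_(x <- m) (snd_ix x - fst_ix x))%N.

Definition pair_lt (x y : ixpair) : bool :=
  (fst_ix x < fst_ix y)%N ||
  ((fst_ix x == fst_ix y) && (snd_ix x < snd_ix y)%N).

(* Distinct monomials of equal height are never prefixes of one another. *)
Definition mon_lt (m m' : {fmonom ixpair}) : Prop :=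
  (mon_height m < mon_height m')%N \/
  mon_height m = mon_height m' /\
  exists (p s s' : seq ixpair) (x x' : ixpair),
    [/\ m = p ++ x :: s :> seq ixpair, m' = p ++ x' :: s' :> seq ixpair &
        pair_lt x x'].

Definition is_initial (f : freealg) (m : {fmonom ixpair}) : Prop :=
  m \in msupp f /\ forall m', m' \in msupp f -> m' != m -> mon_lt m' m.

(* The span of these monomials is the space of initial parts of J. *)
Definition initial_monomials (J : set freealg) : set freealg :=
  [set << m >> | m in [set m | exists2 f, J f & is_initial f m]].

Definition Uprec := quo (initial_monomials Un_ideal).

Definition chi (x : ixpair) : Uprec := \pi_Uprec (fhat x).

Section Module.
Variables (L : vectType K) (rho : 'M[K]_n -> 'End(L)) (v : L).

Definition Lprec := quo (initial_monomials (annihilator rho v)).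
HB.instance Definition _ := GRing.Lmodule.on Lprec.

Definition vprec : Lprec := \pi_Lprec (1 : freealg).

(* The class of f g, for f in the class u and g in the class w *)
Definition Uprec_act (u : Uprec) (w : Lprec) : Lprec :=
  \pi_Lprec (repr u * repr w : freealg).

(* The exponential series of a locally nilpotent operator: the sum of the
   finitely many nonzero terms *)
Definition exp_op (g : Lprec -> Lprec) (w : Lprec) : Lprec :=
  \sum_(k \in [set: nat]) ((k`!)%:R^-1 : K) *: iter k g w.

Definition pairs_sorted : seq ixpair :=
  sort (fun x y => (x == y) || pair_lt x y) (enum {: ixpair}).

Definition exp_c (c : {ffun ixpair -> K}) (w : Lprec) : Lprec :=
  foldr (fun x => exp_op (fun u => c x *: Uprec_act (chi x) u)) w pairs_sorted.

Definition exp_orbit_closure : set (proj Lprec) :=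
  zclosure [set p | exists c : {ffun ixpair -> K}, hcoord p (exp_c c vprec)].

End Module.
End Degeneration.
Arguments Lprec {K n L} rho v.
Arguments exp_orbit_closure {K n L} rho v.

(* Row index k stands for i = k + 1, column index j for j + 1. *)
Definition GT_polytope (R : realType) (n : nat) (lam : 'I_n.-1 -> nat) :
    set {ffun ixpair n -> R} :=
  [set T : {ffun ixpair n -> R} | (forall x, 0 <= T x) /\
    forall (k : 'I_n.-1) (j : 'I_n), (k < j)%N ->
      \sum_(x : ixpair n | (fst_ix x == k :> nat) && (j <= snd_ix x)%N) T x
      - \sum_(x : ixpair n | (fst_ix x == k.+1 :> nat) && (j < snd_ix x)%N) T x
      <= (lam k)%:R].
Arguments GT_polytope R {n} lam.

(* Main.v *)
From HB Require Import structures.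
From mathcomp Require Import all_boot all_order all_algebra.
From mathcomp Require Import fingroup perm finmap.
From mathcomp Require Import mathcomp_extra boolp classical_sets functions.
From mathcomp Require Import cardinality fsbigop reals.
From mathcomp Require Import complex monalg generic_quotient zify ring.
Require Import Defs.

(* Order the letters of a word as in the order of the exponentials. A sorted word
   f^T is an initial part of the annihilator of v exactly when T violates an
   inequality of P_lam:
   - if T violates the inequality (i, j), apply suitable powers of the f_{i+1,l}
     to the relation f_{i,i+1}^D u = 0 given by sl_2-theory, where D is the sum of
     the T_{i,l} with l >= j; the expansion has leading word f^T;
   - if T lies in P_lam, read T as a semistandard tableau b. In a tensor power of
     C^n, f^T applied to a column-antisymmetrized vector w of weight lam has a
     positive coordinate at b, while every smaller word has coordinate 0 there. By
     contravariance of the hermitian form, relations for v also hold for w.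
   Hence the degenerate module has a basis indexed by the lattice points T of
   P_lam, in which exp(c) v has coordinates prod c^T / T!, so the orbit closure is
   the projective toric variety of these points. By Hermite's identity every
   lattice point of k P_lam is a sum of k lattice points of P_lam, so the Veronese
   map identifies it with the one of k P_lam for all k > 0. *)

Set Implicit Arguments.
Unset Strict Implicit.
Unset Printing Implicit Defensive.

Import Order.TTheory GRing.Theory Num.Theory.
Local Open Scope classical_set_scope.
Local Open Scope quotient_scope.
Local Open Scope ring_scope.

(** * Forms and regular maps *)

(** The number of lattice points of P_lam is never compared with dim L, so each half of the
    criterion for initial words needs its own argument. For a violated inequality only two adjacent
    rows matter: with a = i+1, the bracket of f_{a,l} with f_{i,a} is f_{i,l} and the other brackets
    involved vanish, while a count of letters shows that every unwanted word in the expansion is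
    smaller. For T in P_lam, the inequalities (i, j) are what makes the entries of the filling
    increase from row i to row i+1; together with antisymmetry along columns this forces the letters
    of f^T to act in their own rows only, so all contributions to the coordinate at b are positive.
    It is not known beforehand that w generates a copy of L, hence the detour through the submodule
    generated by (v, w). On the geometric side, exp(c) v is parametrized by all c, whereas the toric
    variety is the closure of a torus orbit; the two are reconciled by density of the torus. *)

Section MakeScalar.
Variables (K : fieldType) (V : lmodType K) (f : V -> K).
Hypothesis f_lin : forall a x y, f (a *: x + y) = a * f x + f y.

Definition make_scalar_fun := f.
HB.instance Definition _ :=
  GRing.isLinear.Build K V K *%R make_scalar_fun f_lin.
Definition make_scalar : {scalar V} := make_scalar_fun.

End MakeScalar.

Section Forms.
Variables (K : fieldType) (V : lmodType K).
Implicit Types (f g : V -> K) (d e : nat).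

Lemma form_fin (M : finType) d (l : M -> 'I_d -> {scalar V}) :
  form d (fun v => \sum_i \prod_(j < d) l i j v).
Proof.
exists #|M|, (fun i => l (enum_val i)); apply/funext => v.
by apply: reindex; apply: onW_bij; apply: enum_val_bij.
Qed.

Lemma form0 d : form d (fun _ : V => 0).
Proof.
exists 0%N; unshelve eexists; first by case.
by apply/funext => v; rewrite big_ord0.
Qed.

Lemma form_scalar (l : {scalar V}) : form 1 l.
Proof.
exists 1%N, (fun _ _ => l); apply/funext => v.
by rewrite !big_ord1.
Qed.

Lemma form_monomial d (l : 'I_d -> {scalar V}) : form d (fun v => \prod_j l j v).
Proof. by exists 1%N, (fun _ => l); apply/funext => v; rewrite big_ord1. Qed.

Lemma form1 : form 0 (fun _ : V => 1).
Proof.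
exists 1%N; unshelve eexists; first by move=> _; case.
by apply/funext => v; rewrite big_ord1 big_ord0.
Qed.

Lemma formD d f g : form d f -> form d g -> form d (fun v => f v + g v).
Proof.
move=> [m [l ->]] [m' [l' ->]].
have := form_fin (fun s : 'I_m + 'I_m' =>
  match s with inl i => l i | inr i => l' i end).
by congr form; apply/funext => v; rewrite big_sumType.
Qed.

Lemma formM d e f g : form d f -> form e g -> form (d + e) (fun v => f v * g v).
Proof.
move=> [m [l ->]] [m' [l' ->]].
have := form_fin (fun (s : 'I_m * 'I_m') (j : 'I_(d + e)) =>
  match fintype.split j with inl i => l s.1 i | inr i => l' s.2 i end).
congr form; apply/funext => v; rewrite big_distrl /=.
under [RHS]eq_bigr do rewrite big_distrr /=.
rewrite pair_big; apply: eq_bigr => -[i i'] _ /=.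
rewrite big_split_ord; congr (_ * _); apply: eq_bigr => j _.
  by rewrite -/(unsplit (inl j)) unsplitK.
by rewrite -/(unsplit (inr j)) unsplitK.
Qed.

Lemma form_sum d (J : Type) (s : seq J) (F : J -> V -> K) :
  (forall j, form d (F j)) -> form d (fun v => \sum_(j <- s) F j v).
Proof.
move=> hF; elim: s => [|j s IH].
  by under eq_fun do rewrite big_nil; apply: form0.
by under eq_fun do rewrite big_cons; apply: formD.
Qed.

Lemma form_prod e d (F : 'I_d -> V -> K) :
  (forall j, form e (F j)) -> form (d * e) (fun v => \prod_(j < d) F j v).
Proof.
elim: d F => [|d IH] F hF.
  by under eq_fun do rewrite big_ord0; apply: form1.
under eq_fun do rewrite big_ord_recl.
by rewrite mulSn; apply: formM => //; apply: IH.
Qed.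

Lemma scaled_scalar_lin c (l : {scalar V}) a x y :
  c * l (a *: x + y) = a * (c * l x) + c * l y.
Proof. by rewrite linearP mulrDr mulrCA. Qed.

(** The scalar is absorbed in the first linear factor of each product. In degree 0 there is no such
    factor: the forms are then the constants m%:R, which are not stable under scaling. This is why
    positive degrees appear in [formB] and [form_comp]. *)
Lemma formZ d c f : form d.+1 f -> form d.+1 (fun v => c * f v).
Proof.
move=> [m [l ->]].
exists m, (fun i j => if unlift ord0 j is Some _ then l i j
                      else make_scalar (scaled_scalar_lin c (l i j))).
apply/funext => v; rewrite big_distrr; apply: eq_bigr => i _.
rewrite [in RHS]big_ord_recl unlift_none [in LHS]big_ord_recl /= mulrA; congr (_ * _).
by apply: eq_bigr => j _; rewrite liftK.
Qed.

Lemma formB d f g : form d.+1 f -> form d.+1 g -> form d.+1 (fun v => f v - g v).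
Proof.
move=> hf hg; under eq_fun do rewrite -mulN1r.
by apply: formD => //; apply: formZ.
Qed.

Lemma form_homog d f a v : form d f -> f (a *: v) = a ^+ d * f v.
Proof.
move=> [m [l ->]]; rewrite big_distrr; apply: eq_bigr => i _.
under eq_bigr do rewrite linearZ.
by rewrite big_split /= prodr_const card_ord.
Qed.

End Forms.

Section FormMaps.
Variables (K : fieldType) (V W : lmodType K).

Lemma form_map_homog d (F : V -> W) a v :
  form_map d F -> F (a *: v) = a ^+ d *: F v.
Proof.
move=> [m [f [w [hf ->]]]]; rewrite scaler_sumr; apply: eq_bigr => i _.
by rewrite (form_homog _ _ (hf i)) scalerA.
Qed.

Lemma form_comp e d (f : W -> K) (F : V -> W) :
  form d f -> form_map e.+1 F -> form (d * e.+1) (fun v => f (F v)).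
Proof.
move=> [m [l ->]] [m' [g [w [hg ->]]]].
apply: form_sum => i; apply: form_prod => j.
under eq_fun do rewrite linear_sum /=.
apply: form_sum => s; under eq_fun do rewrite linearZ /= mulrC.
exact: formZ.
Qed.

Lemma form_map_fin (M : finType) d (f : M -> V -> K) (w : M -> W) :
  (forall i, form d (f i)) -> form_map d (fun v => \sum_i f i v *: w i).
Proof.
move=> hf; exists #|M|, (fun i => f (enum_val i)), (fun i => w (enum_val i)).
split=> //; apply/funext => v.
by apply: reindex; apply: onW_bij; apply: enum_val_bij.
Qed.

End FormMaps.

Section Projective.
Variables (K : fieldType) (V : lmodType K).
Implicit Types (p q : proj V) (v w : V) (X : set (proj V)).

Definition mkproj v (v0 : v != 0) : proj V :=
  @Proj K V [set a *: v | a in [set: K]] (ex_intro2 _ _ v v0 erefl).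

Lemma hcoord_mkproj v (v0 : v != 0) : hcoord (mkproj v0) v.
Proof. by split=> //; exists 1 => //; rewrite scale1r. Qed.

Lemma hcoord_line p v : hcoord p v -> line p = [set a *: v | a in [set: K]].
Proof.
move=> [v0]; have [u u0 ->] := lineP p => -[b _ bv].
have b0 : b != 0 by apply: contraNneq v0 => b0; rewrite -bv b0 scale0r.
apply/seteqP; split=> _ [a _ <-].
  by exists (a / b) => //; rewrite -bv scalerA divfK.
by exists (a * b) => //; rewrite -bv scalerA.
Qed.

Lemma hcoord_scale p v w : hcoord p v -> hcoord p w -> exists2 a, a != 0 & w = a *: v.
Proof.
move=> pv [w0]; rewrite (hcoord_line pv) => -[a _ aw]; exists a => //.
by apply: contraNneq w0 => a0; rewrite -aw a0 scale0r.
Qed.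

Lemma hcoordZ p v a : a != 0 -> hcoord p v -> hcoord p (a *: v).
Proof.
move=> a0 pv; split; first by rewrite scaler_eq0 (negPf a0) pv.1.
by rewrite (hcoord_line pv); exists a.
Qed.

Lemma hcoord_inj p q v : hcoord p v -> hcoord q v -> p = q.
Proof.
move=> /hcoord_line + /hcoord_line; case: p q => L PL [L' PL'] /= E E'.
by rewrite -E' in E; move: PL PL'; rewrite E => PL PL'; congr Proj; apply: Prop_irrelevance.
Qed.

Lemma hcoord_ex p : exists v, hcoord p v.
Proof.
by have [v v0 LE] := lineP p; exists v; split=> //; rewrite LE; exists 1; rewrite ?scale1r.
Qed.

Lemma vanishesP d f p v : form d f -> hcoord p v -> vanishes f p <-> f v = 0.
Proof.
move=> hf pv; split=> [|fv0 w]; first by apply; apply: pv.2.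
by rewrite (hcoord_line pv) => -[a _ <-]; rewrite (form_homog _ _ hf) fv0 mulr0.
Qed.

(** The zero locus of a single form is closed, and every closed set is an intersection of such
    loci. *)
Lemma zclosureP X p : zclosure X p <->
  forall d f, form d f -> (forall q, X q -> vanishes f q) -> vanishes f p.
Proof.
split=> [clp d f hf fX|H Z [[S [hS ->]] XZ] /= f Sf].
  apply: (clp [set q | vanishes f q]); split=> //.
  exists [set f]; split=> [_ ->|]; first by exists d.
  by apply/seteqP; split=> q /=; [move=> ? _ -> | apply].
by have [d hf] := hS f Sf; apply: (H d) => // q Xq; apply: (XZ q).
Qed.

Lemma zclosure_vanish X d f p v : form d f ->
  (forall q w, X q -> hcoord q w -> f w = 0) -> zclosure X p -> hcoord p v -> f v = 0.
Proof.
move=> hf fX /zclosureP clp pv; apply/(vanishesP hf pv)/(clp d) => // q Xq.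
by have [w qw] := hcoord_ex q; apply/(vanishesP hf qw); apply: fX qw.
Qed.

End Projective.

(* A morphism given on each chart [g i != 0] by the forms [F i] *)
Lemma regular_glue (K : fieldType) (V W : lmodType K) (X : set (proj V))
    (Y : set (proj W)) (J : Type) (d e : J -> nat) (F : J -> V -> W)
    (g : J -> V -> K) :
  (forall i, form_map (d i) (F i)) -> (forall i, form (e i) (g i)) ->
  (forall p v, X p -> hcoord p v -> exists i, g i v != 0) ->
  (forall p v i, X p -> hcoord p v -> g i v != 0 ->
     F i v != 0 /\ forall q, hcoord q (F i v) -> Y q) ->
  (forall p v i j, X p -> hcoord p v -> g i v != 0 -> g j v != 0 ->
     exists a, F j v = a *: F i v) ->
  exists phi : X -> Y, regular_map phi /\
    forall (p : X) v i, hcoord (\val p) v -> g i v != 0 ->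
      hcoord (\val (phi p)) (F i v).
Proof.
move=> hF hg cov mapXY compat.
(* The image must be described by every chart and every coordinate vector of [p] at once:
   homogeneity handles the change of vector, the proportionality hypothesis the change of chart. *)
have ex (p : X) : exists y : Y, forall v i, hcoord (\val p) v -> g i v != 0 ->
    hcoord (\val y) (F i v).
  have Xp : X (\val p) by apply: set_valP.
  have [v pv] := hcoord_ex (\val p); have [i giv] := cov _ _ Xp pv.
  have [Fv0 FY] := mapXY _ _ _ Xp pv giv.
  have Yq := FY _ (hcoord_mkproj Fv0).
  exists (SigSub (mem_set Yq)) => w j pw gjw /=.
  have [a a0 wE] := hcoord_scale pv pw.
  have gjv : g j v != 0.
    by apply: contraNneq gjw => gjv; rewrite wE (form_homog _ _ (hg j)) gjv mulr0.
  have [b FE] := compat _ _ _ _ Xp pv giv gjv.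
  have [Fjv0 _] := mapXY _ _ _ Xp pv gjv.
  rewrite wE (form_map_homog _ _ (hF j)) FE scalerA; apply: hcoordZ.
    apply: mulf_neq0; first exact: expf_neq0.
    by apply: contraNneq Fjv0 => b0; rewrite FE b0 scale0r.
  exact: hcoord_mkproj.
pose phi p := projT1 (cid (ex p)); have phiP p := projT2 (cid (ex p)).
exists phi; split=> [p|p v i]; last exact: phiP.
have Xp : X (\val p) by apply: set_valP.
have [v pv] := hcoord_ex (\val p); have [i giv] := cov _ _ Xp pv.
exists [set q | ~ vanishes (g i) q], (d i), (F i); split=> //.
- exists [set g i]; split=> [_ ->|]; first by exists (e i).
  apply/seteqP; split=> q /=; first by move=> /contrapT ? _ ->.
  by move=> H; apply; apply: H.
- by move=> /(vanishesP (hg i) pv) => gv0; rewrite gv0 eqxx in giv.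
- move=> q w nv qw; apply: phiP => //.
  by apply/eqP => gw0; apply: nv; apply/(vanishesP (hg i) qw).
Qed.

(** * Veronese maps between projective toric varieties *)

Section SeparatePoly.
Variables (K : numFieldType) (I : finType).
Implicit Types (g h : {ffun I -> K} -> K) (c : {ffun I -> K}).

Definition upd c x t : {ffun I -> K} := [ffun y => if y == x then t else c y].

(** Being polynomial in each variable separately is enough for the density argument, and avoids
    multivariate polynomials. *)
Variant sep_poly g : Prop :=
  SepPoly of forall c x, exists p : {poly K}, forall t, g (upd c x t) = p.[t].

Lemma sep_poly_cst a : sep_poly (fun=> a).
Proof. by split=> c x; exists a%:P => t; rewrite hornerC. Qed.

Lemma sep_polyD g h : sep_poly g -> sep_poly h -> sep_poly (fun c => g c + h c).
Proof.
move=> [hg] [hh]; split=> c x; have [p pE] := hg c x; have [q qE] := hh c x.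
by exists (p + q) => t; rewrite hornerD pE qE.
Qed.

Lemma sep_polyM g h : sep_poly g -> sep_poly h -> sep_poly (fun c => g c * h c).
Proof.
move=> [hg] [hh]; split=> c x; have [p pE] := hg c x; have [q qE] := hh c x.
by exists (p * q) => t; rewrite hornerM pE qE.
Qed.

Lemma sep_poly_sum (J : Type) (s : seq J) (F : J -> {ffun I -> K} -> K) :
  (forall j, sep_poly (F j)) -> sep_poly (fun c => \sum_(j <- s) F j c).
Proof.
move=> hF; elim: s => [|j s IH].
  by under eq_fun do rewrite big_nil; apply: sep_poly_cst.
by under eq_fun do rewrite big_cons; apply: sep_polyD.
Qed.

Lemma sep_poly_prod (J : Type) (s : seq J) (F : J -> {ffun I -> K} -> K) :
  (forall j, sep_poly (F j)) -> sep_poly (fun c => \prod_(j <- s) F j c).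
Proof.
move=> hF; elim: s => [|j s IH].
  by under eq_fun do rewrite big_nil; apply: sep_poly_cst.
by under eq_fun do rewrite big_cons; apply: sep_polyM.
Qed.

Lemma sep_poly_pow y k : sep_poly (fun c => c y ^+ k).
Proof.
split=> c x; exists (if y == x then 'X^k else (c y ^+ k)%:P) => t.
by rewrite ffunE; case: eqP => _; rewrite ?hornerXn ?hornerC.
Qed.

Lemma poly_eq0_punctured (p : {poly K}) : (forall t, t != 0 -> p.[t] = 0) -> p = 0.
Proof.
move=> H; apply/eqP; apply: contraT => p0.
have := @max_poly_roots _ p [seq i.+1%:R | i <- iota 0 (size p)] p0.
(* The nonzero elements 1, ..., size p are distinct roots in characteristic 0, which is too many for
   a nonzero [p]. *)
rewrite size_map size_iota ltnn => -> //.
  by apply/allP => _ /mapP[i _ ->]; apply/eqP/H; rewrite pnatr_eq0.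
rewrite map_inj_uniq ?iota_uniq // => i j /eqP; rewrite eqr_nat.
by move=> /eqP [].
Qed.

(** Induction on the number of zero coordinates of [c]: varying one of them gives a polynomial that
    vanishes away from 0 by induction, hence also at 0. *)
Lemma sep_poly_torus g : sep_poly g ->
  (forall t : {ffun I -> K}, (forall x, t x != 0) -> g t = 0) -> forall c, g c = 0.
Proof.
move=> [hg] g0 c; have [m] := ubnP #|[set x | c x == 0]%SET|.
elim: m c => // m IH c; rewrite ltnS => hm.
case: (boolP [forall x, c x != 0]) => [/forallP/g0 //|].
rewrite negb_forall => /existsP[x]; rewrite negbK => /eqP cx.
have -> : c = upd c x 0 by apply/ffunP => y; rewrite ffunE; case: eqP => // ->.
have [p pE] := hg c x; rewrite pE (@poly_eq0_punctured p) ?horner0 // => t t0.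
rewrite -pE; apply: IH; apply: leq_trans hm.
apply: proper_card; apply/properP; split.
  by apply/fintype.subsetP => y; rewrite !inE ffunE; case: (eqVneq y x) => // _; rewrite (negPf t0).
by exists x; rewrite !inE ?cx // ffunE eqxx.
Qed.

End SeparatePoly.

(** * The Veronese isomorphism onto the toric variety of k-fold sums of exponents *)

Section Veronese.
Variables (K : numFieldType) (I : finType) (V : lmodType K) (J : finType).
Variables (ex : J -> {ffun I -> nat}) (xi : J -> {scalar V}) (e : J -> V).
Hypothesis xi_span : forall v, v = \sum_j xi j v *: e j.
Hypothesis xi_e : forall i j, xi i (e j) = (i == j)%:R.
Variable alpha : {ffun I -> K} -> V.
Hypothesis xi_alpha : forall c j, xi j (alpha c) = \prod_x c x ^+ ex j x.
Variable j0 : J.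
Hypothesis ex_j0 : forall x, ex j0 x = 0%N.
Variables (k' : nat) (B : {fset lattice I}).
Let k := k'.+1.
Let sum_ex (s : 'I_k -> J) : lattice I := [ffun x => (\sum_i ex (s i) x)%:Z].
Hypothesis B_sum : forall s, sum_ex s \in B.
Hypothesis B_dec : forall m, m \in B -> exists s, m = sum_ex s.

Let W := {ffun B -> K^o}.
Let tot (s : 'I_k -> J) : B := FSetSub (B_sum s).
(** One decomposition of [m] is fixed. By [X_relation] the product of coordinates attached to it is
    the same on X for every other decomposition. *)
Let dec (m : B) : 'I_k -> J := projT1 (cid (B_dec (valP m))).

Lemma dec_tot m : tot (dec m) = m.
Proof. by apply: val_inj; rewrite /= /dec; case: cid. Qed.

Let cons_ix (j : J) (tau : 'I_k' -> J) (i : 'I_k) : J :=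
  if unlift ord0 i is Some i' then tau i' else j.

Let torus_orbit : set (proj W) :=
  [set p | exists t : {ffun I -> K}, (forall x, t x != 0) /\ hcoord p (torus_point B t)].
Let X := zclosure [set p | exists c, hcoord p (alpha c)].
Let Y := zclosure torus_orbit.

Lemma torus_pointE (t : {ffun I -> K}) m :
  torus_point B t m = \prod_i \prod_x t x ^+ ex (dec m i) x.
Proof.
rewrite ffunE exchange_big; apply: eq_bigr => x _ /=.
by rewrite -[in LHS](dec_tot m) /= ffunE -exprnP -expr_sum.
Qed.

Lemma torus_point_tot (t : {ffun I -> K}) s :
  torus_point B t (tot s) = \prod_i \prod_x t x ^+ ex (s i) x.
Proof.
rewrite ffunE exchange_big; apply: eq_bigr => x _ /=.
by rewrite ffunE -exprnP -expr_sum.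
Qed.

Lemma alpha_neq0 c : alpha c != 0.
Proof.
apply: contra_eq_neq (xi_alpha c j0) => ->.
by rewrite linear0 eq_sym big1 ?oner_eq0 // => x _; rewrite ex_j0 expr0.
Qed.

(** The binomial is a form that vanishes at every [alpha c], hence on the closure. *)
Lemma X_relation d (s s' : 'I_d.+1 -> J) p v :
  (forall x, \sum_i ex (s i) x = \sum_i ex (s' i) x)%N ->
  X p -> hcoord p v -> \prod_i xi (s i) v = \prod_i xi (s' i) v.
Proof.
move=> ss' Xp pv; apply/eqP; rewrite -subr_eq0; apply/eqP.
have form_mon (u : 'I_d.+1 -> J) : form d.+1 (fun v => \prod_i xi (u i) v).
  exact: form_monomial.
apply: (zclosure_vanish (formB (form_mon s) (form_mon s')) _ Xp pv) => q w [c qc] qw.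
have [a a0 ->] := hcoord_scale qc qw; apply/eqP; rewrite subr_eq0; apply/eqP.
have E (u : 'I_d.+1 -> J) : \prod_i xi (u i) (a *: alpha c) = a ^+ d.+1 * \prod_x c x ^+ (\sum_i ex (u i) x).
  under eq_bigr do rewrite linearZ xi_alpha.
  rewrite big_split /= prodr_const card_ord exchange_big; congr (_ * _).
  by apply: eq_bigr => x _; rewrite -prodrXr.
by rewrite !E; congr (_ * _); apply: eq_bigr => x _; rewrite ss'.
Qed.

Lemma coord_lin (m : B) a (x y : W) : (a *: x + y) m = a * x m + y m.
Proof. by rewrite !ffunE. Qed.

Definition coord m : {scalar W} := make_scalar (coord_lin m).

Lemma Y_relation d (s s' : 'I_d.+1 -> B) p (y : W) :
  (forall x, \sum_i (\val (s i) x) = \sum_i (\val (s' i) x)) ->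
  Y p -> hcoord p y -> \prod_i y (s i) = \prod_i y (s' i).
Proof.
move=> ss' Yp py; apply/eqP; rewrite -subr_eq0; apply/eqP.
have form_mon (u : 'I_d.+1 -> B) : form d.+1 (fun y : W => \prod_i (y (u i) : K)).
  exact: (form_monomial (fun i => coord (u i))).
apply: (zclosure_vanish (formB (form_mon s) (form_mon s')) _ Yp py) => q w [t [t0 qt]] qw.
have [a a0 ->] := hcoord_scale qt qw; apply/eqP; rewrite subr_eq0; apply/eqP.
have E (u : 'I_d.+1 -> B) : \prod_i (a *: torus_point B t) (u i) =
    a ^+ d.+1 * \prod_x t x ^ (\sum_i \val (u i) x).
  under eq_bigr => i _ do rewrite ffunE [_ *: _]/GRing.scale /= ffunE.
  rewrite big_split /= prodr_const card_ord exchange_big; congr (_ * _).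
  apply: eq_bigr => x _; apply/esym.
  by apply: (big_morph (fun z : int => t x ^ z)) => [z z'|]; rewrite ?expr0z ?expfzDr.
by rewrite !E; congr (_ * _); apply: eq_bigr => x _; rewrite ss'.
Qed.

(** The k-th Veronese map, with a single coordinate for all monomials of the same exponent. *)
Let F (v : V) : W := \sum_m (\prod_i xi (dec m i) v) *: [ffun m' => (m' == m)%:R].

Lemma F_E v m : F v m = \prod_i xi (dec m i) v.
Proof.
rewrite sum_ffunE (bigD1 m) //= !ffunE eqxx [X in _ + X]big1 => [|m' mm'].
  by rewrite addr0 [_ *: _]mulr1.
by rewrite !ffunE eq_sym (negPf mm') scaler0.
Qed.

Lemma F_form : form_map k F.
Proof.
by apply: form_map_fin => m; apply: form_monomial.
Qed.

Lemma F_tot s p v : X p -> hcoord p v -> F v (tot s) = \prod_i xi (s i) v.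
Proof.
move=> Xp pv; rewrite F_E; apply: X_relation Xp pv => x.
have /(congr1 val)/= /ffunP/(_ x) := dec_tot (tot s).
by rewrite !ffunE => -[].
Qed.

(** A form vanishing on the torus orbit, composed with [F] and [alpha], is separately polynomial in
    c and vanishes on the torus. By density it vanishes for all c, including those with zero
    coordinates. *)
Lemma F_Y p v q : X p -> hcoord p v -> hcoord q (F v) -> Y q.
Proof.
move=> Xp pv qF; apply/zclosureP => d f hf fY.
apply/(vanishesP hf qF).
apply: (zclosure_vanish (form_comp hf F_form) _ Xp pv) => r w [c rc] rw.
have [a a0 ->] := hcoord_scale rc rw.
rewrite (form_map_homog _ _ F_form) (form_homog _ _ hf).
suff -> : f (F (alpha c)) = 0 by rewrite mulr0.
move: c {rc}; apply: sep_poly_torus => [|t t0].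
  case: hf => m [l ->]; apply: sep_poly_sum => i; apply: sep_poly_prod => j.
  have E c : l i j (F (alpha c)) = \sum_m
      (\prod_s \prod_x c x ^+ ex (dec m s) x) * l i j [ffun m' => (m' == m)%:R].
    rewrite linear_sum; apply: eq_bigr => m' _; rewrite linearZ /=; congr (_ * _).
    by apply: eq_bigr => s _; rewrite xi_alpha.
  under eq_fun do rewrite E.
  apply: sep_poly_sum => m'; apply: sep_polyM; last exact: sep_poly_cst.
  apply: sep_poly_prod => s; apply: sep_poly_prod => x; exact: sep_poly_pow.
have E : F (alpha t) = torus_point B t.
  by apply/ffunP => m; rewrite F_E torus_pointE; under eq_bigr do rewrite xi_alpha.
have T0 : torus_point B t != 0.
  apply/eqP => /ffunP/(_ (tot (fun=> j0))); rewrite torus_point_tot ffunE => /eqP.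
  by rewrite big1 ?oner_eq0 // => i _; rewrite big1 // => x _; rewrite ex_j0.
rewrite E; apply/(vanishesP hf (hcoord_mkproj T0))/fY.
by exists t; split=> //; apply: hcoord_mkproj.
Qed.

(** A local inverse of [F]: for v on X, [G tau (F v)] is v times the product of the coordinates
    [xi (tau i) v]. *)
Let G (tau : 'I_k' -> J) (y : W) : V := \sum_j y (tot (cons_ix j tau)) *: e j.

Lemma xi_sum (a : J -> K) i : xi i (\sum_j a j *: e j) = a i.
Proof.
rewrite linear_sum /= (bigD1 i) //= linearZ xi_e eqxx /= mulr1 big1 ?addr0 // => j ji.
by rewrite linearZ xi_e eq_sym (negPf ji) /= mulr0.
Qed.

Lemma xi_inj v w : (forall j, xi j v = xi j w) -> v = w.
Proof. by move=> H; rewrite (xi_span v) (xi_span w); under eq_bigr do rewrite H. Qed.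

Lemma G_E tau y j : xi j (G tau y) = y (tot (cons_ix j tau)).
Proof. exact: xi_sum. Qed.

Lemma G_form tau : form_map 1 (G tau).
Proof.
apply: form_map_fin => j; exact: (form_scalar (coord _)).
Qed.

Lemma big_cons_ix (R : Type) (idx : R) (op : Monoid.law idx) (f : J -> R) j tau :
  \big[op/idx]_i f (cons_ix j tau i) = op (f j) (\big[op/idx]_i f (tau i)).
Proof.
rewrite big_ord_recl /cons_ix unlift_none; congr (op _ _).
by apply: eq_bigr => i _; rewrite liftK.
Qed.

Lemma cons_dec m : exists j tau, dec m = cons_ix j tau.
Proof.
exists (dec m ord0), (fun i => dec m (lift ord0 i)); apply/funext => i.
by rewrite /cons_ix; case: unliftP => [i' ->|->].
Qed.

(** On the torus orbit, [G tau] sends the point of t to a multiple of [alpha t], the factor being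
    the monomial of exponent sum [tau]. *)
Lemma G_X tau p y q : Y p -> hcoord p y -> hcoord q (G tau y) -> X q.
Proof.
move=> Yp py qG; apply/zclosureP => d f hf fX.
apply/(vanishesP hf qG).
apply: (zclosure_vanish (form_comp hf (G_form tau)) _ Yp py) => r w [t [t0 rt]] rw.
have [a a0 ->] := hcoord_scale rt rw.
rewrite (form_map_homog _ _ (G_form tau)) (form_homog _ _ hf).
have -> : G tau (torus_point B t) = (\prod_i \prod_x t x ^+ ex (tau i) x) *: alpha t.
  apply: xi_inj => j; rewrite G_E linearZ xi_alpha torus_point_tot /= mulrC.
  exact: (big_cons_ix _ (fun j => \prod_x t x ^+ ex j x)).
rewrite (form_homog _ _ hf).
suff -> : f (alpha t) = 0 by rewrite !mulr0.
apply/(vanishesP hf (hcoord_mkproj (alpha_neq0 t)))/fX.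
by exists t; apply: hcoord_mkproj.
Qed.

Lemma val_tot_cons j tau x :
  \val (tot (cons_ix j tau)) x = (ex j x)%:Z + (\sum_i ex (tau i) x)%:Z.
Proof. by rewrite /= ffunE (big_cons_ix _ (fun j => ex j x)). Qed.

(** The vectors [G tau y] and [G tau' y] are proportional because their 2 x 2 minors are binomial
    relations of Y. *)
Lemma G_compat tau tau' p y j : Y p -> hcoord p y ->
  y (tot (cons_ix j tau)) != 0 -> exists a, G tau' y = a *: G tau y.
Proof.
move=> Yp py y0; exists (y (tot (cons_ix j tau')) / y (tot (cons_ix j tau))).
apply: xi_inj => i; rewrite linearZ !G_E /=; apply: (mulIf y0).
rewrite mulrAC divfK // [RHS]mulrC.
have := @Y_relation 1 (fun l => if l == ord0 then tot (cons_ix i tau') else tot (cons_ix j tau))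
  (fun l => if l == ord0 then tot (cons_ix i tau) else tot (cons_ix j tau')) p y.
rewrite !big_ord_recl !big_ord0 /= !mulr1; apply=> // x.
rewrite !big_ord_recl !big_ord0 !addr0 !val_tot_cons addrACA [RHS]addrACA.
by congr (_ + _); rewrite addrC.
Qed.

Lemma veronese_isomorphic : isomorphic X (@projective_toric I K B).
Proof.
have covX p v : X p -> hcoord p v -> exists j, xi j v != 0.
  move=> _ [v0 _]; apply/existsP; apply: contraNT v0.
  rewrite negb_exists => /forallP v0; apply/eqP/xi_inj => j.
  by rewrite linear0; apply/eqP; rewrite -[_ == _]negbK.
have F_neq0 p v j : X p -> hcoord p v -> xi j v != 0 ->
    F v (tot (fun=> j)) != 0.
  move=> Xp pv xj; rewrite (F_tot _ Xp pv) prodr_const; exact: expf_neq0.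
have neq0_ffun (y : W) m : y m != 0 -> y != 0.
  by apply: contraNneq => ->; rewrite ffunE.
have [phi [phi_reg phiP]] := @regular_glue K V W X Y J (fun=> k) (fun=> 1%N)
  (fun=> F) (fun j => xi j) (fun=> F_form) (fun j => form_scalar (xi j)) covX
  (fun p v j Xp pv xj => conj (neq0_ffun _ _ (F_neq0 _ _ _ Xp pv xj))
    (fun q => F_Y Xp pv))
  (fun p v i j _ _ _ _ => ex_intro _ 1 (esym (scale1r _))).
have [psi [psi_reg psiP]] : exists psi : Y -> X, regular_map psi /\
    forall (q : Y) y (i : ('I_k' -> J) * J), hcoord (\val q) y ->
      y (tot (cons_ix i.2 i.1)) != 0 -> hcoord (\val (psi q)) (G i.1 y).
  apply: (@regular_glue K W V Y X _ (fun=> 1%N) (fun=> 1%N) (fun i => G i.1)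
    (fun i (y : W) => y (tot (cons_ix i.2 i.1)))) => [[tau j]|[tau j]|p y|p y [tau j]|p y [tau j] [tau' j']] /=.
  - exact: G_form.
  - exact: (form_scalar (coord _)).
  - move=> _ [y0 _]; have [m ym] : exists m, y m != 0.
      apply/existsP; apply: contraNT y0; rewrite negb_exists => /forallP y0.
      by apply/eqP/ffunP => m; rewrite ffunE; apply/eqP; rewrite -[_ == _]negbK.
    have [j [tau E]] := cons_dec m; exists (tau, j) => /=.
    by rewrite -E dec_tot.
  - move=> Yp py y0; split; last by move=> q; apply: G_X Yp py.
    by apply: contraNneq y0 => G0; rewrite -G_E G0 linear0.
  - by move=> Yp py y0 _; apply: G_compat Yp py y0.
exists phi, psi; split=> //.
- move=> p; apply: val_inj; have Xp : X (\val p) by apply: set_valP.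
  have [v pv] := hcoord_ex (\val p); have [j xj] := covX _ _ Xp pv.
  have pF := phiP p v j pv xj.
  have consE : cons_ix j (fun=> j) = (fun=> j).
    by apply/funext => i; rewrite /cons_ix; case: unlift.
  have := psiP (phi p) (F v) (fun=> j, j) pF; rewrite /= consE.
  move=> /(_ (F_neq0 _ _ _ Xp pv xj)) pG; apply: (hcoord_inj pG).
  have -> : G (fun=> j) (F v) = xi j v ^+ k' *: v.
    apply: xi_inj => i; rewrite G_E linearZ (F_tot _ Xp pv) /= mulrC.
    by rewrite (big_cons_ix _ (fun j => xi j v)) prodr_const card_ord.
  by apply: hcoordZ => //; apply: expf_neq0.
- move=> q; apply: val_inj; have Yq : Y (\val q) by apply: set_valP.
  have [y qy] := hcoord_ex (\val q).
  have [m ym] : exists m, y m != 0.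
    apply/existsP; apply: contraNT qy.1; rewrite negb_exists => /forallP y0.
    by apply/eqP/ffunP => m; rewrite ffunE; apply/eqP; rewrite -[_ == _]negbK.
  have [j [tau E]] := cons_dec m; rewrite -(dec_tot m) E in ym.
  have qG := psiP q y (tau, j) qy ym.
  have /(phiP (psi q) _ j qG) qF : xi j (G tau y) != 0 by rewrite G_E.
  apply: (hcoord_inj qF).
  (* At m' the left side is a product of k coordinates of y, with total exponent m' plus k times the
     sum of the exponents of [tau]. The same total arises from m' and the k' points k * ex (tau i),
     so [Y_relation] applies. *)
  have E' : F (G tau y) = (\prod_i y (tot (fun=> tau i))) *: y.
    apply/ffunP => m'; rewrite ffunE F_E; under eq_bigr do rewrite G_E.
    pose s' i := if unlift ord0 i is Some i' then tot (fun=> tau i') else m'.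
    rewrite (@Y_relation _ _ s' _ _ _ Yq qy) => [|x].
      rewrite big_ord_recl /s' unlift_none [RHS]mulrC; congr (_ * _).
      by apply: eq_bigr => i _; rewrite liftK.
    under eq_bigr do rewrite val_tot_cons.
    rewrite big_split /= [in RHS]big_ord_recl {1}/s' unlift_none.
    congr (_ + _).
      by rewrite -[in RHS](dec_tot m') /= ffunE -[RHS]/(Posz _) (big_morph Posz PoszD (erefl _)).
    under [RHS]eq_bigr do rewrite /s' liftK /= ffunE.
    rewrite sumr_const card_ord.
    under [RHS]eq_bigr do rewrite sum_nat_const card_ord.
    by rewrite -(big_morph Posz PoszD (erefl _)) -big_distrr /= PoszM -(natz k) mulr_natl.
  rewrite E'; apply: hcoordZ => //.
  by apply: contraNneq qF.1 => c0; rewrite E' c0 scale0r.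
Qed.

End Veronese.

(** * Lattice points of Gelfand-Tsetlin polytopes *)

Section PatternPoints.
Variable n : nat.
Implicit Types (T : {ffun ixpair n -> nat}) (lam : 'I_n.-1 -> nat).

Definition rsum T (i j : nat) : nat :=
  (\sum_(x : ixpair n | (fst_ix x == i :> nat) && (j <= snd_ix x)) T x)%N.

(** The negative sum is moved to the right to stay within natural numbers. The index j needs no
    upper bound, since the left side is 0 for j >= n. *)
Definition gt_point lam T : Prop := forall (k : 'I_n.-1) (j : nat), (k < j)%N ->
  (rsum T k j <= lam k + rsum T k.+1 j.+1)%N.

Lemma ixpair_lt (x : ixpair n) : (fst_ix x < snd_ix x)%N.
Proof. exact: (valP x). Qed.

Lemma ixpair_eqP (x y : ixpair n) :
  fst_ix x = fst_ix y :> nat -> snd_ix x = snd_ix y :> nat -> x = y.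
Proof.
case: x y => [[a b] h] [[a' b'] h'] /= aa' bb'; apply: val_inj => /=.
by congr pair; apply: val_inj.
Qed.

Definition mkix (i j : nat) (ij : (i < j)%N) (jn : (j < n)%N) : ixpair n :=
  exist _ (Ordinal (ltn_trans ij jn), Ordinal jn) ij.

Lemma rsum_ge T i j : (n <= j)%N -> rsum T i j = 0%N.
Proof.
move=> nj; rewrite /rsum big1 // => x /andP[_ jx].
by have := leq_trans nj jx; rewrite leqNgt ltn_ord.
Qed.

Lemma rsum_out T i j : (n.-1 <= i)%N -> rsum T i j = 0%N.
Proof.
move=> ni; rewrite /rsum big1 // => x /andP[/eqP xi _].
have : (fst_ix x < n.-1)%N.
  by rewrite ltn_predRL (leq_ltn_trans (ixpair_lt x)).
by rewrite xi ltnNge ni.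
Qed.

Lemma rsum_step T i j (ij : (i < j)%N) (jn : (j < n)%N) :
  rsum T i j = (T (mkix ij jn) + rsum T i j.+1)%N.
Proof.
rewrite /rsum (bigD1 (mkix ij jn)) /= ?eqxx ?leqnn //; congr addn.
apply: eq_bigl => x; rewrite -andbA; case: (eqVneq (fst_ix x : nat) i) => //= xi.
rewrite [RHS]ltn_neqAle andbC; congr andb; congr negb.
apply/eqP/eqP => [->//|jx]; exact: ixpair_eqP.
Qed.

Lemma rsum_ix T x : rsum T (fst_ix x) (snd_ix x) = (T x + rsum T (fst_ix x) (snd_ix x).+1)%N.
Proof.
rewrite (rsum_step _ (ixpair_lt x) (ltn_ord (snd_ix x))); congr (T _ + _)%N.
exact: ixpair_eqP.
Qed.

Lemma rsum_anti T i j j' : (j <= j')%N -> (rsum T i j' <= rsum T i j)%N.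
Proof.
move=> jj'; rewrite /rsum [leqRHS](bigID (fun x => j' <= snd_ix x)%N) /=.
apply: leq_trans (leq_addr _ _); rewrite leq_eqVlt; apply/orP; left; apply/eqP.
apply: eq_bigl => x; rewrite -andbA; congr andb.
by case: (leqP j' (snd_ix x)) => h; rewrite ?andbF ?andbT // (leq_trans jj' h).
Qed.

Lemma rsum_telescope (g : nat -> nat -> nat) i j :
  (forall j, (g i j.+1 <= g i j)%N) -> (i < j <= n)%N ->
  rsum [ffun x => g (fst_ix x) (snd_ix x) - g (fst_ix x) (snd_ix x).+1]%N i j =
  (g i j - g i n)%N.
Proof.
move=> g_anti /andP[]; have [m] := ubnP (n - j)%N.
elim: m j => // m IH j; rewrite ltnS => hm ij.
rewrite leq_eqVlt => /orP[/eqP ->|jn]; first by rewrite rsum_ge ?subnn.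
rewrite (rsum_step _ ij jn) IH ?ffunE ?ltnS ?(ltnW ij) //=; last first.
  by apply: leq_trans hm; rewrite ltn_sub2l.
have gn : (g i n <= g i j.+1)%N.
  elim: {+}n jn => // p IHp; rewrite ltnS leq_eqVlt => /orP[/eqP -> //|/IHp].
  exact: leq_trans.
by rewrite addnBA // subnK.
Qed.

(** The inequalities are iterated along the diagonal (i, j), (i+1, j+1), ... until the rows run out.
    This makes the polytope bounded. *)
Lemma rsum_bound lam T i j : gt_point lam T -> (i < j)%N ->
  (rsum T i j <= \sum_(k : 'I_n.-1 | i <= k) lam k)%N.
Proof.
move=> hT; have [m] := ubnP (n.-1 - i)%N.
elim: m i j => // m IH i j; rewrite ltnS => hm ij.
case: (leqP n.-1 i) => ni; first by rewrite rsum_out.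
apply: (leq_trans (hT (Ordinal ni) j ij)).
rewrite [leqRHS](bigD1 (Ordinal ni)) //= leq_add2l.
apply: (leq_trans (IH i.+1 _ _ _)) => //; first by apply: leq_trans hm; rewrite ltn_sub2l.
rewrite [leqRHS](bigID (fun k : 'I_n.-1 => i < k)%N) /=.
apply: leq_trans (leq_addr _ _); rewrite leq_eqVlt; apply/orP; left; apply/eqP.
apply: eq_bigl => k; case: ltnP => // ik; rewrite ?andbF // andbT (ltnW ik) /=.
by rewrite -val_eqE /= gtn_eqF.
Qed.

Lemma gt_point_bound lam T x : gt_point lam T -> (T x <= \sum_k lam k)%N.
Proof.
move=> hT; apply: leq_trans (leq_addr (rsum T (fst_ix x) (snd_ix x).+1) _) _.
rewrite -rsum_ix; apply: leq_trans (rsum_bound hT (ixpair_lt x)) _.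
by rewrite [leqRHS](bigID (fun k : 'I_n.-1 => fst_ix x <= k)%N) leq_addr.
Qed.

(** Passing from s to s+1 shifts the window of summands: the quotient of s leaves and that of s+k+1,
    larger by one, enters. *)
Lemma sum_floor_shift k s : (\sum_(r < k.+1) (s + r) %/ k.+1)%N = s.
Proof.
elim: s => [|s IH].
  by rewrite big1 // => r _; rewrite divn_small // add0n ltn_ord.
rewrite big_ord_recr /= [(s.+1 + k)%N]addSnnS divnDr // divnn /= addnA.
rewrite -[in RHS]IH [in RHS]big_ord_recl addn0 addn1 [RHS]/=; congr S.
by rewrite [RHS]addnC; congr addn; apply: eq_bigr => r _; rewrite addSnnS.
Qed.

(* Rounding the row sums up or down preserves the defining inequalities, and
   the k roundings of s/k add up to s by Hermite's identity. *)
Lemma gt_point_decompose lam k T : gt_point (fun i => k.+1 * lam i)%N T ->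
  exists s : 'I_k.+1 -> {ffun ixpair n -> nat},
    (forall r, gt_point lam (s r)) /\ forall x, T x = (\sum_r s r x)%N.
Proof.
move=> hT; pose g (r i j : nat) := ((rsum T i j + r) %/ k.+1)%N.
have g_anti r i j : (g r i j.+1 <= g r i j)%N.
  by apply: leq_div2r; rewrite leq_add2r; apply: rsum_anti.
pose s (r : 'I_k.+1) : {ffun ixpair n -> nat} :=
  [ffun x => g r (fst_ix x) (snd_ix x) - g r (fst_ix x) (snd_ix x).+1]%N.
have sE (r : 'I_k.+1) i j : (i < j)%N -> rsum (s r) i j = g r i j.
  move=> ij; case: (leqP j n) => jn; last first.
    by rewrite rsum_ge ?(ltnW jn) // /g rsum_ge ?(ltnW jn) // divn_small // ltn_ord.
  rewrite rsum_telescope ?ij // [X in (_ - X)%N](_ : _ = 0%N) ?subn0 //.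
  by rewrite /g rsum_ge // divn_small // ltn_ord.
exists s; split=> [r i j ij|x].
  (* The term (k+1) lam i is divisible by k+1, so it passes through the floor and monotonicity
     suffices. *)
  rewrite !sE ?ltnS // /g -[lam i](@mulKn _ k.+1) // -divnDl ?dvdn_mulr //.
  by apply: leq_div2r; rewrite addnA leq_add2r hT.
under eq_bigr do rewrite ffunE.
rewrite sumnB => [|r _]; last exact: g_anti.
by rewrite !sum_floor_shift rsum_ix addnK.
Qed.

Lemma gt_point_sum lam (J : finType) (s : J -> {ffun ixpair n -> nat}) :
  (forall r, gt_point lam (s r)) ->
  gt_point (fun i => #|J| * lam i)%N [ffun x => \sum_r s r x]%N.
Proof.
move=> hs i j ij; have E i' j' : rsum [ffun x => \sum_r s r x]%N i' j' = (\sum_r rsum (s r) i' j')%N.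
  by rewrite /rsum exchange_big; apply: eq_bigr => x _; rewrite ffunE.
rewrite !E -sum_nat_const -big_split; apply: leq_sum => r _; exact: hs.
Qed.

Definition to_lattice T : lattice (ixpair n) := [ffun x => (T x)%:Z].

Variable R : realType.

(** The inequalities are homogeneous in T and lam together, so dilating the polytope amounts to
    multiplying lam. *)
Lemma dilate_gtP lam k (m : lattice (ixpair n)) :
  dilate k.+1 (GT_polytope R lam) (realpt R m) <->
  exists2 T, gt_point (fun i => k.+1 * lam i)%N T & m = to_lattice T.
Proof.
have k0 : (0 : R) < k.+1%:R by rewrite ltr0n.
have sumE (T : {ffun ixpair n -> nat}) P :
    \sum_(x | P x) ((k.+1%:R)^-1 * (T x)%:R) = (k.+1%:R)^-1 * (\sum_(x | P x) T x)%:R :> R.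
  by rewrite -big_distrr natr_sum.
have ineqE (T : {ffun ixpair n -> nat}) (i : 'I_n.-1) (j : nat) :
    ((k.+1%:R : R)^-1 * (rsum T i j)%:R - (k.+1%:R)^-1 * (rsum T i.+1 j.+1)%:R <= (lam i)%:R)
    = (rsum T i j <= k.+1 * lam i + rsum T i.+1 j.+1)%N.
  by rewrite -mulrBr mulrC ler_pdivrMr // lerBlDr -natrM -natrD ler_nat mulnC.
split=> [[T [T0 hT] TE]|[T hT ->]].
- have m0 x : 0 <= m x.
    move/ffunP/(_ x): TE; rewrite !ffunE => mE.
    by rewrite -(ler0z R) -mE mulr_ge0 ?ler0n.
  pose T' := [ffun x => `|m x|%N].
  have T'E x : T x = (k.+1%:R)^-1 * (T' x)%:R.
    move/ffunP/(_ x): TE; rewrite !ffunE => mE.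
    rewrite natr_absz ger0_norm // -mE mulrA mulVf ?mul1r //; exact: lt0r_neq0.
  exists T'; last by apply/ffunP => x; rewrite !ffunE gez0_abs.
  move=> i j ij; case: (ltnP j n) => jn; last by rewrite rsum_ge.
  have := hT i (Ordinal jn) ij; rewrite -ineqE.
  by congr (_ <= _); congr (_ - _); rewrite -sumE; apply: eq_bigr.
- exists [ffun x => (k.+1%:R)^-1 * (T x)%:R]; last first.
    apply/ffunP => x; rewrite !ffunE mulrA mulfV ?mul1r //; exact: lt0r_neq0.
  split=> [x|i j ij]; first by rewrite ffunE mulr_ge0 ?ler0n // invr_ge0 ler0n.
  have := hT i j ij; rewrite -ineqE.
  by congr (_ <= _); congr (_ - _); rewrite -sumE; apply: eq_bigr => x _; rewrite ffunE.
Qed.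

Lemma finite_gt_points lam : finite_set [set T | gt_point lam T].
Proof.
pose N := (\sum_k lam k)%N.
apply: (@sub_finite_set _ _ [set T : {ffun ixpair n -> nat} | forall x, T x < N.+1]%N).
  by move=> T hT x; rewrite ltnS; apply: gt_point_bound.
pose f (T : {ffun ixpair n -> 'I_N.+1}) : {ffun ixpair n -> nat} := [ffun x => T x : nat].
apply: (@sub_finite_set _ _ (f @` [set: {ffun ixpair n -> 'I_N.+1}])).
  move=> T hT; exists [ffun x => Ordinal (hT x)] => //.
  by apply/ffunP => x; rewrite !ffunE.
exact/finite_image/finite_finset.
Qed.

Lemma lattice_points_gtP lam k (m : lattice (ixpair n)) :
  m \in lattice_points (dilate k.+1 (GT_polytope R lam)) <->
  exists2 T, gt_point (fun i => k.+1 * lam i)%N T & m = to_lattice T.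
Proof.
(* Finiteness must be shown before membership can be unfolded: [fset_set] of an infinite set is
   empty. *)
rewrite /lattice_points in_fset_set; last first.
  apply: (@sub_finite_set _ _ (to_lattice @` [set T | gt_point (fun i => k.+1 * lam i)%N T])).
    by move=> m' /dilate_gtP[T hT ->]; exists T.
  exact/finite_image/finite_gt_points.
by rewrite -dilate_gtP inE.
Qed.

End PatternPoints.

(** * Highest weight vectors *)

Section SpanInduction.
Variables (K : fieldType) (V : lmodType K).
Implicit Types S : set V.

Lemma lspan_ind S (Q : V -> Prop) :
  (forall x, S x -> Q x) -> Q 0 ->
  (forall a x y, Q x -> Q y -> Q (a *: x + y)) -> forall x, lspan S x -> Q x.
Proof. by move=> SQ Q0 QD x; apply; split. Qed.

Lemma lspan_sub S x : S x -> lspan S x.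
Proof. by move=> Sx W [_]; apply. Qed.

Lemma lspanP S a x y : lspan S x -> lspan S y -> lspan S (a *: x + y).
Proof. by have [_ +] := lspan_subspace S; apply. Qed.

Lemma lspan0 S : lspan S 0.
Proof. by have [] := lspan_subspace S. Qed.

Lemma lspanD S x y : lspan S x -> lspan S y -> lspan S (x + y).
Proof. by rewrite -[x in x + y]scale1r; apply: lspanP. Qed.

Lemma lspanZ S a x : lspan S x -> lspan S (a *: x).
Proof. by move=> Sx; rewrite -[a *: x]addr0; apply: lspanP => //; apply: lspan0. Qed.

Lemma lspan_sum S (J : Type) (s : seq J) (P : pred J) (F : J -> V) :
  (forall j, P j -> lspan S (F j)) -> lspan S (\sum_(j <- s | P j) F j).
Proof. by move=> H; apply: big_ind => //; [apply: lspan0 | apply: lspanD]. Qed.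

End SpanInduction.

Lemma lspan_map (K : fieldType) (V W : lmodType K) (f : {linear V -> W})
    (S : set V) (S' : set W) x :
  (forall y, S y -> lspan S' (f y)) -> lspan S x -> lspan S' (f x).
Proof.
move=> H; elim/lspan_ind: x / => [//||a x y fx fy]; first by rewrite linear0; apply: lspan0.
by rewrite linearP; apply: lspanP.
Qed.

Section Representations.
Variables (K : numFieldType) (n : nat).

(** A common notion for L, for the tensor model and for their product. Linearity and brackets are
    required on traceless matrices only, as in [sl_rep]. *)
Definition is_rep (M : lmodType K) (act : 'M[K]_n -> M -> M) : Prop :=
  [/\ forall A, linear (act A),
    forall a A B, \tr A = 0 -> \tr B = 0 -> forall x,
      act (a *: A + B) x = a *: act A x + act B x &
    forall A B, \tr A = 0 -> \tr B = 0 -> forall x,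
      act (bracket A B) x = act A (act B x) - act B (act A x)].

Definition is_hwv (M : lmodType K) (act : 'M[K]_n -> M -> M)
    (lam : 'I_n.-1 -> nat) (v : M) : Prop :=
  (forall i j : 'I_n, (i < j)%N -> act (delta_mx i j) v = 0) /\
  (forall (k : 'I_n.-1) (i j : 'I_n), i = k :> nat -> j = k.+1 :> nat ->
      act (delta_mx i i - delta_mx j j) v = (lam k)%:R *: v).

Lemma mxtrace_delta (i j : 'I_n) : \tr (delta_mx i j : 'M[K]_n) = (i == j)%:R.
Proof.
rewrite /mxtrace (bigD1 i) //= mxE eqxx big1 ?addr0 // => k ki.
by rewrite mxE (negPf ki).
Qed.

Lemma mxtrace_bracket (A B : 'M[K]_n) : \tr (bracket A B) = 0.
Proof. by rewrite linearB /= mxtrace_mulC subrr. Qed.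

Lemma mxtrace_fneg (x : ixpair n) : \tr (fneg K x) = 0.
Proof. by rewrite mxtrace_delta -val_eqE /= gtn_eqF // ixpair_lt. Qed.

Lemma bracket_delta (i j k l : 'I_n) :
  bracket (delta_mx i j : 'M[K]_n) (delta_mx k l) =
  (j == k)%:R *: delta_mx i l - (l == i)%:R *: delta_mx k j.
Proof.
rewrite /bracket !mul_delta_mx_cond.
by congr (_ - _); case: eqP; rewrite ?mulr1n ?mulr0n ?scale1r ?scale0r.
Qed.

Section OneRep.
Variables (M : lmodType K) (act : 'M[K]_n -> M -> M).
Hypothesis act_rep : is_rep act.

Lemma act_lin A : linear (act A). Proof. by case: act_rep. Qed.

HB.instance Definition _ A := GRing.isLinear.Build K M M *:%R (act A) (act_lin A).

Lemma actD A B x : \tr A = 0 -> \tr B = 0 -> act (A + B) x = act A x + act B x.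
Proof.
by case: act_rep => _ H _ tA tB; rewrite -[A in A + B]scale1r H // scale1r.
Qed.

Lemma act0 x : act 0 x = 0.
Proof.
have := @actD 0 0 x (mxtrace0 _ _) (mxtrace0 _ _).
by rewrite addr0 -[LHS]addr0 => /addrI.
Qed.

Lemma actZ a A x : \tr A = 0 -> act (a *: A) x = a *: act A x.
Proof.
case: act_rep => _ H _ tA; rewrite -[a *: A]addr0 H ?mxtrace0 //.
by rewrite act0 addr0.
Qed.

Lemma act_sum (J : Type) (s : seq J) (F : J -> 'M[K]_n) x :
  (forall j, \tr (F j) = 0) -> act (\sum_(j <- s) F j) x = \sum_(j <- s) act (F j) x.
Proof.
move=> tF; elim: s => [|j s IH]; first by rewrite !big_nil act0.
rewrite !big_cons actD ?IH //.
by rewrite raddf_sum big1 // => i _; apply: tF.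
Qed.

Lemma act_bracket A B x : \tr A = 0 -> \tr B = 0 ->
  act A (act B x) = act (bracket A B) x + act B (act A x).
Proof. by case: act_rep => _ _ H tA tB; rewrite H // subrK. Qed.

Lemma actr0 A : act A 0 = 0. Proof. exact: linear0. Qed.

Definition fword (m : seq (ixpair n)) (v : M) : M :=
  foldr (fun x => act (fneg K x)) v m.

Lemma fword_cat m m' v : fword (m ++ m') v = fword m (fword m' v).
Proof. exact: foldr_cat. Qed.

Lemma fword_linear m : linear (fword m).
Proof.
move=> a x y; elim: m => //= z m ->; exact: act_lin.
Qed.

Lemma fwordD m x y : fword m (x + y) = fword m x + fword m y.
Proof. by rewrite -[x in LHS]scale1r fword_linear scale1r. Qed.

Lemma fword0 m : fword m 0 = 0.
Proof. by elim: m => //= x m ->; apply: actr0. Qed.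

Variables (lam : 'I_n.-1 -> nat) (v : M).
Hypothesis v_hwv : is_hwv act lam v.
Variable i0 : 'I_n.
Hypothesis i0_0 : i0 = 0%N :> nat.

Lemma hwv_weight (i : 'I_n) :
  act (delta_mx i i - delta_mx i0 i0) v = - (\sum_(k : 'I_n.-1 | k < i) lam k)%N%:R *: v.
Proof.
have [m] := ubnP (i : nat); elim: m i => // m IH [[|i] hi] /= him.
  rewrite big_pred0 // oppr0 scale0r.
  by rewrite (_ : Ordinal hi = i0) ?subrr ?act0 //; apply: val_inj.
have hi' : (i < n)%N := ltnW hi.
have hi'' : (i < n.-1)%N by rewrite ltn_predRL.
pose j := Ordinal hi'.
have tr0 (a b : 'I_n) : \tr (delta_mx a a - delta_mx b b : 'M[K]_n) = 0.
  by rewrite linearB /= !mxtrace_delta !eqxx subrr.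
rewrite (_ : delta_mx _ _ - _ = (-1) *: (delta_mx j j - delta_mx (Ordinal hi) (Ordinal hi))
    + (delta_mx j j - delta_mx i0 i0)); last first.
  by rewrite scaleN1r opprB addrA subrK.
rewrite actD ?mxtraceZ ?tr0 ?mulr0 //= actZ ?tr0 // (v_hwv.2 (Ordinal hi'')) // IH //.
rewrite scalerA -scalerDl; congr (_ *: v).
rewrite [in RHS](bigD1 (Ordinal hi'')) //= natrD opprD mulN1r.
congr (- _ - _%:R); apply: eq_bigl => k.
by rewrite ltnS -val_eqE /= [RHS]andbC -ltn_neqAle.
Qed.

(** Each diagonal unit is corrected by the one at [i0], so that every term is traceless and the
    action can be distributed over the sum. *)
Lemma traceless_expand (A : 'M[K]_n) : \tr A = 0 ->
  A = \sum_i \sum_j A i j *: (delta_mx i j - (i == j)%:R *: delta_mx i0 i0).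
Proof.
move=> tA; rewrite [LHS]matrix_sum_delta.
have -> : \sum_i \sum_j A i j *: (delta_mx i j - (i == j)%:R *: delta_mx i0 i0) =
   \sum_i \sum_j A i j *: delta_mx i j - (\tr A) *: delta_mx i0 i0.
  rewrite [in RHS]/mxtrace scaler_suml -sumrB; apply: eq_bigr => i _.
  under eq_bigr do rewrite scalerBr.
  rewrite sumrB; congr (_ - _); rewrite (bigD1 i) //= eqxx scale1r big1 ?addr0 // => j ji.
  by rewrite eq_sym (negPf ji) scale0r scaler0.
by rewrite tA scale0r subr0.
Qed.

Definition word_span := lspan [set fword m v | m in [set: seq (ixpair n)]].

(** Induction on the word, for all traceless A at once: moving A past the first letter leaves a
    bracket, again traceless, acting on a shorter word. On v itself the matrix units raise, lower or
    scale. *)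
Lemma word_span_act A z : \tr A = 0 -> word_span z -> word_span (act A z).
Proof.
have S m : word_span (fword m v) by apply: lspan_sub; exists m.
have Sf x y : word_span y -> word_span (act (fneg K x) y).
  apply: (@lspan_map _ _ _ (act (fneg K x) : {linear M -> M})) => _ [m _ <-].
  exact: (S (x :: m)).
move=> tA; apply: (@lspan_map _ _ _ (act A : {linear M -> M})) => _ [m _ <-] /=.
elim: m A tA => [|x m IH] A tA /=; last first.
  rewrite act_bracket ?mxtrace_fneg //; apply: lspanD; last by apply: Sf; apply: IH.
  by apply: IH; apply: mxtrace_bracket.
have tB i j : \tr (delta_mx i j - (i == j)%:R *: delta_mx i0 i0 : 'M[K]_n) = 0.
  by rewrite linearB /= mxtraceZ !mxtrace_delta eqxx mulr1 subrr.
rewrite (traceless_expand tA) act_sum => [|i]; last first.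
  by rewrite linear_sum /= big1 // => j _; rewrite mxtraceZ tB mulr0.
apply: lspan_sum => i _; rewrite act_sum => [|j]; last by rewrite mxtraceZ tB mulr0.
apply: lspan_sum => j _; rewrite actZ //; apply: lspanZ.
case: (ltngtP i j) => ij.
- rewrite -val_eqE /= ltn_eqF // scale0r subr0 (v_hwv.1 _ _ ij).
  exact: lspan0.
- rewrite -val_eqE /= gtn_eqF // scale0r subr0.
  have -> : delta_mx i j = fneg K (mkix ij (ltn_ord i)).
    by congr delta_mx; apply: val_inj.
  exact: (S [:: _]).
- have -> : j = i by apply: val_inj.
  by rewrite eqxx scale1r hwv_weight; apply: lspanZ; exact: (S [::]).
Qed.

End OneRep.
End Representations.

Section Annihilate.
Variables (K : fieldType) (M : lmodType K) (h : {linear M -> M}).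

(** The product of the operators h - mu over [s], used to remove the eigenvectors with eigenvalue in
    [s]. *)
Definition kill (s : seq K) (z : M) : M := foldr (fun mu y => h y - mu *: y) z s.

Lemma kill_linear s : linear (kill s).
Proof.
move=> a x y; elim: s => //= mu s ->.
rewrite linearP scalerDr opprD addrACA scalerBr; congr (_ - _ + _).
by rewrite !scalerA mulrC.
Qed.

HB.instance Definition _ s := GRing.isLinear.Build K M M *:%R (kill s) (kill_linear s).

Lemma kill_eigen s mu z : h z = mu *: z -> kill s z = (\prod_(nu <- s) (mu - nu)) *: z.
Proof.
move=> hz; elim: s => [|nu s IH] /=; first by rewrite big_nil scale1r.
by rewrite IH linearZ /= hz big_cons !scalerA -scalerBl mulrC -mulrBl.
Qed.

End Annihilate.

(** * The highest weight vector is not a combination of longer words *)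

Section WeightSeparation.
Variables (K : numFieldType) (n : nat) (M : lmodType K) (act : 'M[K]_n -> M -> M).
Hypothesis act_rep : is_rep act.
Variables (lam : 'I_n.-1 -> nat) (v : M).
Hypothesis v_hwv : is_hwv act lam v.
Variable i0 : 'I_n.
Hypothesis i0_0 : i0 = 0%N :> nat.

HB.instance Definition _ A := GRing.isLinear.Build K M M *:%R (act A) (act_lin act_rep A).

(** The diagonal matrix (0, 1, ..., n-1) made traceless by changing its first entry. This change
    causes the second summand of [height_wt]. *)
Definition height_mx : 'M[K]_n := \sum_(i < n) i%:R *: (delta_mx i i - delta_mx i0 i0).

Definition height_wt (x : ixpair n) : nat :=
  (snd_ix x - fst_ix x + (fst_ix x == i0) * \sum_(i < n) i)%N.

Lemma mxtrace_root (i j : 'I_n) : \tr (delta_mx i i - delta_mx j j : 'M[K]_n) = 0.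
Proof. by rewrite linearB /= !mxtrace_delta !eqxx subrr. Qed.

Lemma mxtrace_height : \tr height_mx = 0.
Proof.
by rewrite raddf_sum big1 // => i _; rewrite [LHS]mxtraceZ mxtrace_root mulr0.
Qed.

Lemma height_hwv : exists c, act height_mx v = c *: v.
Proof.
exists (\sum_(i < n) i%:R * - (\sum_(k : 'I_n.-1 | k < i) lam k)%N%:R).
rewrite act_sum // => [|i]; last by rewrite mxtraceZ mxtrace_root mulr0.
rewrite scaler_suml; apply: eq_bigr => i _.
by rewrite actZ ?mxtrace_root // (hwv_weight act_rep v_hwv i0_0) scalerA.
Qed.

Lemma bracket_height x : bracket height_mx (fneg K x) = (height_wt x)%:R *: fneg K x.
Proof.
have E (i : 'I_n) : bracket (i%:R *: (delta_mx i i - delta_mx i0 i0) : 'M[K]_n) (fneg K x) =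
    (i%:R * ((i == snd_ix x)%:R - (i == fst_ix x)%:R + (i0 == fst_ix x)%:R)) *: fneg K x.
  rewrite /bracket -scalemxAl -scalemxAr -scalerBr -scalerA; congr (_ *: _).
  transitivity (bracket (delta_mx i i) (fneg K x) - bracket (delta_mx i0 i0) (fneg K x)).
    rewrite /bracket mulmxBl mulmxBr !opprB addrACA [RHS]addrACA; congr (_ + _).
    exact: addrC.
  have i0s : (i0 == snd_ix x) = false.
    by apply/negbTE/eqP => i0x; have := ixpair_lt x; rewrite -i0x i0_0.
  rewrite !bracket_delta i0s scale0r sub0r opprK.
  have D (k a b : 'I_n) : (k == a)%:R *: (delta_mx k b : 'M[K]_n) = (k == a)%:R *: delta_mx a b.
    by case: eqP => [->|]; rewrite ?scale0r.
  have D' (k a b : 'I_n) : (a == k)%:R *: (delta_mx b k : 'M[K]_n) = (k == a)%:R *: delta_mx b a.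
    by rewrite eq_sym; case: eqP => [->|]; rewrite ?scale0r.
  by rewrite D (D' i) (D' i0) -scalerBl -scalerDl.
have -> : bracket height_mx (fneg K x) =
   \sum_(i < n) bracket (i%:R *: (delta_mx i i - delta_mx i0 i0) : 'M[K]_n) (fneg K x).
  by rewrite /bracket /height_mx mulmx_suml mulmx_sumr sumrB.
under eq_bigr do rewrite E.
rewrite -scaler_suml; congr (_ *: _).
under eq_bigr do rewrite mulrDr mulrBr.
have S j : \sum_(i < n) i%:R * (i == j)%:R = j%:R :> K.
  rewrite (bigD1 j) //= eqxx mulr1 big1 ?addr0 // => i ij.
  by rewrite (negPf ij) mulr0.
rewrite big_split sumrB /= !S -big_distrl /= -natr_sum natrD natrM mulrC.
by rewrite natrB ?(ltnW (ixpair_lt x)) // [i0 == _]eq_sym.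
Qed.

Lemma height_wt_gt0 x : (0 < height_wt x)%N.
Proof. by rewrite addn_gt0 subn_gt0 ixpair_lt. Qed.

Lemma height_fword c m : act height_mx v = c *: v ->
  act height_mx (fword act m v) =
  (c + (\sum_(x <- m) height_wt x)%N%:R) *: fword act m v.
Proof.
move=> hc; elim: m => [|x m IH] /=; first by rewrite big_nil addr0.
rewrite act_bracket ?mxtrace_fneg ?mxtrace_height // bracket_height actZ ?mxtrace_fneg //.
by rewrite IH linearZ -scalerDl big_cons natrD addrCA.
Qed.

Definition lower_span := lspan [set fword act m v | m in [set m : seq (ixpair n) | m != [::]]].

(** If [v] has height eigenvalue c, nonempty words have eigenvalues c + i with i a positive integer.
    The product of height - (c+i) for 1 <= i <= N kills any given combination of them once N is
    large, but scales [v] by a nonzero factor. *)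
Lemma hwv_notin_lower : v != 0 -> ~ lower_span v.
Proof.
move=> v0 vl; have [c hc] := height_hwv.
pose h := act height_mx : {linear M -> M}.
pose s N := [seq c + i.+1%:R | i <- iota 0 N].
have [N /(_ N (leqnn _))] : exists N0, forall N, (N0 <= N)%N -> kill h (s N) v = 0.
  elim/lspan_ind: v / vl => [_ [m /= m0 <-]||a x y [N1 H1] [N2 H2]].
  - exists (\sum_(x <- m) height_wt x)%N => N hN.
    rewrite (kill_eigen _ (height_fword m hc)) (_ : \prod_(_ <- _) _ = 0) ?scale0r //.
    apply/eqP; rewrite prodf_seq_eq0; apply/hasP.
    exists (c + (\sum_(x <- m) height_wt x)%N%:R); last by rewrite subrr eqxx.
    case: m m0 hN => // x m _; rewrite big_cons => hN.
    apply/mapP; exists (height_wt x + \sum_(x <- m) height_wt x).-1%N.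
      rewrite mem_iota add0n; apply: leq_trans hN.
      by rewrite prednK // addn_gt0 height_wt_gt0.
    by rewrite prednK // addn_gt0 height_wt_gt0.
  - by exists 0%N => N _; rewrite linear0.
  - exists (maxn N1 N2) => N; rewrite geq_max => /andP[h1 h2].
    by rewrite linearP /= H1 // H2 // scaler0 addr0.
move=> /eqP; rewrite (kill_eigen _ hc) scaler_eq0 (negPf v0) orbF prodf_seq_eq0.
move=> /hasP[_ /mapP[i _ ->]]; rewrite opprD addrA subrr sub0r oppr_eq0.
by rewrite pnatr_eq0.
Qed.

End WeightSeparation.

(* The submodule of L x W generated by (v, w) meets 0 x W in a submodule
   orthogonal to w, hence to the whole cyclic module of w: a relation between
   words applied to v also holds for w. *)
Section Transfer.
Variables (K : numFieldType) (n : nat) (L W : lmodType K).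
Variables (actL : 'M[K]_n -> L -> L) (actW : 'M[K]_n -> W -> W).
Hypotheses (L_rep : is_rep actL) (W_rep : is_rep actW).
Variables (lam : 'I_n.-1 -> nat) (v : L) (w : W).
Hypotheses (v_hwv : is_hwv actL lam v) (w_hwv : is_hwv actW lam w) (v0 : v != 0).
Variable i0 : 'I_n.
Hypothesis i0_0 : i0 = 0%N :> nat.
Variable B : W -> W -> K.
Hypothesis B_lin : forall y a x z, B y (a *: x + z) = a * B y x + B y z.
Hypothesis B_0 : forall z, B 0 z = 0.
Hypothesis B_adj : forall (i j : 'I_n) y z, i != j ->
  B (actW (delta_mx j i) y) z = B y (actW (delta_mx i j) z).
Hypothesis B_def : forall x, word_span actW w x ->
  (forall m, B (fword actW m w) x = 0) -> x = 0.

Definition pair_act (A : 'M[K]_n) (z : L * W) : L * W := (actL A z.1, actW A z.2).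

Lemma pair_rep : is_rep pair_act.
Proof.
case: L_rep W_rep => [l1 l2 l3] [w1 w2 w3]; split.
- by move=> A a x y; rewrite /pair_act /= l1 w1.
- by move=> a A A' tA tA' x; rewrite /pair_act /= l2 // w2.
- by move=> A A' tA tA' x; rewrite /pair_act /= l3 // w3.
Qed.

Lemma pair_hwv : is_hwv pair_act lam (v, w).
Proof.
case: v_hwv w_hwv => [v1 v2] [w1 w2]; split.
- by move=> i j ij; rewrite /pair_act /= v1 // w1.
- by move=> k i j ik jk; rewrite /pair_act /= (v2 k) // (w2 k).
Qed.

Lemma fword_pair m : fword pair_act m (v, w) = (fword actL m v, fword actW m w).
Proof. by elim: m => //= x m ->. Qed.

Let Z := word_span pair_act (v, w).
Let Z' := lower_span pair_act (v, w).

Lemma pair_span_split z : Z z -> exists c, Z' (z - c *: (v, w)).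
Proof.
elim/lspan_ind => {z} [_ [m _ <-]||a x y [c hc] [d hd]].
- case: (eqVneq m [::]) => [->|m0].
    by exists 1; rewrite scale1r subrr; apply: lspan0.
  exists 0; rewrite scale0r subr0; apply: lspan_sub; by exists m.
- by exists 0; rewrite scale0r subr0; apply: lspan0.
- exists (a * c + d); rewrite scalerDl opprD addrACA -scalerA -scalerBr.
  exact: lspanP.
Qed.

(** The component of (0, y) along (v, w) is zero, since otherwise v would be a combination of longer
    words in L. So y is a combination of nonempty words applied to [w], and the adjoint of a first
    letter is a raising operator, which kills [w]. *)
Lemma form_hwv_eq0 y : Z (0, y) -> B w y = 0.
Proof.
move=> /pair_span_split[c hc].
have c0 : c = 0.
  apply/eqP; apply: contraT => c0; exfalso.
  apply: (hwv_notin_lower L_rep v_hwv i0_0 v0).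
  rewrite [X in lower_span _ _ X](_ : v = (- c^-1) *: ((0, y) - c *: (v, w)).1); last first.
    by rewrite /= sub0r scaleNr scalerN opprK scalerA mulVf // scale1r.
  apply: lspanZ; apply: (@lspan_map _ _ _ (fst : {linear (L * W)%type -> L}) _ _ _ _ hc).
  move=> _ [m m0 <-]; rewrite fword_pair; by apply: lspan_sub; exists m.
move: hc; rewrite c0 scale0r subr0 -[in B w y]/((0, y) : L * W).2.
elim/lspan_ind => [_ [[|x m] // _ <-]||a x z Hx Hz] /=.
- rewrite fword_pair /= -B_adj; last by rewrite -val_eqE /= gtn_eqF // ixpair_lt.
  by case: w_hwv => H _; rewrite H ?B_0 // ixpair_lt.
- by have := B_lin w 1 0 0; rewrite scale1r addr0 mul1r -[LHS]addr0 => /addrI <-.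
- by rewrite B_lin Hx Hz mulr0 addr0.
Qed.

(** The letters are moved one by one to the other side of the form; raising operators preserve both
    the submodule and the vanishing first component. *)
Lemma form_words_eq0 m y : Z (0, y) -> B (fword actW m w) y = 0.
Proof.
elim: m y => [|x m IH] y Zy /=; first exact: form_hwv_eq0.
rewrite B_adj; last by rewrite -val_eqE /= ltn_eqF // ixpair_lt.
apply: IH.
have -> : (0, actW (delta_mx (fst_ix x) (snd_ix x)) y) =
    pair_act (delta_mx (fst_ix x) (snd_ix x)) (0, y).
  by rewrite /pair_act /= (actr0 L_rep).
apply: (word_span_act pair_rep pair_hwv i0_0) => //.
by rewrite mxtrace_delta -val_eqE /= ltn_eqF // ixpair_lt.
Qed.

Lemma annihilator_transfer (ms : seq (seq (ixpair n))) (c : seq (ixpair n) -> K) :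
  \sum_(m <- ms) c m *: fword actL m v = 0 ->
  \sum_(m <- ms) c m *: fword actW m w = 0.
Proof.
move=> H; have Zx : Z (0, \sum_(m <- ms) c m *: fword actW m w).
  rewrite -[X in (X, _)]H.
  have -> : (\sum_(m <- ms) c m *: fword actL m v, \sum_(m <- ms) c m *: fword actW m w) =
     \sum_(m <- ms) c m *: fword pair_act m (v, w).
    elim: ms {H} => [|m ms IH]; first by rewrite !big_nil.
    by rewrite !big_cons -IH fword_pair.
  by apply: lspan_sum => m _; apply: lspanZ; apply: lspan_sub; exists m.
apply: B_def => [|m]; last exact: form_words_eq0.
by apply: lspan_sum => m _; apply: lspanZ; apply: lspan_sub; exists m.
Qed.

End Transfer.

(** * A tensor model containing the highest weight vector *)

(* The tensor power of K^n indexed by the cells P of a diagram; its basis is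
   indexed by the fillings of P, and the highest weight vector is the
   antisymmetrization along the columns of the filling by row indices. *)
Section TensorModel.
Variables (K : numClosedFieldType) (n : nat) (P : finType) (C : eqType).
Variables (col : P -> C) (idx : P -> 'I_n).
Hypothesis col_idx_inj : forall p q, col p = col q -> idx p = idx q -> p = q.
Hypothesis idx_down : forall p (i : 'I_n), (i < idx p)%N ->
  exists q, col q = col p /\ idx q = i.

Definition filling : Type := {ffun P -> 'I_n}.
HB.instance Definition _ := Finite.on filling.

Definition tensor : Type := {ffun filling -> K^o}.
HB.instance Definition _ := GRing.Lmodule.on tensor.

Implicit Types (t : {perm P}) (b : filling) (phi psi : tensor) (p q : P).

Definition repl b p i : filling := [ffun q => if q == p then i else b q].

Lemma replE b p i q : repl b p i q = if q == p then i else b q.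
Proof. by rewrite ffunE. Qed.

Lemma repl_eq b p i : repl b p i p = i. Proof. by rewrite replE eqxx. Qed.

Lemma repl_id b p : repl b p (b p) = b.
Proof. by apply/ffunP => q; rewrite replE; case: eqP => [->|]. Qed.

Lemma repl_repl b p i j : repl (repl b p i) p j = repl b p j.
Proof. by apply/ffunP => q; rewrite !replE; case: eqP. Qed.

Lemma repl_swap b p q i j : p != q -> repl (repl b p i) q j = repl (repl b q j) p i.
Proof.
move=> pq; apply/ffunP => r; rewrite !replE.
by case: (eqVneq r q) => // ->; rewrite eq_sym (negPf pq).
Qed.

Definition tensor_act (A : 'M[K]_n) phi : tensor :=
  [ffun b : filling => (\sum_p \sum_j A (b p) j * phi (repl b p j) : K)].

Lemma tensor_act_lin A : linear (tensor_act A).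
Proof.
move=> a phi psi; apply/ffunP => b; rewrite !ffunE /GRing.scale /= big_distrr /= -big_split.
apply: eq_bigr => p _ /=; rewrite big_distrr -big_split; apply: eq_bigr => j _ /=.
by rewrite !ffunE /GRing.scale /= mulrDr mulrCA.
Qed.

Lemma tensor_act_linl a A B phi :
  tensor_act (a *: A + B) phi = a *: tensor_act A phi + tensor_act B phi.
Proof.
apply/ffunP => b; rewrite !ffunE /GRing.scale /= big_distrr /= -big_split.
apply: eq_bigr => p _ /=; rewrite big_distrr -big_split; apply: eq_bigr => j _ /=.
by rewrite !mxE mulrDl mulrA.
Qed.

(** The part of A B in which the two matrices act at different cells. It is symmetric in A and B, so
    it cancels in the commutator. *)
Definition two_site (A B : 'M[K]_n) phi b : K :=
  \sum_p \sum_(q | q != p) \sum_j \sum_k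
    A (b p) j * (B (b q) k * phi (repl (repl b p j) q k)).

Lemma two_site_sym A B phi b : two_site A B phi b = two_site B A phi b.
Proof.
rewrite /two_site.
under eq_bigr do rewrite big_mkcond.
rewrite exchange_big; apply: eq_bigr => p _; rewrite [RHS]big_mkcond /=.
apply: eq_bigr => q _; rewrite eq_sym; case: eqP => //= /eqP qp.
rewrite exchange_big; apply: eq_bigr => j _; apply: eq_bigr => k _.
by rewrite mulrCA repl_swap.
Qed.

Lemma tensor_act_comp A B phi b :
  tensor_act A (tensor_act B phi) b = tensor_act (A *m B) phi b + two_site A B phi b.
Proof.
rewrite !ffunE /two_site -big_split; apply: eq_bigr => p _ /=.
under eq_bigr do rewrite ffunE big_distrr (bigD1 p) //=.
rewrite big_split /=; congr (_ + _).
  under eq_bigr do rewrite big_distrr.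
  rewrite exchange_big; apply: eq_bigr => k _ /=.
  rewrite mxE big_distrl; apply: eq_bigr => j _ /=.
  by rewrite repl_eq repl_repl mulrA.
rewrite exchange_big; apply: eq_bigr => q qp; apply: eq_bigr => j _ /=.
rewrite big_distrr; apply: eq_bigr => k _ /=.
by rewrite replE (negPf qp).
Qed.

Lemma tensor_rep : is_rep tensor_act.
Proof.
split=> [A|a A B _ _ phi|A B _ _ phi]; first exact: tensor_act_lin.
  exact: tensor_act_linl.
have -> : bracket A B = (-1) *: (B *m A) + A *m B by rewrite scaleN1r addrC.
rewrite tensor_act_linl scaleN1r addrC; apply/ffunP => b.
have E (x y : tensor) : (x - y) b = x b - y b by rewrite !ffunE.
by rewrite !E !tensor_act_comp two_site_sym opprD addrACA subrr addr0.
Qed.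

Lemma tensor_act_delta i j phi b :
  tensor_act (delta_mx i j) phi b = \sum_(p | b p == i) phi (repl b p j).
Proof.
rewrite ffunE [RHS]big_mkcond; apply: eq_bigr => p _.
rewrite (bigD1 j) //= mxE eqxx andbT big1 ?addr0 => [|k kj].
  by case: eqP => _; rewrite ?mul1r ?mul0r.
by rewrite mxE (negPf kj) andbF mul0r.
Qed.

Definition perm_filling b (t : {perm P}) : filling := [ffun p => b (t p)].

Definition col_perm (t : {perm P}) : bool := [forall p, col (t p) == col p].

Lemma col_permP t : reflect (forall p, col (t p) = col p) (col_perm t).
Proof. by apply: (iffP forallP) => H p; apply/eqP/H. Qed.

Definition alternating phi : Prop :=
  forall t b, col_perm t -> phi (perm_filling b t) = (-1) ^+ t * phi b.

Lemma alternating_act A phi : alternating phi -> alternating (tensor_act A phi).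
Proof.
move=> hphi t b ht; rewrite !ffunE big_distrr (reindex_inj (@perm_inj _ t^-1)).
apply: eq_bigr => p _ /=; rewrite big_distrr; apply: eq_bigr => j _ /=.
rewrite ffunE permKV mulrCA -hphi //; congr (_ * phi _).
apply/ffunP => q; rewrite !(ffunE, replE).
by rewrite (canF_eq (permK t)).
Qed.

Lemma alternating_repeat phi b p q : alternating phi ->
  p != q -> col p = col q -> b p = b q -> phi b = 0.
Proof.
move=> hphi pq cpq bpq.
have ct : col_perm (tperm p q) by apply/col_permP => r; case: tpermP => [->|->|].
have := hphi _ b ct.
rewrite (_ : perm_filling b _ = b); last first.
  by apply/ffunP => r; rewrite ffunE; case: tpermP => [->|->|].
rewrite odd_tperm pq expr1 mulN1r => /eqP.
by rewrite -subr_eq0 opprK -mulr2n mulrn_eq0 => /eqP.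
Qed.

Definition antisymmetrizer : tensor :=
  [ffun b : filling => (\sum_(t : {perm P} | col_perm t && [forall p, b p == idx (t p)]) (-1) ^+ t : K)].

Lemma alternating_antisymmetrizer : alternating antisymmetrizer.
Proof.
move=> t b ht; rewrite !ffunE big_distrr (reindex_inj (mulgI t)).
apply: eq_big => s.
  congr andb.
    apply/col_permP/col_permP => H p; last by rewrite permM H (col_permP _ ht).
    by rewrite -{1}(permKV t p) -permM H -{1}(col_permP _ ht) permKV.
  apply/forallP/forallP => H p; last by rewrite ffunE permM.
  by have := H ((t^-1)%g p); rewrite ffunE permM permKV.
by move=> _; rewrite odd_permM signr_addb.
Qed.

Lemma alternating_fword m phi : alternating phi -> alternating (fword tensor_act m phi).
Proof. by move=> hphi; elim: m => //= x m; apply: alternating_act. Qed.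

Lemma antisymmetrizer_idx : antisymmetrizer [ffun p => idx p] = 1.
Proof.
rewrite ffunE (big_pred1 1%g) ?odd_perm1 // => t.
apply/andP/eqP => [[/col_permP ct /forallP it]|->]; last first.
  by split; [apply/col_permP => p; rewrite perm1 | apply/forallP => p; rewrite ffunE perm1].
apply/permP => p; rewrite perm1; apply: col_idx_inj => //.
by have := it p; rewrite ffunE => /eqP.
Qed.

Lemma antisymmetrizer_supp b : antisymmetrizer b != 0 ->
  exists2 t, col_perm t & forall p, b p = idx (t p).
Proof.
rewrite ffunE => b0; apply: contraPP b0 => H; rewrite big1 ?eqxx // => t /andP[ct /forallP bt].
by case: H; exists t => // p; apply/eqP.
Qed.

(** A nonzero contribution at b puts i at a cell where a column permutation of the row filling has
    j. As i < j, that column contains i elsewhere too, so b repeats an entry in a column and the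
    coordinate is 0. *)
Lemma antisymmetrizer_raise (i j : 'I_n) : (i < j)%N ->
  tensor_act (delta_mx i j) antisymmetrizer = 0.
Proof.
move=> ij; apply/ffunP => b; rewrite [RHS]ffunE; apply/eqP; apply: contraT => nz.
have [p bp nzp] : exists2 p, b p = i & antisymmetrizer (repl b p j) != 0.
  apply: contraPP nz => H; rewrite tensor_act_delta big1 ?eqxx // => p /eqP bp.
  by apply/eqP; rewrite -[_ == _]negbK; apply/negP => h; apply: H; exists p.
have [t ct bt] := antisymmetrizer_supp nzp.
have tp : idx (t p) = j by rewrite -bt repl_eq.
have [q' [cq' iq']] := idx_down (p := t p) (i := i) ltac:(by rewrite tp).
pose q := (t^-1)%g q'.
have tq : t q = q' by rewrite permKV.
have := bt q; rewrite tq iq' replE; case: eqP => [qp ji|/eqP qp bq].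
  by move: ij; rewrite ji ltnn.
case/eqP: nz; apply: (alternating_repeat (p := p) (q := q)).
- exact/alternating_act/alternating_antisymmetrizer.
- by rewrite eq_sym.
- by rewrite -(col_permP _ ct q) tq cq' (col_permP _ ct).
- by rewrite bq bp.
Qed.

Lemma antisymmetrizer_weight (i : 'I_n) :
  tensor_act (delta_mx i i) antisymmetrizer =
  #|[pred p | idx p == i]|%:R *: antisymmetrizer.
Proof.
apply/ffunP => b; rewrite tensor_act_delta.
under eq_bigr => p /eqP bp do rewrite -[X in repl b p X]bp repl_id.
rewrite sumr_const [RHS]ffunE; case: (eqVneq (antisymmetrizer b) 0) => [->|/antisymmetrizer_supp].
  by rewrite mul0rn scaler0.
move=> [t ct bt]; rewrite -[LHS]mulr_natl; congr (_%:R * _).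
rewrite -!sum1_card [RHS](reindex_inj (@perm_inj _ t)).
by apply: eq_bigl => p; rewrite [RHS]inE -bt.
Qed.

Definition hform phi psi : K := \sum_b (phi b : K)^* * psi b.

Lemma hform_lin phi a psi psi' :
  hform phi (a *: psi + psi') = a * hform phi psi + hform phi psi'.
Proof.
rewrite /hform big_distrr -big_split; apply: eq_bigr => b _ /=.
by rewrite !ffunE /GRing.scale /= mulrDr mulrCA.
Qed.

Lemma hform0 psi : hform 0 psi = 0.
Proof. by rewrite /hform big1 // => b _; rewrite ffunE conjC0 mul0r. Qed.

Lemma hform_adj (i j : 'I_n) phi psi :
  hform (tensor_act (delta_mx j i) phi) psi = hform phi (tensor_act (delta_mx i j) psi).
Proof.
rewrite /hform.
under eq_bigr do rewrite tensor_act_delta rmorph_sum big_distrl.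
under [RHS]eq_bigr do rewrite tensor_act_delta big_distrr.
rewrite (exchange_big_dep xpredT) //= [RHS](exchange_big_dep xpredT) //=.
apply: eq_bigr => p _.
rewrite (reindex_onto (fun b => repl b p j) (fun b => repl b p i)) /=; last first.
  by move=> b /eqP bp; rewrite repl_repl -bp repl_id.
apply: eq_big => b.
  rewrite repl_eq eqxx repl_repl /=; apply/eqP/eqP => [/ffunP/(_ p)|<-].
    by rewrite repl_eq.
  by rewrite repl_id.
by rewrite repl_eq eqxx /= repl_repl => /eqP ->.
Qed.

Lemma hform_def x w : word_span tensor_act w x ->
  (forall m, hform (fword tensor_act m w) x = 0) -> x = 0.
Proof.
move=> xw H; have xx : hform x x = 0.
  elim/lspan_ind: {1}x / xw => [_ [m _ <-] //||a y z Hy Hz]; first exact: hform0.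
  transitivity (a^* * hform y x + hform z x); last by rewrite Hy Hz mulr0 addr0.
  rewrite /hform big_distrr -big_split; apply: eq_bigr => b _ /=.
  by rewrite !ffunE /GRing.scale /= rmorphD rmorphM mulrDl mulrA.
apply/ffunP => b; rewrite [RHS]ffunE.
have /eqP := xx; rewrite psumr_eq0 => [/allP/(_ b)|b' _]; last by rewrite mulrC mul_conjC_ge0.
by rewrite mem_index_enum mulf_eq0 conjC_eq0 orbb => /(_ isT)/eqP.
Qed.

(** Each letter raises the sum of the entries by its height, so words of different heights have
    disjoint supports. *)
Lemma height_fword_tensor m b : fword tensor_act m antisymmetrizer b != 0 ->
  (\sum_p b p = \sum_p idx p + \sum_(x <- m) (snd_ix x - fst_ix x))%N.
Proof.
elim: m b => [|x m IH] b /=.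
  move=> /antisymmetrizer_supp[t _ bt]; rewrite big_nil addn0 [RHS](reindex_inj (@perm_inj _ t)).
  by apply: eq_bigr => p _; rewrite bt.
rewrite tensor_act_delta => nz.
have [p bp nzp] : exists2 p, b p = snd_ix x &
    fword tensor_act m antisymmetrizer (repl b p (fst_ix x)) != 0.
  apply: contraPP nz => H; rewrite big1 ?eqxx // => p /eqP bp.
  by apply/eqP; rewrite -[_ == _]negbK; apply/negP => h; apply: H; exists p.
have := IH _ nzp; rewrite (bigD1 p) //= repl_eq big_cons.
under eq_bigr => q qp do rewrite replE (negPf qp).
rewrite [in X in _ -> X](bigD1 p) //= bp.
have := ltnW (ixpair_lt x); move: (\sum_(i in P | _) _)%N => S le E.
by rewrite -{1}(subnK le) -addnA E addnCA.
Qed.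

End TensorModel.

(** * Words and tableaux *)

Section SortedWords.
Variable n : nat.
Implicit Types (x y z : ixpair n) (s : seq (ixpair n)).

Definition pair_le x y : bool := (x == y) || pair_lt x y.

Lemma pair_leE x y : pair_le x y =
  (fst_ix x < fst_ix y)%N || ((fst_ix x == fst_ix y) && (snd_ix x <= snd_ix y)%N).
Proof.
rewrite /pair_le /pair_lt; case: (eqVneq x y) => [->|xy] /=; first by rewrite eqxx leqnn orbT.
case: ltngtP => //= xy1; last first.
  rewrite -val_eqE /= xy1 eqxx /= ltn_neqAle andbC; case: (_ <= _)%N => //=.
  by apply: contra_neqN xy => /eqP xy2; apply: ixpair_eqP.
by rewrite -val_eqE /= gtn_eqF.
Qed.

Lemma pair_le_refl : reflexive pair_le.
Proof. by move=> x; rewrite /pair_le eqxx. Qed.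

Lemma pair_le_trans : transitive pair_le.
Proof. by move=> y x z; rewrite !pair_leE -!val_eqE /=; lia. Qed.

Lemma pair_le_total : total pair_le.
Proof. by move=> x y; rewrite !pair_leE -!val_eqE /=; lia. Qed.

Lemma pair_le_anti : antisymmetric pair_le.
Proof.
move=> x y; rewrite !pair_leE -!val_eqE /= => H.
by apply: ixpair_eqP; lia.
Qed.

Lemma pair_ltE x y : pair_lt x y = (x != y) && pair_le x y.
Proof.
rewrite /pair_le; case: eqP => [->|_] //=.
by rewrite /pair_lt !ltnn andbF.
Qed.

Lemma sorted_pairs_sorted : sorted pair_le (pairs_sorted n).
Proof. exact/sort_sorted/pair_le_total. Qed.

Lemma uniq_pairs_sorted : uniq (pairs_sorted n).
Proof. by rewrite sort_uniq enum_uniq. Qed.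

Lemma mem_pairs_sorted x : x \in pairs_sorted n.
Proof. by rewrite mem_sort mem_enum. Qed.

Definition word_of (xs : seq (ixpair n)) (T : {ffun ixpair n -> nat}) : seq (ixpair n) :=
  flatten [seq nseq (T x) x | x <- xs].

Lemma count_word_of xs T x : uniq xs ->
  count_mem x (word_of xs T) = if x \in xs then T x else 0%N.
Proof.
elim: xs => //= y xs IH /andP[yxs uxs]; rewrite count_cat count_nseq IH // in_cons /=.
rewrite [y == x]eq_sym; case: (eqVneq x y) => [->|_]; last by rewrite mul0n add0n.
by rewrite (negPf yxs) addn0 mul1n.
Qed.

Lemma mem_word_of xs T x : x \in word_of xs T -> x \in xs.
Proof. by move=> /flattenP[_ /mapP[y yxs ->]] /nseqP[->]. Qed.

Lemma sorted_word_of xs T : sorted pair_le xs -> sorted pair_le (word_of xs T).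
Proof.
rewrite !(sorted_pairwise pair_le_trans); elim: xs => //= x xs IH /andP[xxs sxs].
rewrite pairwise_cat IH // andbT; apply/andP; split.
  apply/allrelP => y z /nseqP[-> _] /mem_word_of; exact: (allP xxs).
elim: (T x) => //= k ->; rewrite andbT; apply/allP => y /nseqP[-> _]; exact: pair_le_refl.
Qed.

Definition mword T := word_of (pairs_sorted n) T.

Lemma count_mword T x : count_mem x (mword T) = T x.
Proof. by rewrite count_word_of ?uniq_pairs_sorted // mem_pairs_sorted. Qed.

Lemma sorted_mword T : sorted pair_le (mword T).
Proof. exact/sorted_word_of/sorted_pairs_sorted. Qed.

Lemma sorted_eq_mword s : sorted pair_le s -> s = mword [ffun x => count_mem x s].
Proof.
move=> ss; apply: (sorted_eq pair_le_trans pair_le_anti ss (sorted_mword _)).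
by apply/allP => x _; rewrite /= count_mword ffunE.
Qed.

Lemma mword_inj : injective mword.
Proof. by move=> T T' E; apply/ffunP => x; rewrite -!count_mword E. Qed.

End SortedWords.

(** * Coordinates of words at fillings *)

Section Tableaux.
Variables (K : numClosedFieldType) (n : nat) (P : finType) (C : eqType).
Variables (col : P -> C) (idx : P -> 'I_n).
Hypothesis col_idx_inj : forall p q, col p = col q -> idx p = idx q -> p = q.
Hypothesis idx_down : forall p (i : 'I_n), (i < idx p)%N ->
  exists q, col q = col p /\ idx q = i.

Implicit Types (b : filling n P) (p q : P) (s : seq (ixpair n)) (phi : tensor K n P).

(* The word [s] lists the pairs (row, entry) of all cells whose entry exceeds
   the smallest possible one. *)
Record tableau b s : Prop := Tableau {
  tab_incr : forall p q, col p = col q -> (idx p < idx q)%N -> (b p < b q)%N;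
  tab_ge : forall p, (idx p <= b p)%N;
  tab_count : forall x, count_mem x s = #|[pred p | (idx p == fst_ix x) && (b p == snd_ix x)]| }.

Let w : tensor K n P := antisymmetrizer K col idx.
Let act := @tensor_act K n P.

Lemma tab_mem b s p : tableau b s -> (idx p < b p)%N ->
  exists y, [/\ y \in s, fst_ix y = idx p & snd_ix y = b p].
Proof.
move=> tb pb; pose y : ixpair n := exist _ (idx p, b p) pb.
exists y; split=> //; rewrite -has_pred1 has_count (tab_count tb).
by apply/card_gt0P; exists p; rewrite !inE !eqxx.
Qed.

Lemma tab_below b s x p : tableau b s -> {in s, forall y, pair_le x y} ->
  (idx p < fst_ix x)%N -> b p = idx p.
Proof.
move=> tb xs px; apply/val_inj/eqP; rewrite eqn_leq (tab_ge tb) andbT leqNgt; apply/negP => pb.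
have [y [/xs xy yp _]] := tab_mem tb pb.
by move: xy; rewrite pair_leE yp -val_eqE /=; lia.
Qed.

(** Rows above that of x still hold their smallest entries, which excludes p there. If p is lower,
    its column has in row [fst_ix x] an entry below [snd_ix x]: either it equals [fst_ix x], and the
    replacement creates a repetition, or it gives a letter of s smaller than x. *)
Lemma repl_offrow_eq0 b s x p phi : alternating col phi -> tableau b s ->
  {in s, forall y, pair_le x y} -> b p = snd_ix x -> idx p != fst_ix x ->
  phi (repl b p (fst_ix x)) = 0.
Proof.
move=> hphi tb xs bp; rewrite -val_eqE neq_ltn => /orP[px|xp].
  have := tab_below tb xs px; rewrite bp => E.
  by have := ixpair_lt x; rewrite E ltnNge (ltnW px).
have [q [cq iq]] := idx_down xp.
have bqp : (b q < snd_ix x)%N by rewrite -bp (tab_incr tb) // iq.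
have := tab_ge tb q; rewrite iq leq_eqVlt => /orP[/eqP bq|].
  have pq : p != q by apply/eqP => E; move: xp; rewrite E iq ltnn.
  apply: (alternating_repeat hphi pq) => //.
  by rewrite repl_eq replE eq_sym (negPf pq); apply: val_inj.
rewrite -iq => /(tab_mem tb)[y [/xs xy yq yb]].
by move: xy; rewrite pair_leE yq yb iq ltnn eqxx /= leqNgt bqp.
Qed.

Lemma tab_step b s x p : tableau b (x :: s) -> {in x :: s, forall y, pair_le x y} ->
  idx p = fst_ix x -> b p = snd_ix x -> tableau (repl b p (fst_ix x)) s.
Proof.
move=> tb xs ip bp; split=> [q r cqr iqr|q|y].
- rewrite !replE; case: (eqVneq r p) => [rp|rp]; case: (eqVneq q p) => [qp|qp].
  + by move: iqr; rewrite rp qp ltnn.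
  + by rewrite (tab_below tb xs) -ip -?rp.
  + by apply: leq_trans (tab_incr tb (_ : col p = col r) _); rewrite ?bp ?ltnS -?qp // ltnW // ixpair_lt.
  + exact: (tab_incr tb).
- by rewrite replE; case: eqP => [->|_]; rewrite ?ip ?(tab_ge tb).
- have := tab_count tb y; rewrite /= (cardD1 p) inE /= ip bp => E.
  apply/(@addnI (x == y)); rewrite E; congr (_ + _)%N.
  apply: eq_card => q; rewrite !inE replE; case: (eqVneq q p) => //= ->.
  apply/esym/negP => /andP[/eqP h1 /eqP h2].
  by have := ixpair_lt y; rewrite -h1 -h2 ip ltnn.
Qed.

Lemma sorted_min x s : sorted (@pair_le n) (x :: s) -> {in x :: s, forall y, pair_le x y}.
Proof.
move=> sx y; rewrite in_cons => /orP[/eqP ->|]; first exact: pair_le_refl.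
by apply/allP; rewrite /= (path_sortedE (@pair_le_trans n)) in sx; case/andP: sx.
Qed.

(** Only the cells of row [fst_ix x] with entry [snd_ix x] contribute. Each leads to a tableau for
    the remaining word, so the sum is one of positive terms; it is nonempty because x is counted. *)
Lemma fword_tableau_gt0 b s : sorted (@pair_le n) s -> tableau b s ->
  0 < (fword act s w b : K).
Proof.
elim: s b => [|x s IH] b ss tb /=.
  rewrite (_ : b = [ffun p => idx p]) ?antisymmetrizer_idx ?ltr01 //.
  apply/ffunP => p; rewrite ffunE; apply/val_inj/eqP; rewrite eqn_leq (tab_ge tb) andbT leqNgt.
  by apply/negP => /(tab_mem tb)[y []].
have xs := sorted_min ss.
have ws : alternating col (fword act s w).
  exact/alternating_fword/alternating_antisymmetrizer.
rewrite [act _ _]/act tensor_act_delta (bigID (fun p => idx p == fst_ix x)) /=.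
rewrite [X in _ + X]big1 ?addr0 => [|p /andP[/eqP bp ip]]; last first.
  exact: (repl_offrow_eq0 ws tb xs bp ip).
have : (0 < count_mem x (x :: s))%N by rewrite /= eqxx.
rewrite (tab_count tb) => /card_gt0P[p]; rewrite inE => /andP[ip bp].
rewrite (bigD1 p) /=; last by rewrite bp ip.
have step q : idx q = fst_ix x -> b q = snd_ix x -> 0 < (fword act s w (repl b q (fst_ix x)) : K).
  move=> iq bq; apply: IH; last exact: tab_step tb xs iq bq.
  by move: ss => /path_sorted.
apply: ltr_pwDl; first by apply: step; apply/eqP.
by apply: sumr_ge0 => q /andP[/andP[/eqP bq /eqP iq] _]; apply/ltW/step.
Qed.

(** The common prefix is undone in the tableau. The letter x' would then need a cell of its row with
    entry [snd_ix x'], that is, x' would be a letter of x :: s although it is smaller than all of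
    them. *)
Lemma fword_smaller_eq0 b u s s' x x' : sorted (@pair_le n) (u ++ x :: s) ->
  tableau b (u ++ x :: s) -> pair_lt x' x -> fword act (u ++ x' :: s') w b = 0.
Proof.
have walt m : alternating col (fword act m w).
  exact/alternating_fword/alternating_antisymmetrizer.
elim: u b => [|y u IH] b ss tb x'x /=.
  rewrite [act _ _]/act tensor_act_delta big1 // => q /eqP bq.
  have xs : {in x :: s, forall y, pair_le x' y}.
    move=> y /(sorted_min ss); apply: pair_le_trans.
    by rewrite /pair_le x'x orbT.
  apply: (repl_offrow_eq0 (walt _) tb xs bq); apply/eqP => iq.
  have [y [/(sorted_min ss) ys yi yb]] : exists y, [/\ y \in x :: s, fst_ix y = idx q & snd_ix y = b q].
    by apply: tab_mem tb _; rewrite iq bq ixpair_lt.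
  have yx' : y = x' by apply: ixpair_eqP; rewrite ?yi ?yb ?iq ?bq.
  rewrite yx' in ys; have := @pair_le_anti n x x'; rewrite ys /pair_le x'x orbT => /(_ isT) E.
  by move: x'x; rewrite E pair_ltE eqxx.
rewrite [act _ _]/act tensor_act_delta big1 // => q /eqP bq.
have ys := sorted_min ss.
case: (eqVneq (idx q) (fst_ix y)) => iq; last exact: (repl_offrow_eq0 (walt _) tb ys bq iq).
by apply: IH => //; [move: ss => /path_sorted | apply: tab_step tb ys iq bq].
Qed.

Lemma fword_mon_lt_eq0 b (m m' : {fmonom ixpair n}) : sorted (@pair_le n) m ->
  tableau b m -> mon_lt m' m -> fword act m' w b = 0.
Proof.
move=> sm tb [hlt|[_ [p [s [s' [x [x' [E' E x'x]]]]]]]]; last first.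
  by rewrite E'; apply: (@fword_smaller_eq0 b p s' s x' x); rewrite -?E.
apply/eqP; apply: contraTT hlt => nz; rewrite -leqNgt.
have := height_fword_tensor nz.
rewrite (height_fword_tensor (lt0r_neq0 (fword_tableau_gt0 sm tb))) => /addnI.
by rewrite /mon_height => ->.
Qed.

End Tableaux.

(** * The tableau of a lattice point *)

Section PatternFilling.
Variables (n : nat) (lam : 'I_n.-1 -> nat).

Definition head_sum (i : nat) : nat := (\sum_(k : 'I_n.-1 | k < i) lam k)%N.
Definition num_cols : nat := (\sum_k lam k)%N.

Lemma head_sumS (k : 'I_n.-1) : head_sum k.+1 = (head_sum k + lam k)%N.
Proof.
rewrite /head_sum (bigD1 k) //= addnC; congr addn; apply: eq_bigl => l.
by rewrite -val_eqE /=; lia.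
Qed.

Lemma head_sum_mono i j : (i <= j)%N -> (head_sum i <= head_sum j)%N.
Proof.
move=> ij; rewrite /head_sum [leqRHS](bigID (fun k : 'I_n.-1 => k < i)%N) /=.
apply: leq_trans (leq_addr _ _); rewrite leq_eqVlt; apply/orP; left; apply/eqP.
by apply: eq_bigl => k; lia.
Qed.

Lemma head_sum_split i : (head_sum i + \sum_(k : 'I_n.-1 | i <= k) lam k)%N = num_cols.
Proof.
rewrite /num_cols [RHS](bigID (fun k : 'I_n.-1 => k < i)%N); congr addn.
by apply: eq_bigl => k; rewrite -leqNgt.
Qed.

(* Columns are ordered by increasing height; [head_sum i] of them do not reach
   row i. *)
Definition cell : Type := {p : 'I_num_cols * 'I_n | (head_sum p.2 <= p.1)%N}.
HB.instance Definition _ := Finite.on cell.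
Definition cell_col (p : cell) : 'I_num_cols := (val p).1.
Definition cell_row (p : cell) : 'I_n := (val p).2.
Definition mkcell (c : 'I_num_cols) (i : 'I_n) (h : (head_sum i <= c)%N) : cell :=
  exist (fun p : 'I_num_cols * 'I_n => head_sum p.2 <= p.1)%N (c, i) h.

Lemma cell_inj (p q : cell) : cell_col p = cell_col q -> cell_row p = cell_row q -> p = q.
Proof.
by case: p q => [[c i] h] [[c' i'] h']; rewrite /cell_col /cell_row /= => cc ii;
  apply: val_inj; rewrite /= cc ii.
Qed.

Lemma cell_down (p : cell) (i : 'I_n) : (i < cell_row p)%N ->
  exists q, cell_col q = cell_col p /\ cell_row q = i.
Proof.
move=> ip; have h : (head_sum i <= cell_col p)%N.
  exact: leq_trans (head_sum_mono (ltnW ip)) (valP p).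
by exists (mkcell h).
Qed.

Lemma card_interval N lo hi : (hi <= N)%N ->
  #|[pred c : 'I_N | lo <= c < hi]%N| = (hi - lo)%N.
Proof.
rewrite -sum1_card big_mkcond /= => hN.
have -> : (\sum_(c < N) (if lo <= c < hi then 1 else 0) = minn hi N - lo)%N.
  by elim: N {hN} => [|N IH]; rewrite ?big_ord0 ?big_ord_recr /= ?IH; [lia|case: ifP; lia].
by rewrite (minn_idPl hN).
Qed.

Lemma card_row (i : 'I_n) (Q : pred 'I_num_cols) :
  #|[pred p : cell | (cell_row p == i) && Q (cell_col p)]| =
  #|[pred c : 'I_num_cols | (head_sum i <= c)%N && Q c]|.
Proof.
rewrite -(card_in_imset (f := cell_col)) => [|p q]; last first.
  by rewrite !inE => /andP[/eqP pi _] /andP[/eqP qi _] /cell_inj; apply; rewrite pi qi.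
apply: eq_card => c; rewrite inE; apply/imsetP/andP => [[p]|[hc Qc]].
  by rewrite inE => /andP[/eqP <- Qp] ->; split=> //; apply: (valP p).
by exists (mkcell hc); rewrite // inE eqxx.
Qed.

Lemma card_row_total (i : 'I_n) :
  #|[pred p : cell | cell_row p == i]| = (num_cols - head_sum i)%N.
Proof.
rewrite -(card_interval (head_sum i) (leqnn num_cols)).
rewrite (eq_card (B := [pred p : cell | (cell_row p == i) && xpredT (cell_col p)])); last first.
  by move=> p; rewrite !inE andbT.
rewrite (card_row i xpredT); apply: eq_card => c.
by rewrite !inE andbT ltn_ord andbT.
Qed.

Variable T : {ffun ixpair n -> nat}.
Hypothesis hT : gt_point lam T.

(** The first [rsum T i j] cells of row i, starting from column [head_sum i], are those with entry
    at least j; thus entries decrease weakly along a row. The value i is taken when no larger j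
    qualifies. *)
Definition entry (c i : nat) : nat :=
  maxn i (\max_(j < n | (i < j) && (c < head_sum i + rsum T i j)) j)%N.

Lemma entry_lt c (i : 'I_n) : (entry c i < n)%N.
Proof.
rewrite gtn_max ltn_ord /=; have n0 : (0 < n)%N by apply: leq_ltn_trans (ltn_ord i).
by apply: (big_ind (fun m => m < n)%N) => // m m' hm hm'; rewrite gtn_max hm.
Qed.

Lemma entry_ge c i j : (i < j < n)%N ->
  (j <= entry c i)%N = (c < head_sum i + rsum T i j)%N.
Proof.
move=> /andP[ij jn]; apply/idP/idP => [|h].
  rewrite /entry leq_max leqNgt ij /=; apply: contraTT; rewrite -leqNgt => h.
  rewrite -ltnNge -[j]prednK ?(leq_ltn_trans _ ij) // ltnS.
  apply/bigmax_leqP => k /andP[ik hk]; suff : ~~ (j <= k)%N by lia.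
  by apply/negP => jk; have := rsum_anti T i jk; lia.
rewrite /entry leq_max; apply/orP; right.
have := @leq_bigmax_cond _ (fun k : 'I_n => (i < k) && (c < head_sum i + rsum T i k))%N
  (fun k : 'I_n => k : nat) (Ordinal jn).
by apply; rewrite /= ij.
Qed.

(** With j the upper entry, c < head_sum i + rsum T i j. The inequality (i, j) bounds the right side
    by head_sum (i+1) + rsum T (i+1) (j+1), so the lower entry is at least j+1. *)
Lemma entry_incr1 c i : (i.+1 < n)%N -> (head_sum i.+1 <= c)%N -> (entry c i < entry c i.+1)%N.
Proof.
move=> i1n hc; have i1 : (i.+1 <= entry c i.+1)%N by rewrite /entry leq_maxl.
have in1 : (i < n.-1)%N by lia.
case: (ltnP i (entry c i)) => ie; last exact: leq_ltn_trans ie i1.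
have en := entry_lt c (Ordinal (ltnW i1n)).
have : (entry c i <= entry c i)%N by [].
rewrite {1}entry_ge; last by rewrite ie.
move=> /leq_trans/(_ (leq_add (leqnn (head_sum i)) (hT (k := Ordinal in1) ie))).
rewrite addnA -(head_sumS (Ordinal in1)) /=.
case: (leqP n (entry c i).+1) => ne.
  by rewrite rsum_ge // addn0 ltnNge hc.
by move=> h; rewrite entry_ge ?ne ?ltnS ?ie.
Qed.

Lemma entry_incr c i j : (i < j)%N -> (j < n)%N -> (head_sum j <= c)%N ->
  (entry c i < entry c j)%N.
Proof.
elim: j => // j IH; rewrite ltnS leq_eqVlt => /orP[/eqP -> jn hc|ij jn hc].
  exact: entry_incr1.
apply: ltn_trans (IH ij (ltnW jn) _) (entry_incr1 jn hc).
exact: leq_trans (head_sum_mono (leqnSn j)) hc.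
Qed.

Definition pattern_filling : filling n cell :=
  [ffun p => Ordinal (entry_lt (cell_col p) (cell_row p))].

Lemma tableau_pattern_filling : tableau cell_col cell_row pattern_filling (mword T).
Proof.
split=> [p q cpq pq|p|x].
- by rewrite !ffunE /= cpq; apply: entry_incr => //; apply: (valP q).
- by rewrite ffunE /= leq_maxl.
pose Q (c : 'I_num_cols) := entry c (fst_ix x) == snd_ix x.
rewrite count_mword (eq_card (B := [pred p : cell | (cell_row p == fst_ix x) && Q (cell_col p)])); last first.
  move=> p; rewrite !inE -[pattern_filling p == _]val_eqE ffunE /= /Q.
  by case: eqP => // ->.
rewrite card_row; have xl := ixpair_lt x; have xn := ltn_ord (snd_ix x).
set i : nat := fst_ix x; set j : nat := snd_ix x.
have hi : (head_sum i + rsum T i j <= num_cols)%N.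
  by rewrite -(head_sum_split i) leq_add2l; apply: rsum_bound.
have -> : T x = (head_sum i + rsum T i j - (head_sum i + rsum T i j.+1))%N.
  by rewrite subnDl rsum_ix addnK.
rewrite -(card_interval _ hi); apply: eq_card => c; rewrite !inE /Q -/i -/j.
have Ej : (j <= entry c i)%N = (c < head_sum i + rsum T i j)%N by rewrite entry_ge ?xl.
(* For j.+1 = n the lemma [entry_ge] does not apply; both sides are then false because entries are
   smaller than n. *)
have Ej1 : (j < entry c i)%N = (c < head_sum i + rsum T i j.+1)%N && (j.+1 < n)%N.
  case: (ltnP j.+1 n) => jn; first by rewrite entry_ge ?jn ?(ltnW xl) ?andbT // ltnS ltnW.
  rewrite andbF; apply/negbTE; rewrite -leqNgt -ltnS.
  exact: leq_trans (entry_lt c (fst_ix x)) jn.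
have jn0 : (n <= j.+1)%N -> rsum T i j.+1 = 0%N by exact: rsum_ge.
rewrite eqn_leq [(entry c i <= j)%N]leqNgt Ej1 Ej.
by case: (ltnP j.+1 n) Ej1 jn0 => h Ej1 jn0; [|have := jn0 isT]; lia.
Qed.

End PatternFilling.

Section StandardWords.
Variables (K : numClosedFieldType) (n : nat) (L : lmodType K) (act : 'M[K]_n -> L -> L).
Hypothesis act_rep : is_rep act.
Variables (lam : 'I_n.-1 -> nat) (v : L).
Hypotheses (v_hwv : is_hwv act lam v) (v0 : v != 0).
Hypothesis n_gt0 : (0 < n)%N.

Let w := antisymmetrizer K (@cell_col n lam) (@cell_row n lam).

Lemma antisymmetrizer_hwv : is_hwv (@tensor_act K n _) lam w.
Proof.
split=> [i j ij|k i j ik jk].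
  exact: (antisymmetrizer_raise _ (@cell_down n lam) ij).
have -> : delta_mx i i - delta_mx j j = (-1) *: delta_mx j j + delta_mx i i :> 'M[K]_n.
  by rewrite scaleN1r addrC.
rewrite tensor_act_linl !antisymmetrizer_weight scalerA -scalerDl; congr (_ *: _).
rewrite !card_row_total mulN1r addrC -natrB; last first.
  by rewrite leq_sub2l // head_sum_mono // ik jk.
congr (_%:R); rewrite ik jk head_sumS.
have : (head_sum lam k + lam k <= num_cols lam)%N.
  rewrite -head_sumS -(head_sum_split lam k.+1); exact: leq_addr.
lia.
Qed.

(** After transfer to the tensor model, the relation is read at the coordinate of the tableau of T:
    all smaller words vanish there and the word of T does not. *)
Lemma mword_not_initial (T : {ffun ixpair n -> nat}) (c : {fmonom ixpair n} -> K)
    (ms : seq {fmonom ixpair n}) (m : {fmonom ixpair n}) :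
  gt_point lam T -> m = mword T :> seq _ -> uniq ms -> m \in ms ->
  (forall m', m' \in ms -> m' != m -> mon_lt m' m) ->
  \sum_(m' <- ms) c m' *: fword act m' v = 0 -> c m = 0.
Proof.
move=> hT mE ums mms mmax Hv.
pose i0 := Ordinal n_gt0.
have Hw : \sum_(m' <- ms) c m' *: fword (@tensor_act K n _) m' w = 0.
  have := @annihilator_transfer K n L _ act _ act_rep (@tensor_rep K n _) lam v w
    v_hwv antisymmetrizer_hwv v0 i0 erefl (@hform K n _) (@hform_lin K n _)
    (@hform0 K n _) (fun i j y z _ => hform_adj i j y z) (@hform_def K n _ ^~ w)
    [seq val m' | m' <- ms] (fun s => c (FMonom s)).
  rewrite !big_map => H; rewrite -[RHS]H.
    by apply: eq_bigr => m' _; rewrite fmK.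
  by rewrite -[RHS]Hv; apply: eq_bigr => m' _; rewrite fmK.
have tb := tableau_pattern_filling hT; rewrite -mE in tb.
have sm : sorted (@pair_le n) m by rewrite mE; apply: sorted_mword.
move: Hw => /ffunP/(_ (pattern_filling lam T)).
rewrite sum_ffunE (bigD1_seq m) //= big_seq_cond big1 => [|m' /andP[m'ms m'm]]; last first.
  rewrite ffunE (fword_mon_lt_eq0 K (@cell_inj n lam) (@cell_down n lam) sm tb) ?scaler0 //.
  exact: mmax.
rewrite addr0 !ffunE => /eqP; rewrite mulf_eq0 => /orP[/eqP //|].
by rewrite (negPf (lt0r_neq0 (fword_tableau_gt0 K (@cell_inj n lam) (@cell_down n lam) sm tb))).
Qed.

End StandardWords.

(** * Words violating the inequalities *)

(* Moving the Y's to the right through a power of X base turns some of the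
   X base into other X's. All coefficients are natural numbers, so a term
   found once in the expansion cannot cancel. *)
Section Leibniz.
Variables (K : fieldType) (L : lmodType K) (J : eqType) (X Y : J -> {linear L -> L}).
Variable base : J.
Hypothesis X_comm : forall l m z, X l (X m z) = X m (X l z).
Hypothesis Y_comm : forall l m z, l != base -> m != base -> Y l (Y m z) = Y m (Y l z).
Hypothesis Y_X : forall l m z, l != base ->
  Y l (X m z) = X m (Y l z) + (if m == base then X l z else 0).

Definition Xw (s : seq J) (z : L) : L := foldr (fun l => X l) z s.
Definition Yw (s : seq J) (z : L) : L := foldr (fun l => Y l) z s.

Lemma XwD s z z' : Xw s (z + z') = Xw s z + Xw s z'.
Proof. by elim: s => //= l s ->; rewrite linearD. Qed.

Lemma YwD s z z' : Yw s (z + z') = Yw s z + Yw s z'.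
Proof. by elim: s => //= l s ->; rewrite linearD. Qed.

Lemma Xw_cat s s' z : Xw (s ++ s') z = Xw s (Xw s' z).
Proof. exact: foldr_cat. Qed.

Lemma Xw_rem l s z : l \in s -> Xw s z = X l (Xw (rem l s) z).
Proof.
elim: s => //= m s IH; rewrite in_cons; case: (eqVneq m l) => [->//|ml].
by move=> /= /IH ->; rewrite X_comm.
Qed.

Lemma Yw_rem l s z : base \notin s -> l \in s -> Yw s z = Y l (Yw (rem l s) z).
Proof.
elim: s => //= m s IH; rewrite !in_cons negb_or eq_sym => /andP[mb bs].
case: (eqVneq m l) => [->//|ml] /= ls.
rewrite IH // Y_comm //; apply: contraNneq bs => <-; exact: ls.
Qed.

Lemma Xw_perm s s' z : perm_eq s s' -> Xw s z = Xw s' z.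
Proof.
elim: s s' => [|l s IH] s' h; first by rewrite perm_sym in h; rewrite (perm_nilP h).
have ls' : l \in s' by rewrite -(perm_mem h) mem_head.
rewrite (Xw_rem _ ls') /= (IH (rem l s')) // -(perm_cons l).
exact: perm_trans h (perm_to_rem ls').
Qed.

Lemma Yw_perm s s' z : base \notin s -> perm_eq s s' -> Yw s z = Yw s' z.
Proof.
elim: s s' => [|l s IH] s' bs h; first by rewrite perm_sym in h; rewrite (perm_nilP h).
have ls' : l \in s' by rewrite -(perm_mem h) mem_head.
rewrite (Yw_rem _ _ ls') -?(perm_mem h) //=.
move: bs; rewrite in_cons negb_or => /andP[_ bs].
rewrite (IH (rem l s')) // -(perm_cons l).
exact: perm_trans h (perm_to_rem ls').
Qed.

(** Sums of terms X^s Y^b u sharing two invariants of the commutation rule: the number D of X's, and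
    for each letter other than [base] its number of occurrences in X's and Y's together. The
    multiplicity of [base] is left free. *)
Inductive cone (u : L) (D : nat) (p : J -> nat) : L -> Prop :=
| cone_nil : cone u D p 0
| cone_add s b z : size s = D -> base \notin b ->
    (forall l, l != base -> count_mem l s + count_mem l b = p l)%N ->
    cone u D p z -> cone u D p (Xw s (Yw b u) + z).

Lemma coneD u D p z z' : cone u D p z -> cone u D p z' -> cone u D p (z + z').
Proof.
move=> + cz'; elim => [|s b t sD bb sb _ IH]; first by rewrite add0r.
by rewrite -addrA; apply: cone_add.
Qed.

Lemma cone_mono u D s b : size s = D -> base \notin b ->
  cone u D (fun l => count_mem l s + count_mem l b)%N (Xw s (Yw b u)).
Proof.
by move=> sD bb; rewrite -[Xw _ _]addr0; apply: cone_add => //; apply: cone_nil.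
Qed.

Lemma cone_ext u D p p' z : (forall l, l != base -> p l = p' l) ->
  cone u D p z -> cone u D p' z.
Proof.
move=> pp'; elim => [|s b t sD bb sb _ IH]; first exact: cone_nil.
by apply: cone_add => // l lb; rewrite sb ?pp'.
Qed.

Lemma coneX u D p m z : cone u D p z ->
  cone u D.+1 (fun l => (m == l) + p l)%N (X m z).
Proof.
elim => [|s b t sD bb sb _ IH]; first by rewrite linear0; apply: cone_nil.
rewrite linearD -[X m (Xw s _)]/(Xw (m :: s) _); apply: cone_add => //=; first by rewrite sD.
by move=> l lb; rewrite -addnA sb.
Qed.

Lemma coneY_mono u l s b : l != base -> base \notin b ->
  cone u (size s) (fun m => (l == m) + (count_mem m s + count_mem m b))%N
    (Y l (Xw s (Yw b u))).
Proof.
move=> lb bb; elim: s => [|m s IH] /=.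
  have lbb : base \notin l :: b by rewrite in_cons negb_or eq_sym lb.
  by apply: cone_ext (@cone_mono u 0 [::] (l :: b) erefl lbb).
rewrite Y_X //; apply: coneD.
  by apply: cone_ext (coneX m IH) => k _; rewrite addnCA -!addnA.
case: eqP => [->|_]; last exact: cone_nil.
apply: cone_ext (@cone_mono u (size s).+1 (l :: s) b erefl bb) => k kb /=.
by rewrite [base == k]eq_sym (negPf kb) add0n addnA.
Qed.

Lemma coneY u D p l z : l != base -> cone u D p z ->
  cone u D (fun m => (l == m) + p m)%N (Y l z).
Proof.
move=> lb; elim => [|s b t sD bb sb _ IH]; first by rewrite linear0; apply: cone_nil.
rewrite linearD; apply: coneD => //; rewrite -sD.
by apply: cone_ext (coneY_mono u s lb bb) => k kb; rewrite sb.
Qed.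

Lemma coneYw u D p e z : base \notin e -> cone u D p z ->
  cone u D (fun m => count_mem m e + p m)%N (Yw e z).
Proof.
elim: e => //= l e IH; rewrite in_cons negb_or eq_sym => /andP[lb be] cz.
by apply: cone_ext (coneY lb (IH be cz)) => k _; rewrite addnA.
Qed.

(** The term singled out is the one where each Y of h converts a different X base. *)
Lemma Yw_Xbase u D h : base \notin h -> (size h <= D)%N ->
  exists2 c, cone u D (fun l => count_mem l h) c &
    Yw h (Xw (nseq D base) u) = Xw (h ++ nseq (D - size h) base) u + c.
Proof.
elim: h => [|l h IH] /=.
  by exists 0; [apply: cone_nil | rewrite subn0 addr0].
rewrite in_cons negb_or eq_sym => /andP[lb bh] hD.
have [c cc ->] := IH bh (ltnW hD); set k := (D - (size h).+1)%N.
have -> : (D - size h = k.+1)%N by rewrite /k -subSn.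
have E g z : base \notin g -> Y l (Xw g z) = Xw g (Y l z).
  elim: g => //= m g IHg; rewrite in_cons negb_or eq_sym => /andP[mb bg].
  by rewrite Y_X // (negPf mb) addr0 IHg.
exists (Xw h (X base (Y l (Xw (nseq k base) u))) + Y l c).
  apply: coneD; last exact: coneY.
  have := coneY_mono u (nseq k base) lb (isT : base \notin [::]).
  rewrite size_nseq => /(coneX base) H.
  have {}H : cone u (size h + k.+1) (fun m => count_mem m h + ((base == m) +
      ((l == m) + (count_mem m (nseq k base) + 0))))%N
      (Xw h (X base (Y l (Xw (nseq k base) u)))).
    elim: (h) => //= m g IHg; apply: cone_ext (coneX m IHg) => r _; by rewrite addnA.
  rewrite (_ : size h + k.+1 = D)%N in H; last by rewrite /k; lia.
  apply: cone_ext H => m mb; rewrite count_nseq /= [base == m]eq_sym (negPf mb).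
  by rewrite mul0n add0n !addn0 addnC.
rewrite linearD addrA; congr (_ + _).
rewrite Xw_cat E // [Xw (nseq k.+1 base) u]/= Y_X // eqxx XwD addrC; congr (_ + _).
by rewrite -[X l _]/(Xw (l :: nseq k base) u) -Xw_cat -[RHS]/(Xw (l :: h ++ nseq k base) u);
  apply: Xw_perm; rewrite perm_catC perm_cons perm_catC.
Qed.

(** If [h] has length D, the distinguished term has no X base left, and the Y's of [e] commute with
    it down to u. *)
Lemma Yw_Yw_Xbase u D e h : base \notin h -> base \notin e -> (size h <= D)%N ->
  (e = [::] \/ size h = D) ->
  exists2 c, cone u D (fun l => count_mem l e + count_mem l h)%N c &
    Yw e (Yw h (Xw (nseq D base) u)) = Xw (h ++ nseq (D - size h) base) (Yw e u) + c.
Proof.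
move=> bh be hD eh; have [c cc ->] := Yw_Xbase u bh hD.
exists (Yw e c); first exact: coneYw.
rewrite YwD; congr (_ + _); case: eh => [->//|hs]; rewrite hs subnn cats0.
elim: e be {cc} => //= l e IH; rewrite in_cons negb_or eq_sym => /andP[lb be].
rewrite IH //; elim: (h) bh => //= m g IHg; rewrite in_cons negb_or eq_sym => /andP[mb bg].
by rewrite Y_X // (negPf mb) addr0 IHg.
Qed.

End Leibniz.

Section Nilpotency.
Variables (K : numFieldType) (n : nat) (L : vectType K) (act : 'M[K]_n -> L -> L).
Hypothesis act_rep : is_rep act.
Variables (i j : 'I_n) (u : L) (m : nat).
Hypothesis ij : i != j.
Let e := delta_mx i j : 'M[K]_n.
Let f := delta_mx j i : 'M[K]_n.
Let h := delta_mx i i - delta_mx j j : 'M[K]_n.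
Hypothesis e_u : act e u = 0.
Hypothesis h_u : act h u = m%:R *: u.

HB.instance Definition _ A := GRing.isLinear.Build K L L *:%R (act A) (act_lin act_rep A).

Let z k := iter k (act f) u.

Lemma tr_e : \tr e = 0. Proof. by rewrite mxtrace_delta (negPf ij). Qed.
Lemma tr_f : \tr f = 0. Proof. by rewrite mxtrace_delta eq_sym (negPf ij). Qed.
Lemma tr_h : \tr h = 0. Proof. by rewrite linearB /= !mxtrace_delta !eqxx subrr. Qed.

Lemma bracket_ef : bracket e f = h.
Proof. by rewrite bracket_delta !eqxx !scale1r. Qed.

Lemma bracket_hf : bracket h f = (- 2%:R) *: f.
Proof.
have -> : bracket h f = bracket (delta_mx i i) f - bracket (delta_mx j j) f.
  rewrite /bracket /h mulmxBl mulmxBr !opprB addrACA [RHS]addrACA; congr (_ + _).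
  exact: addrC.
rewrite !bracket_delta (negPf ij) !eqxx !scale0r !scale1r sub0r subr0 -opprD.
by rewrite -mulr2n -scaler_nat scaleNr.
Qed.

Lemma h_z k : act h (z k) = (m%:R - 2%:R * k%:R) *: z k.
Proof.
elim: k => [|k IH]; first by rewrite mulr0 subr0.
rewrite /z iterS act_bracket ?tr_h ?tr_f // bracket_hf actZ ?tr_f // -/(z k) IH linearZ -scalerDl.
by congr (_ *: _); rewrite -[k.+1%:R]natr1; ring.
Qed.

Lemma e_z k : act e (z k.+1) = (k.+1%:R * (m%:R - k%:R)) *: z k.
Proof.
have R1 k' : act e (z k'.+1) = act h (z k') + act f (act e (z k')).
  by rewrite /z iterS act_bracket ?tr_e ?tr_f // bracket_ef.
elim: k => [|k IH]; rewrite R1 h_z.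
  by rewrite [z 0]/= e_u (actr0 act_rep) addr0 mulr0 !subr0 mul1r.
rewrite IH linearZ /= -[act f (z k)]/(z k.+1) -scalerDl; congr (_ *: _).
by rewrite -!natr1; ring.
Qed.

(** For k > m, [e] maps f^{k+1} u to a nonzero multiple of f^k u; so if f^D u were nonzero, no power
    of f would kill u. These powers would be infinitely many eigenvectors of h with distinct
    eigenvalues, against finite dimension. *)
Lemma nilpotent_lowering D : (m < D)%N -> iter D (act f) u = 0.
Proof.
move=> mD; apply/eqP; apply: contraT => zD; exfalso.
have step k : (m < k)%N -> z k != 0 -> z k.+1 != 0.
  move=> mk; apply: contraNneq => zk1; move: (e_z k); rewrite zk1 (actr0 act_rep).
  move=> /esym/eqP; rewrite scaler_eq0 mulf_eq0 pnatr_eq0 /= subr_eq0 eqr_nat.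
  by rewrite ltn_eqF.
have up k : z (D + k) != 0.
  elim: k => [|k IH]; first by rewrite addn0.
  by rewrite addnS; apply: step => //; apply: leq_trans mD (leq_addr _ _).
have z0 k : z k != 0.
  apply: contraNneq (up k) => zk; rewrite /z iterD -/(z k) zk.
  by apply/eqP; elim: D {mD zD up} => //= d ->; rewrite (actr0 act_rep).
pose d := \dim (fullv : {vspace L}).
pose t := [tuple z k | k < d.+1].
have : free t.
  apply/freeP => c Hc k.
  pose mu (k : nat) : K := m%:R - 2%:R * k%:R.
  have mu_inj a b : mu a = mu b -> a = b.
    by move=> /addrI/oppr_inj/mulfI; rewrite pnatr_eq0 => /(_ isT)/eqP; rewrite eqr_nat => /eqP.
  (* Removing all eigenvalues but the k-th from a linear relation isolates its k-th coefficient. *)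
  pose s := [seq mu l | l : 'I_d.+1 <- enum 'I_d.+1 & l != k].
  have kz (l : nat) : kill (act h) s (z l) = (\prod_(nu <- s) (mu l - nu)) *: z l.
    exact/kill_eigen/h_z.
  have := congr1 (kill (act h) s) Hc.
  rewrite linear_sum (linear0 (kill (act h) s)) (bigD1 k) //= big1 ?addr0 => [|l lk].
    rewrite linearZ /= (nth_mktuple (fun k : 'I_d.+1 => z k)) kz scalerA => /eqP.
    rewrite scaler_eq0 (negPf (z0 k)) orbF mulf_eq0 prodf_seq_eq0 => /orP[/eqP //|].
    move=> /hasP[nu /mapP[l]]; rewrite mem_filter => /andP[lk _] -> /=.
    by rewrite subr_eq0 => /eqP/mu_inj kl; case/eqP: lk; apply: val_inj.
  rewrite linearZ /= (nth_mktuple (fun k : 'I_d.+1 => z k)) kz (_ : \prod_(_ <- _) _ = 0) ?scale0r ?scaler0 //.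
  apply/eqP; rewrite prodf_seq_eq0; apply/hasP; exists (mu l); last by rewrite /= subrr.
  by apply/mapP; exists l => //; rewrite mem_filter lk mem_enum.
move=> /eqP; rewrite size_tuple => ft.
have : (\dim <<t>> <= d)%N by apply/dimvS/subvf.
by rewrite ft ltnn.
Qed.

End Nilpotency.

Section SeqFacts.

Lemma sum_seq_count (J : finType) (s : seq J) (g : J -> nat) :
  (\sum_(l <- s) g l = \sum_(l : J) count_mem l s * g l)%N.
Proof.
elim: s => [|m s IH]; first by rewrite big_nil big1.
rewrite big_cons IH (bigD1 m) //= [RHS](bigD1 m) //= eqxx mulnDl mul1n -addnA.
by congr addn; congr addn; apply: eq_bigr => l lm; rewrite eq_sym (negPf lm).
Qed.

Lemma count_seq_count (J : finType) (s : seq J) (p : pred J) :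
  (count p s = \sum_(l | p l) count_mem l s)%N.
Proof.
rewrite -sum1_count big_mkcond sum_seq_count [RHS]big_mkcond /=.
by apply: eq_bigr => l _; case: (p l); rewrite ?muln1 ?muln0.
Qed.

Lemma first_diff (J : eqType) (s t : seq J) : size s = size t -> s != t ->
  exists q x x' s1 t1, [/\ s = q ++ x :: s1, t = q ++ x' :: t1 & x != x'].
Proof.
elim: s t => [|x s IH] [|x' t] //= [st].
case: (eqVneq x x') => [<-|xx' _]; last by exists [::], x, x', s, t.
rewrite eqseq_cons eqxx /= => /(IH _ st)[q [y [y' [s1 [t1 [-> -> yy']]]]]].
by exists (x :: q), y, y', s1, t1.
Qed.

Lemma sorted_filter_split (J : eqType) (le : rel J) (s : seq J) (Q : pred J) :
  transitive le -> (forall x y, le x y -> Q x -> Q y) -> sorted le s ->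
  s = filter (predC Q) s ++ filter Q s.
Proof.
move=> le_tr up; elim: s => //= x s IH; rewrite (path_sortedE le_tr) => /andP[xs ss].
case: (boolP (Q x)) => Qx /=; last by rewrite -IH.
have -> : filter (predC Q) s = [::].
  apply/eqP; rewrite -[_ == _]negbK -has_filter; apply/hasPn => y ys /=.
  by rewrite negbK; apply: up Qx; apply: (allP xs).
congr cons; apply/esym/all_filterP/allP => y ys; apply: up Qx; exact: (allP xs).
Qed.

Lemma filter_pred1 (J : eqType) (s : seq J) x : filter (pred1 x) s = nseq (count_mem x s) x.
Proof. by rewrite -size_filter; apply/all_pred1P/filter_all. Qed.

End SeqFacts.

(** * The relation attached to a violated inequality *)

Section ViolatingWords.
Variables (K : numFieldType) (n : nat) (L : vectType K) (act : 'M[K]_n -> L -> L).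
Hypothesis act_rep : is_rep act.
Variables (lam : 'I_n.-1 -> nat) (v : L).
Hypothesis v_hwv : is_hwv act lam v.

HB.instance Definition _ A := GRing.isLinear.Build K L L *:%R (act A) (act_lin act_rep A).

Lemma act_comm A B z : \tr A = 0 -> \tr B = 0 -> bracket A B = 0 ->
  act A (act B z) = act B (act A z).
Proof. by move=> tA tB AB; rewrite act_bracket // AB (act0 act_rep) add0r. Qed.

Variable k : 'I_n.-1.
Variables (i a : 'I_n).
Hypotheses (i_k : i = k :> nat) (a_k : a = k.+1 :> nat).

Lemma raise_word (s : seq (ixpair n)) : {in s, forall y, (a <= fst_ix y)%N} ->
  act (delta_mx i a) (fword act s v) = 0.
Proof.
elim: s => [_|y s IH ys] /=; first by case: v_hwv => H _; apply: H; rewrite i_k a_k.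
have ay : (a <= fst_ix y)%N by apply: ys; rewrite mem_head.
have y1 := ixpair_lt y.
rewrite act_bracket ?mxtrace_fneg //; last by rewrite mxtrace_delta -val_eqE /= i_k a_k; case: ltngtP (ltnSn k).
rewrite IH => [|z zs]; last by apply: ys; rewrite in_cons zs orbT.
rewrite bracket_delta -!val_eqE /=.
rewrite (_ : (a == snd_ix y :> nat) = false); last by lia.
rewrite (_ : (fst_ix y == i :> nat) = false); last by lia.
by rewrite !scale0r subrr (act0 act_rep) (actr0 act_rep) addr0.
Qed.

Lemma weight_word (s : seq (ixpair n)) : {in s, forall y, (a <= fst_ix y)%N} ->
  act (delta_mx i i - delta_mx a a) (fword act s v) =
  (lam k + count (fun y => fst_ix y == a) s)%:R *: fword act s v.
Proof.
elim: s => [_|y s IH ys] /=; first by rewrite addn0; case: v_hwv => _ H; apply: (H k).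
have ay : (a <= fst_ix y)%N by apply: ys; rewrite mem_head.
have y1 := ixpair_lt y.
have tr0 : \tr (delta_mx i i - delta_mx a a : 'M[K]_n) = 0.
  by rewrite linearB /= !mxtrace_delta !eqxx subrr.
rewrite act_bracket ?mxtrace_fneg // IH => [|z zs]; last by apply: ys; rewrite in_cons zs orbT.
have -> : bracket (delta_mx i i - delta_mx a a) (fneg K y) = (fst_ix y == a)%:R *: fneg K y.
  have -> : bracket (delta_mx i i - delta_mx a a) (fneg K y) =
      bracket (delta_mx i i) (fneg K y) - bracket (delta_mx a a) (fneg K y).
    rewrite /bracket mulmxBl mulmxBr !opprB addrACA [RHS]addrACA; congr (_ + _).
    exact: addrC.
  rewrite !bracket_delta.
  rewrite (_ : (i == snd_ix y) = false); last by rewrite -val_eqE /=; lia.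
  rewrite (_ : (fst_ix y == i) = false); last by rewrite -val_eqE /=; lia.
  rewrite (_ : (a == snd_ix y) = false); last by rewrite -val_eqE /=; lia.
  rewrite !scale0r subrr !sub0r opprK.
  by rewrite /fneg; case: eqP => [->|]; rewrite ?scale0r.
rewrite actZ ?mxtrace_fneg // linearZ -scalerDl; congr (_ *: _).
by rewrite -natrD addnCA.
Qed.

Definition row_letter : Type := {x : ixpair n | fst_ix x == i}.
HB.instance Definition _ := Finite.on row_letter.
Implicit Types (l : row_letter) (s b : seq row_letter).

Lemma row_fst l : fst_ix (val l) = i. Proof. exact/eqP/(valP l). Qed.

Lemma row_lt l : (i < snd_ix (val l))%N.
Proof. by have := ixpair_lt (val l); rewrite row_fst. Qed.

Lemma i_lt_a : (i < a)%N. Proof. by rewrite i_k a_k. Qed.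

Definition mkrow (c : 'I_n) (ic : (i < c)%N) : row_letter :=
  exist (fun x => fst_ix x == i) (exist (fun x : 'I_n * 'I_n => x.1 < x.2)%N (i, c) ic) (eqxx i).

Definition base_letter : row_letter := mkrow i_lt_a.

Definition letter_of (c : 'I_n) : row_letter :=
  if (insub c : option {c : 'I_n | (i < c)%N}) is Some d then mkrow (valP d)
  else base_letter.

Lemma snd_letter_of (c : 'I_n) : (i < c)%N -> snd_ix (val (letter_of c)) = c.
Proof. by move=> ic; rewrite /letter_of insubT. Qed.

(** For the base letter (a, a) is not a pair, and the default value is returned. *)
Definition next_row l : ixpair n := insubd (val l) (a, snd_ix (val l)).

Lemma row_letter_eq l l' : snd_ix (val l) = snd_ix (val l') -> l = l'.
Proof.
move=> ll'; apply/val_inj/ixpair_eqP; first by rewrite !row_fst.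
by rewrite ll'.
Qed.

Lemma base_le l : (a <= snd_ix (val l))%N.
Proof. by rewrite a_k -i_k row_lt. Qed.

Lemma base_lt l : l != base_letter -> (a < snd_ix (val l))%N.
Proof.
move=> lb; rewrite ltn_neqAle base_le andbT; apply: contraNneq lb => al.
by apply/eqP/row_letter_eq/val_inj.
Qed.

Lemma next_rowE l : l != base_letter ->
  fst_ix (next_row l) = a /\ snd_ix (next_row l) = snd_ix (val l).
Proof.
by move=> /base_lt al; rewrite /next_row /insubd insubT.
Qed.

Let X l : {linear L -> L} := act (fneg K (val l)).
(** For the base letter this would be a diagonal unit, which is not traceless; hence the side
    conditions on l in the relations below. *)
Let Y l : {linear L -> L} := act (delta_mx (snd_ix (val l)) a).

Lemma X_comm l m z : X l (X m z) = X m (X l z).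
Proof.
apply: act_comm; rewrite ?mxtrace_fneg // bracket_delta !row_fst.
by rewrite -!val_eqE /= !ltn_eqF ?row_lt // !scale0r subrr.
Qed.

Lemma tr_Y l : l != base_letter -> \tr (delta_mx (snd_ix (val l)) a : 'M[K]_n) = 0.
Proof. by move=> lb; rewrite mxtrace_delta -val_eqE /= gtn_eqF // base_lt. Qed.

Lemma Y_comm l m z : l != base_letter -> m != base_letter -> Y l (Y m z) = Y m (Y l z).
Proof.
move=> lb mb; apply: act_comm; rewrite ?tr_Y // bracket_delta.
by rewrite -!val_eqE /= !ltn_eqF ?base_lt // !scale0r subrr.
Qed.

Lemma Y_X l m z : l != base_letter ->
  Y l (X m z) = X m (Y l z) + (if m == base_letter then X l z else 0).
Proof.
move=> lb; rewrite /= act_bracket ?tr_Y ?mxtrace_fneg // addrC; congr (_ + _).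
rewrite bracket_delta !row_fst.
rewrite (_ : (i == _) = false) ?scale0r ?subr0; last first.
  by rewrite -val_eqE /= ltn_eqF // row_lt.
case: (eqVneq m base_letter) => [->|mb].
  by rewrite [a == _]eqxx scale1r /fneg row_fst.
by rewrite -val_eqE /= ltn_eqF ?base_lt // scale0r (act0 act_rep).
Qed.

Lemma fword_row s z : fword act (map val s) z = Xw X s z.
Proof. by elim: s => //= l s ->. Qed.

Lemma fword_next_row b z : base_letter \notin b ->
  fword act (map next_row b) z = Yw Y b z.
Proof.
elim: b => //= l b IH; rewrite in_cons negb_or eq_sym => /andP[lb bb].
by rewrite IH // /fneg; have [-> ->] := next_rowE lb.
Qed.

Variables (m : seq (ixpair n)) (j : nat).
Hypotheses (m_sorted : sorted (@pair_le n) m) (i_lt_j : (i < j)%N).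

(** The sorted word is cut before (i, j), after row i, and after (a, j). With the last cut, the row
    a letters of the tail number rsum T k.+1 j.+1, so the weight of the tail is the right side of
    the violated inequality. *)
Let Q1 (x : ixpair n) := ((i < fst_ix x) || ((fst_ix x == i :> nat) && (j <= snd_ix x)))%N.
Let Q2 (x : ixpair n) := (i < fst_ix x)%N.
Let Q3 (x : ixpair n) := ((a < fst_ix x) || ((fst_ix x == a :> nat) && (j < snd_ix x)))%N.
Let m1 := filter (predC Q1) m.
Let mx := filter (predC Q2) (filter Q1 m).
Let my := filter (predC Q3) (filter Q2 (filter Q1 m)).
Let mr := filter Q3 (filter Q2 (filter Q1 m)).

Lemma word_split : m = m1 ++ mx ++ my ++ mr.
Proof.
have tr := @pair_le_trans n.
rewrite {1}(sorted_filter_split (Q := Q1) tr _ m_sorted) => [|x y]; last first.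
  by rewrite pair_leE /Q1 -!val_eqE /=; lia.
congr (_ ++ _); have s1 : sorted (@pair_le n) (filter Q1 m) by apply: sorted_filter.
rewrite {1}(sorted_filter_split (Q := Q2) tr _ s1) => [|x y]; last first.
  by rewrite pair_leE /Q2 -!val_eqE /=; lia.
congr (_ ++ _); have s2 : sorted (@pair_le n) (filter Q2 (filter Q1 m)) by apply: sorted_filter.
rewrite {1}(sorted_filter_split (Q := Q3) tr _ s2) // => x y.
by rewrite pair_leE /Q3 -!val_eqE /=; lia.
Qed.

Lemma mem_mx x : x \in mx -> fst_ix x = i /\ (j <= snd_ix x)%N.
Proof.
rewrite !mem_filter /= /Q1 /Q2 => /and3P[h1 h2 _].
have h : fst_ix x = i by apply: val_inj => /=; lia.
by split=> //; move: h1 h2; rewrite h; lia.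
Qed.

Lemma mem_my x : x \in my -> fst_ix x = a /\ (snd_ix x <= j)%N.
Proof.
rewrite !mem_filter /= /Q3 /Q2 => /and4P[h1 h2 _ _].
have h : fst_ix x = a by apply: val_inj => /=; move: h1 h2; rewrite i_k a_k; lia.
by split=> //; move: h1 h2; rewrite h; lia.
Qed.

Lemma mem_mr x : x \in mr -> (a <= fst_ix x)%N.
Proof. by rewrite !mem_filter /Q3 => /andP[h _]; lia. Qed.

Let T : {ffun ixpair n -> nat} := [ffun x => count_mem x m].

Lemma rsum_count (r c : nat) :
  rsum T r c = count (fun x => (fst_ix x == r :> nat) && (c <= snd_ix x)%N) m.
Proof. by rewrite count_seq_count; apply: eq_bigr => x _; rewrite ffunE. Qed.

Lemma size_mx : size mx = rsum T k j.
Proof.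
rewrite rsum_count !size_filter count_filter; apply: eq_count => x /=.
by rewrite /Q1 /Q2 i_k; lia.
Qed.

Lemma count_mr : count (fun y => fst_ix y == a) mr = rsum T k.+1 j.+1.
Proof.
rewrite rsum_count /mr !count_filter; apply: eq_count => x /=.
by rewrite /Q1 /Q2 /Q3 -val_eqE /= i_k a_k; lia.
Qed.

Let sx : seq row_letter := [seq letter_of (snd_ix x) | x <- mx].
Let e : seq row_letter := [seq letter_of (snd_ix x) | x <- my].
Let u := fword act mr v.

Lemma val_sx : map val sx = mx.
Proof.
rewrite -map_comp -[RHS]map_id; apply/eq_in_map => x /mem_mx[xi _] /=.
apply: ixpair_eqP; first by rewrite row_fst xi.
by rewrite snd_letter_of // -xi ixpair_lt.
Qed.

Lemma snd_e l : l \in e -> (a < snd_ix (val l) <= j)%N.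
Proof.
move=> /mapP[x /mem_my[xa xj] ->]; have ax := ixpair_lt x; rewrite xa in ax.
by rewrite snd_letter_of ?ax ?xj // (ltn_trans i_lt_a ax).
Qed.

Lemma base_notin_e : base_letter \notin e.
Proof. by apply/negP => /snd_e; rewrite ltnn. Qed.

Lemma next_row_e : map next_row e = my.
Proof.
rewrite -map_comp -[RHS]map_id; apply/eq_in_map => x xmy /=.
have [xa xj] := mem_my xmy; have ax := ixpair_lt x; rewrite xa in ax.
have eb : letter_of (snd_ix x) != base_letter.
  by apply: contraNneq base_notin_e => <-; apply: map_f.
have [h1 h2] := next_rowE eb; apply: ixpair_eqP; first by rewrite h1 xa.
by rewrite h2 snd_letter_of // (ltn_trans i_lt_a ax).
Qed.

Lemma fword_m : fword act m v = fword act m1 (Xw X sx (Yw Y e u)).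
Proof.
rewrite word_split !fword_cat -val_sx -next_row_e fword_row.
by rewrite fword_next_row ?base_notin_e.
Qed.

Let h := filter (predC1 base_letter) sx.

Lemma perm_h : perm_eq (h ++ nseq (size mx - size h) base_letter) sx.
Proof.
have -> : (size mx - size h)%N = count_mem base_letter sx.
  by rewrite -val_sx size_map size_filter -(count_predC (pred1 base_letter) sx) addnK.
by rewrite -filter_pred1 perm_catC perm_filterC.
Qed.

Lemma base_notin_h : base_letter \notin h.
Proof. by rewrite mem_filter /= eqxx. Qed.

Lemma count_h l : l != base_letter -> count_mem l h = count_mem l sx.
Proof.
move=> lb; rewrite count_filter; apply: eq_count => x /=.
by case: (eqVneq x l) => // ->; rewrite lb.
Qed.

(** Heights agree because a letter of row i is one higher than the letter of row a with the same
    end, and the number of row i letters is fixed. It remains to exclude that the first difference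
    with [mx] is upwards. *)
Lemma smaller_term s b : size s = size mx -> base_letter \notin b ->
  (forall l, l != base_letter ->
     count_mem l s + count_mem l b = count_mem l e + count_mem l h)%N ->
  ~~ perm_eq s sx ->
  exists w, mon_lt (FMonom w) (FMonom m) /\
    fword act m1 (Xw X s (Yw Y b u)) = fword act w v.
Proof.
move=> sD bb sb nperm.
pose s' := sort (relpre val (@pair_le n)) s; pose wx : seq (ixpair n) := map val s'.
have ps' : perm_eq s' s by rewrite perm_sort.
have wxs : sorted (@pair_le n) wx.
  by rewrite sorted_map; apply: sort_sorted => x y; apply: pair_le_total.
exists (m1 ++ wx ++ map next_row b ++ mr); split; last first.
  rewrite !fword_cat fword_row fword_next_row // (Xw_perm X_comm _ ps') //.
right; split.
  rewrite /mon_height /= [in RHS]word_split !big_cat /= -val_sx -next_row_e.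
  congr (_ + _)%N; rewrite !addnA; congr (_ + _)%N.
  pose g l := (snd_ix (val l) - a)%N.
  have E1 (t : seq row_letter) :
      (\sum_(x <- map val t) (snd_ix x - fst_ix x) = size t + \sum_(l <- t) g l)%N.
    rewrite big_map -sum1_size -big_split; apply: eq_bigr => l _ /=; rewrite row_fst /g.
    by have := base_le l; rewrite i_k a_k -[sval l]/(val l); lia.
  have E2 (t : seq row_letter) : base_letter \notin t ->
      (\sum_(x <- map next_row t) (snd_ix x - fst_ix x) = \sum_(l <- t) g l)%N.
    move=> bt; rewrite big_map !big_seq; apply: eq_bigr => l lt.
    have /next_rowE[-> ->] // : l != base_letter by apply: contraNneq bt => <-.
  rewrite !E1 !E2 ?base_notin_e // (perm_size ps') sD -val_sx size_map -!addnA; congr (_ + _)%N.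
  rewrite (perm_big _ ps') /= (sum_seq_count s) (sum_seq_count b) (sum_seq_count sx) (sum_seq_count e).
  rewrite -!big_split; apply: eq_bigr => l _ /=.
  rewrite -!mulnDl; case: (eqVneq l base_letter) => [->|lb]; first by rewrite /g subnn !muln0.
  by rewrite sb // count_h // addnC.
have swx : size wx = size mx by rewrite size_map (perm_size ps').
have wxmx : wx != mx.
  apply: contraNneq nperm; rewrite -val_sx => /(inj_map val_inj) <-.
  by rewrite perm_sym.
have [q [x [x' [s1 [t1 [wxE mxE xx']]]]]] := first_diff swx wxmx.
exists (m1 ++ q), (s1 ++ map next_row b ++ mr), (t1 ++ my ++ mr), x, x'.
split; [by rewrite /= wxE -!catA | by rewrite /= [LHS]word_split mxE -!catA |].
case: (boolP (pair_lt x x')) => // nlt.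
have x'x : pair_le x' x.
  by case/orP: (pair_le_total x x') => //; rewrite /pair_le (negPf xx') (negPf nlt).
have [x'i x'j] : fst_ix x' = i /\ (j <= snd_ix x')%N.
  by apply: mem_mx; rewrite mxE mem_cat mem_head orbT.
have rowx y : y \in wx -> exists2 l, l \in s & y = val l.
  by move=> /mapP[l ls ->]; exists l; rewrite // -(perm_mem ps').
have xi : fst_ix x = i.
  by have /rowx[l _ ->] : x \in wx; rewrite ?row_fst // wxE mem_cat mem_head orbT.
(* Suppose x > x' at the first difference. Letters from x on end beyond j, while those of [e] end at
   j at the latest, so all their occurrences come from [mx]. But from this position on, every letter
   of [wx] is at least x, whereas x' is not: [wx] would have more of them. *)
have le_count : (count (pair_le x) wx <= count (pair_le x) mx)%N.
  rewrite !count_seq_count; apply: leq_sum => y xy.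
  case: (boolP (y \in wx)) => [/rowx[l _ yl]|]; last by rewrite -has_pred1 has_count lt0n negbK => /eqP ->.
  have jl : (j < snd_ix (val l))%N.
    move: xy x'x xx'; rewrite yl !pair_leE row_fst xi x'i ltnn eqxx /= => xy x'x xx'.
    apply: leq_ltn_trans x'j (leq_trans _ xy); rewrite ltn_neqAle x'x andbT.
    by apply: contraNneq xx' => E; apply/eqP/ixpair_eqP; rewrite ?xi ?x'i.
  have lb : l != base_letter.
    by apply: contraTneq jl => ->; rewrite -leqNgt /= a_k -i_k.
  have C (t : seq row_letter) : count_mem y (map val t) = count_mem l t.
    by rewrite count_map; apply: eq_count => z /=; rewrite yl (inj_eq val_inj).
  rewrite -val_sx !C (seq.permP ps') -(count_h lb) -[leqRHS]add0n.
  have <- : count_mem l e = 0%N.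
    by apply/count_memPn/negP => /snd_e; rewrite [(_ <= j)%N]leqNgt jl andbF.
  by rewrite -sb // leq_addr.
move: le_count; rewrite wxE mxE !count_cat leq_add2l /= pair_le_refl.
have -> : pair_le x x' = false.
  by apply/negP => /orP[/eqP E|]; [rewrite E eqxx in xx' | rewrite (negPf nlt)].
have -> : count (pair_le x) s1 = size s1.
  apply/eqP; rewrite -all_count; apply/allP => y ys.
  move: wxs; rewrite wxE => /cat_sorted2[_] /(sorted_min)/(_ y); apply.
  by rewrite in_cons ys orbT.
have : size s1 = size t1 by move: swx; rewrite wxE mxE !size_cat /= => /addnI [].
by move=> ->; rewrite add0n add1n ltnNge count_size.
Qed.

Lemma cone_terms c :
  cone X Y base_letter u (size mx) (fun l => count_mem l e + count_mem l h)%N c ->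
  exists N ws, (forall w, w \in ws -> mon_lt (FMonom w) (FMonom m)) /\
    fword act m1 c = N%:R *: fword act m v + \sum_(w <- ws) fword act w v.
Proof.
elim => [|s b z sD bb sb _ [N [ws [wsm E]]]].
  by exists 0%N, [::]; split=> //; rewrite big_nil addr0 scale0r (fword0 act_rep).
rewrite (fwordD act_rep) E; case: (boolP (perm_eq s sx)) => [ps|nps].
  exists N.+1, ws; split=> //; rewrite -natr1 scalerDl scale1r [RHS]addrAC addrC; congr (_ + _).
  have pb : perm_eq b e.
    apply/allP => l _ /=; case: (eqVneq l base_letter) => [->|lb].
      by rewrite (count_memPn bb) (count_memPn base_notin_e).
    by have := sb l lb; rewrite (count_h lb) (seq.permP ps) addnC => /addIn ->.
  rewrite fword_m (Xw_perm X_comm _ ps) (Yw_perm Y_comm _ bb pb) //.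
have [w [wm Ew]] := smaller_term sD bb sb nps.
exists N, (w :: ws); split=> [w'|]; first by rewrite in_cons => /orP[/eqP ->|/wsm].
by rewrite Ew big_cons addrCA.
Qed.

Lemma violating_word : (lam k + rsum T k.+1 j.+1 < rsum T k j)%N ->
  exists N ws, (forall w, w \in ws -> mon_lt (FMonom w) (FMonom m)) /\
    N.+1%:R *: fword act m v + \sum_(w <- ws) fword act w v = 0.
Proof.
rewrite -size_mx -count_mr => hD.
have ia : i != a by rewrite -val_eqE /= ltn_eqF // i_lt_a.
have mra : {in mr, forall y, (a <= fst_ix y)%N} by move=> y; apply: mem_mr.
have X0 : Xw X (nseq (size mx) base_letter) u = 0.
  rewrite -(nilpotent_lowering act_rep ia (raise_word mra) (weight_word mra) hD).
  by elim: (size mx) => //= d ->.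
have hx : (size h <= size mx)%N by rewrite -val_sx size_map size_filter count_size.
(* A letter of [e] ends beyond a and at most at j, so a < j; the letters of [mx] end at j or later
   and none of them is the base letter. *)
have eh : e = [::] \/ size h = size mx.
  case: (eqVneq e [::]) => [|e0]; [by left | right].
  have [l le] : exists l, l \in e by case: (e) e0 => // l t _; exists l; rewrite mem_head.
  have aj : (a < j)%N by have /andP[] := snd_e le; apply: leq_trans.
  rewrite /h (all_filterP _) -?val_sx ?size_map //; apply/allP => l' l's /=.
  have : val l' \in mx by rewrite -val_sx map_f.
  move=> /mem_mx[_ jl']; apply: contraTneq jl' => ->; by rewrite -ltnNge.
have [c cc] := Yw_Yw_Xbase X_comm Y_X u base_notin_h base_notin_e hx eh.
rewrite X0 => E0; have [N [ws [wsm E]]] := cone_terms cc.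
exists N, ws; split=> //.
have E1 : Xw X sx (Yw Y e u) + c = 0.
  rewrite -(Xw_perm X_comm _ perm_h) -E0.
  have Y0 t : Yw Y t 0 = 0 by elim: t => //= l t ->; rewrite (actr0 act_rep).
  by rewrite !Y0.
by rewrite -natr1 scalerDl scale1r addrAC -E addrC fword_m -(fwordD act_rep) E1 (fword0 act_rep).
Qed.

End ViolatingWords.

(** * The degenerate module *)

Section WordOrder.
Variable n : nat.
Implicit Types (m p : {fmonom ixpair n}) (s t : seq (ixpair n)).

Lemma monM m m' : monalg.mul m m' = FMonom (m ++ m').
Proof. exact: fmmulE. Qed.

Lemma mon_height_cat s t :
  mon_height (FMonom (s ++ t)) = (mon_height (FMonom s) + mon_height (FMonom t))%N.
Proof. by rewrite /mon_height big_cat. Qed.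

Lemma mon_lt_catr m m' s : mon_lt m m' -> mon_lt (FMonom (m ++ s)) (FMonom (m' ++ s)).
Proof.
move=> [h|[h [q [t [t' [x [x' [E E' xx']]]]]]]].
  by left; rewrite !mon_height_cat ltn_add2r.
right; split; first by rewrite !mon_height_cat [mon_height (FMonom m)]h.
by exists q, (t ++ s), (t' ++ s), x, x'; split=> //=; rewrite ?E ?E' -catA.
Qed.

Lemma mon_lt_catl m m' s : mon_lt m m' -> mon_lt (FMonom (s ++ m)) (FMonom (s ++ m')).
Proof.
move=> [h|[h [q [t [t' [x [x' [E E' xx']]]]]]]].
  by left; rewrite !mon_height_cat ltn_add2l.
right; split; first by rewrite !mon_height_cat [mon_height (FMonom m)]h.
by exists (s ++ q), t, t', x, x'; split=> //=; rewrite ?E ?E' -catA.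
Qed.

Lemma mon_lt_irr m : ~ mon_lt m m.
Proof.
move=> [|[_ [q [t [t' [x [x' [E E' xx']]]]]]]]; first by rewrite ltnn.
have /(congr1 (drop (size q))) : q ++ x :: t = q ++ x' :: t' by rewrite -E -E'.
by rewrite !drop_size_cat // => -[xE _]; rewrite xE pair_ltE eqxx in xx'.
Qed.

End WordOrder.

Section FreeAlgebra.
Variables (K : fieldType) (n : nat).
Implicit Types (f g : freealg K n) (m p : {fmonom ixpair n}).

Lemma mulr_mon f p : f * << p >> = \sum_(m <- msupp f) << f@_m *g FMonom (m ++ p) >> :> freealg K n.
Proof.
rewrite [LHS]fgmulgU; apply: eq_bigr => m _.
by rewrite mulr1 monM.
Qed.

Lemma mull_mon f p : << p >> * f = \sum_(m <- msupp f) << f@_m *g FMonom (p ++ m) >> :> freealg K n.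
Proof.
rewrite [LHS]fgmulUg; apply: eq_bigr => m _.
by rewrite mul1r monM.
Qed.

Lemma mon1 : << FMonom [::] >> = 1 :> freealg K n.
Proof. by apply/malgP => m; rewrite mcoeff1 mcoeffU1 -fmoneE eq_sym. Qed.

Lemma monZ a m : << a *g m >> = a *: << m >> :> freealg K n.
Proof. by apply/malgP => p; rewrite mcoeffZ !mcoeffU; case: eqP; rewrite ?mulr1 ?mulr0. Qed.

Lemma mcoeff_sum_mon (J : finType) (w : J -> {fmonom ixpair n}) (a : J -> K) i :
  injective w -> (\sum_j a j *: << w j >> : freealg K n)@_(w i) = a i.
Proof.
move=> w_inj; under eq_bigr do rewrite -monZ.
rewrite raddf_sum (bigD1 i) // big1 => [|j ji]; first by rewrite [LHS]addr0 [LHS]mcoeffUU.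
by rewrite [LHS]mcoeffU (inj_eq w_inj) (negPf ji).
Qed.

Lemma mull_monZ a p f : << p >> * (a *: f) = a *: (<< p >> * f) :> freealg K n.
Proof.
rewrite -[a *: f]mul_malgC mulrA; have -> : << p >> * a%:MP = a *: << p >> :> freealg K n.
  by rewrite -monZ [LHS]fgmulUU mul1r mulm1.
by rewrite scalerAl.
Qed.

Lemma mul_mon p m : << p >> * << m >> = << FMonom (p ++ m) >> :> freealg K n.
Proof. by rewrite [LHS]fgmulUU mulr1 monM. Qed.

Lemma fhat_mul_power x k a f :
  fhat K x * (a *: (<< FMonom (nseq k x) >> * f)) = a *: (<< FMonom (nseq k.+1 x) >> * f).
Proof.
have E : fhat K x * (<< FMonom (nseq k x) >> * f) = << FMonom (nseq k.+1 x) >> * f.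
  by rewrite mulrA /fhat mul_mon fmuE.
by rewrite [LHS]mull_monZ E.
Qed.

Lemma mcoeff_mulr f p m : (f * << p >>)@_(FMonom (m ++ p)) = f@_m.
Proof.
have inj m' : FMonom (m' ++ p) = FMonom (m ++ p) -> m' = m.
  move=> [] /(congr1 rev); rewrite !rev_cat => /eqP; rewrite eqseq_cat // eqxx /=.
  by move=> /eqP/(can_inj revK) E; apply: val_inj.
rewrite mulr_mon raddf_sum /=; case: (boolP (m \in msupp f)) => ms; last first.
  rewrite (mcoeff_outdom ms) big1_seq // => m' /andP[_ m's]; rewrite mcoeffU.
  by case: eqP => // /inj E; move: ms; rewrite -E m's.
rewrite (bigD1_seq m) ?fset_uniq // mcoeffU eqxx mulr1n big1_seq => [|m' /andP[m'm _]]; first exact: addr0.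
by rewrite mcoeffU; case: eqP => // /inj E; case/eqP: m'm.
Qed.

Lemma mcoeff_mull f p m : (<< p >> * f : freealg K n)@_(FMonom (p ++ m)) = f@_m.
Proof.
have inj m' : FMonom (p ++ m') = FMonom (p ++ m) -> m' = m.
  by move=> [] /eqP; rewrite eqseq_cat // eqxx /= => /eqP E; apply: val_inj.
rewrite mull_mon raddf_sum /=; case: (boolP (m \in msupp f)) => ms; last first.
  rewrite (mcoeff_outdom ms) big1_seq // => m' /andP[_ m's]; rewrite mcoeffU.
  by case: eqP => // /inj E; move: ms; rewrite -E m's.
rewrite (bigD1_seq m) ?fset_uniq // mcoeffU eqxx mulr1n big1_seq => [|m' /andP[m'm _]]; first exact: addr0.
by rewrite mcoeffU; case: eqP => // /inj E; case/eqP: m'm.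
Qed.

Lemma msupp_mulr f p m : m \in msupp (f * << p >> : freealg K n) ->
  exists2 m', m' \in msupp f & m = FMonom (m' ++ p).
Proof.
rewrite -mcoeff_neq0; apply: contraPP => H.
rewrite mulr_mon raddf_sum /= big1_seq ?eqxx // => m' /andP[_ m's].
by rewrite mcoeffU; case: eqP => // E; case: H; exists m'.
Qed.

Lemma msupp_mull f p m : m \in msupp (<< p >> * f : freealg K n) ->
  exists2 m', m' \in msupp f & m = FMonom (p ++ m').
Proof.
rewrite -mcoeff_neq0; apply: contraPP => H.
rewrite mull_mon raddf_sum /= big1_seq ?eqxx // => m' /andP[_ m's].
by rewrite mcoeffU; case: eqP => // E; case: H; exists m'.
Qed.

Lemma is_initial_mulr f m p : is_initial f m ->
  is_initial (f * << p >> : freealg K n) (FMonom (m ++ p)).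
Proof.
move=> [ms mx]; split; first by rewrite -mcoeff_neq0 mcoeff_mulr mcoeff_neq0.
move=> _ /msupp_mulr[m' m's ->] mm'; apply: mon_lt_catr; apply: mx => //.
by apply: contraNneq mm' => ->.
Qed.

Lemma is_initial_mull f m p : is_initial f m ->
  is_initial (<< p >> * f : freealg K n) (FMonom (p ++ m)).
Proof.
move=> [ms mx]; split; first by rewrite -mcoeff_neq0 mcoeff_mull mcoeff_neq0.
move=> _ /msupp_mull[m' m's ->] mm'; apply: mon_lt_catl; apply: mx => //.
by apply: contraNneq mm' => ->.
Qed.

Lemma mon_expand f : f = \sum_(m <- msupp f) f@_m *: (<< m >> : freealg K n).
Proof.
by rewrite [LHS]monalgE; apply: eq_bigr => m _; rewrite monZ.
Qed.

(* A monomial lies in the span of the initial parts of [S] only if it is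
   itself an initial part, so that membership can be tested coefficientwise. *)
Lemma lspan_initialP (S : set (freealg K n)) f :
  lspan (initial_monomials S) f <->
  forall m, m \in msupp f -> exists2 g, S g & is_initial g m.
Proof.
split=> [|H]; last first.
  rewrite (mon_expand f) big_seq; apply: lspan_sum => m mf; apply: lspanZ.
  by apply: lspan_sub; exists m => //; apply: H.
elim/lspan_ind => {f} [_ [m Hm <-] m'||a f g Hf Hg m].
- by rewrite msuppU1 in_fset1 => /eqP ->.
- by move=> m; rewrite msupp0.
- rewrite -mcoeff_neq0 mcoeffD mcoeffZ => nz.
  case: (boolP (m \in msupp f)) => [/Hf //|mf].
  case: (boolP (m \in msupp g)) => [/Hg //|mg].
  by move: nz; rewrite (mcoeff_outdom mf) (mcoeff_outdom mg) mulr0 addr0 eqxx.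
Qed.

End FreeAlgebra.

(** * Relations in the annihilator and their initial words *)

Section FreeAction.
Variables (K : numFieldType) (n : nat) (L : vectType K) (rho : 'M[K]_n -> 'End(L)).

Let act (A : 'M[K]_n) (u : L) : L := rho A u.

Lemma sl_rep_is_rep : sl_rep rho -> is_rep act.
Proof.
move=> [lin brk]; split=> [A|a A B tA tB x|A B tA tB x].
- exact: linearP.
- by rewrite /act lin // !lfunE /= !lfunE.
- exact: brk.
Qed.

Lemma hwv_is_hwv lam v : highest_weight_vector rho lam v -> is_hwv act lam v.
Proof.
move=> [_ raise wt]; split=> [i j ij|]; last exact: wt.
have ix : fst_ix (mkix ij (ltn_ord j)) = i by apply: val_inj.
have jx : snd_ix (mkix ij (ltn_ord j)) = j by apply: val_inj.
by have := raise (mkix ij (ltn_ord j)); rewrite ix jx.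
Qed.

Hypothesis rho_rep : sl_rep rho.
Let act_rep := sl_rep_is_rep rho_rep.

HB.instance Definition _ A := GRing.isLinear.Build K L L *:%R (act A) (act_lin act_rep A).

Lemma free_actE f u : free_act rho f u = \sum_(m <- msupp f) f@_m *: fword act m u.
Proof. by []. Qed.

Lemma free_actEw (d : {fset {fmonom ixpair n}}) (f : freealg K n) u : (msupp f `<=` d)%fset ->
  free_act rho f u = \sum_(m <- d) f@_m *: fword act m u.
Proof.
move=> fd; rewrite free_actE; apply: big_fset_incl => // m _ mf.
by rewrite (mcoeff_outdom mf) scale0r.
Qed.

Lemma free_act_lin u : linear (fun f => free_act rho f u).
Proof.
move=> a f g; pose d := (msupp f `|` msupp g `|` msupp (a *: f + g))%fset.
rewrite !(@free_actEw d) ?fsubsetUr //; first last.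
- by apply: fsubset_trans (fsubsetUl _ _); apply: fsubsetUl.
- by apply: fsubset_trans (fsubsetUl _ _); apply: fsubsetUr.
rewrite scaler_sumr -big_split; apply: eq_bigr => m _ /=.
by rewrite mcoeffD mcoeffZ scalerDl scalerA.
Qed.

Definition free_act_at u f := free_act rho f u.
HB.instance Definition _ u := GRing.isLinear.Build K (freealg K n) L *:%R
  (free_act_at u) (free_act_lin u).

Lemma free_act_mon m u : free_act rho << m >> u = fword act m u.
Proof. by rewrite free_actE msuppU1 big_seq_fset1 mcoeffUU scale1r. Qed.

Lemma free_act_sum (J : Type) (s : seq J) (c : J -> K) (w : J -> {fmonom ixpair n}) u :
  free_act rho (\sum_(j <- s) c j *: (<< w j >> : freealg K n)) u =
  \sum_(j <- s) c j *: fword act (w j) u.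
Proof.
rewrite -[LHS]/(free_act_at u _) linear_sum; apply: eq_bigr => j _.
by rewrite linearZ /= /free_act_at free_act_mon.
Qed.

Lemma free_act0r f : free_act rho f 0 = 0.
Proof. by rewrite free_actE big1 // => m _; rewrite (fword0 act_rep) scaler0. Qed.

Lemma free_actM f g u : free_act rho (f * g) u = free_act rho f (free_act rho g u).
Proof.
have mon m g' : free_act rho (<< m >> * g') u = fword act m (free_act rho g' u).
  rewrite mull_mon -[LHS]/(free_act_at u _) linear_sum /= /free_act_at [in RHS]free_actE.
  rewrite (_ : fword act m _ = \sum_(k <- msupp g') fword act m (g'@_k *: fword act k u)); last first.
    by apply: (big_morph (fword act m)) => [x y|]; rewrite ?(fwordD act_rep) ?(fword0 act_rep).
  apply: eq_bigr => k _.
  rewrite monZ -[LHS]/(free_act_at u _) linearZ /= /free_act_at free_act_mon fword_cat.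
  by have := fword_linear act_rep m (g'@_k) (fword act k u) 0; rewrite (fword0 act_rep) !addr0.
rewrite [f in LHS]mon_expand mulr_suml -[LHS]/(free_act_at u _) linear_sum /= [RHS]free_actE.
by apply: eq_bigr => m _; rewrite -scalerAl linearZ /= /free_act_at mon.
Qed.

Lemma free_act_fhat x u : free_act rho (fhat K x) u = act (fneg K x) u.
Proof. by rewrite /fhat free_act_mon fmuE. Qed.

Lemma strictly_lower_expand (C : 'M[K]_n) : (forall i j : 'I_n, (i <= j)%N -> C i j = 0) ->
  C = \sum_(z : ixpair n) C (snd_ix z) (fst_ix z) *: fneg K z.
Proof.
move=> tl; apply/matrixP => i j; rewrite summxE; case: (ltnP j i) => ij; last first.
  rewrite tl // big1 // => z _; rewrite !mxE.
  case: (eqVneq i (snd_ix z)) => [iz|_]; case: (eqVneq j (fst_ix z)) => [jz|_];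
    rewrite /= ?mulr0 //.
  by have := ixpair_lt z; move: ij; rewrite iz jz; lia.
pose z := mkix ij (ltn_ord i).
have zi : snd_ix z = i by apply: val_inj.
have zj : fst_ix z = j by apply: val_inj.
rewrite (bigD1 z) //= !mxE zi zj !eqxx mulr1 big1 ?addr0 // => z' zz'; rewrite !mxE.
case: (eqVneq i (snd_ix z')) => [iz|_]; case: (eqVneq j (fst_ix z')) => [jz|_];
  rewrite /= ?mulr0 //.
by case/eqP: zz'; apply: ixpair_eqP; rewrite ?zi ?zj ?iz ?jz.
Qed.

Lemma fhat_lin_bracket (x y : ixpair n) u :
  free_act rho (fhat_lin (bracket (fneg K x) (fneg K y))) u = act (bracket (fneg K x) (fneg K y)) u.
Proof.
set C := bracket _ _.
have tl (i j : 'I_n) : (i <= j)%N -> C i j = 0.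
  move=> ij; rewrite /C bracket_delta !mxE.
  have hx := ixpair_lt x; have hy := ixpair_lt y.
  case: (eqVneq (fst_ix x) (snd_ix y)) => [xy|_]; case: (eqVneq (fst_ix y) (snd_ix x)) => [yx|_];
    rewrite /= ?mul0r ?subr0 ?sub0r ?mul1r //.
  - by move: hx hy; rewrite xy -yx; lia.
  - case: (boolP (_ && _)) => [/andP[/eqP iE /eqP jE]|//].
    by move: ij; rewrite iE jE; move: hx hy; rewrite xy; lia.
  - case: (boolP (_ && _)) => [/andP[/eqP iE /eqP jE]|_]; last exact: oppr0.
    by move: ij; rewrite iE jE; move: hx hy; rewrite yx; lia.
rewrite [in RHS](strictly_lower_expand tl).
rewrite act_sum // => [|z]; last by rewrite mxtraceZ mxtrace_fneg mulr0.
rewrite -[LHS]/(free_act_at u _) linear_sum; apply: eq_bigr => z _.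
by rewrite linearZ /= /free_act_at free_act_fhat actZ // mxtrace_fneg.
Qed.

Variable v : L.
Local Notation Ann := (annihilator rho v).
Local Notation Un := (@Un_ideal K n).

Lemma Un_ideal_sub f : Un f -> Ann f.
Proof.
elim/lspan_ind => [_ [g [h [x [y ->]]]]||a f' g Hf Hg].
- rewrite /annihilator /= !free_actM; set z := free_act rho h v.
  rewrite (_ : free_act rho (_ - _) z = 0) ?free_act0r //.
  have E a b : free_act rho (fhat K a * fhat K b) z = act (fneg K a) (act (fneg K b) z).
    by rewrite free_actM (free_act_fhat b) free_act_fhat.
  have brk : act (bracket (fneg K x) (fneg K y)) z =
      act (fneg K x) (act (fneg K y) z) - act (fneg K y) (act (fneg K x) z).
    by rewrite [X in _ = X - _]act_bracket ?mxtrace_fneg // addrK.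
  rewrite -fhat_lin_bracket -(E x y) -(E y x) in brk.
  rewrite -[LHS]/(free_act_at z _) linearB [X in _ - X]brk linearB subrr //.
- exact: (linear0 (free_act_at v)).
- by have := linearP (free_act_at v) a f' g; rewrite /annihilator /= /free_act_at Hf Hg scaler0 addr0.
Qed.

Lemma Un_ideal_mulr f g : Un f -> Un (f * g).
Proof.
elim/lspan_ind => [_ [g' [h [x [y ->]]]]||a f' g' Hf Hg].
- apply: lspan_sub; exists g', (h * g), x, y; exact: esym (mulrA _ _ _).
- by rewrite mul0r; apply: lspan0.
- rewrite mulrDl -scalerAl; exact: lspanP Hf Hg.
Qed.

Lemma annihilator_mull f g : Ann f -> Ann (g * f).
Proof.
rewrite /annihilator /= free_actM => ->.
exact: free_act0r.
Qed.

(** The words of [ws] may repeat or cancel; being smaller than m, they cannot affect its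
    coefficient. *)
Lemma initial_of_relation (m : {fmonom ixpair n}) c
    (ws : seq (K * seq (ixpair n))) : c != 0 ->
  (forall w, w \in ws -> mon_lt (FMonom w.2) m) ->
  c *: fword act m v + \sum_(w <- ws) w.1 *: fword act w.2 v = 0 ->
  exists2 f, Ann f & is_initial f m.
Proof.
move=> c0 wsm E; pose g : freealg K n := \sum_(w <- ws) w.1 *: << FMonom w.2 >>.
exists (c *: (<< m >> : freealg K n) + g).
  have := linearP (free_act_at v) c << m >> g; rewrite /annihilator /= /free_act_at => ->.
  by rewrite free_act_mon /g (free_act_sum _ (fun w => w.1) (fun w => FMonom w.2)).
have gm m' : m' \in msupp g -> mon_lt m' m.
  rewrite -mcoeff_neq0; apply: contraPP => H; apply/negP; rewrite negbK.
  rewrite /g raddf_sum /= big1_seq ?eqxx // => w /andP[_ wws]; rewrite mcoeffZ mcoeffU.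
  by case: eqP => [wE|]; rewrite ?mulr0 //; case: H; rewrite -wE; apply: wsm.
have gm0 : g@_m = 0.
  by apply/mcoeff_outdom/negP => /gm; apply: mon_lt_irr.
split=> [|m'].
  by rewrite -mcoeff_neq0 mcoeffD mcoeffZ gm0 addr0 mcoeffUU mulr1.
rewrite -mcoeff_neq0 mcoeffD mcoeffZ mcoeffU => nz mm'; apply: gm.
by move: nz; rewrite [m == m']eq_sym (negPf mm') mulr0 add0r mcoeff_neq0.
Qed.

(** At a descent x y, the product is y x plus the bracket, and the exchanged word is smaller of the
    same height. *)
Lemma unsorted_initial (m : {fmonom ixpair n}) : ~~ sorted (@pair_le n) m ->
  exists2 f, Ann f & is_initial f m.
Proof.
move=> nsm; have [p [x [y [s [mE yx]]]]] : exists p x y s,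
    m = p ++ x :: y :: s :> seq _ /\ pair_lt y x.
  elim: (fmonom_val m) nsm => // x [|y s] IH //=; rewrite negb_and => /orP[xy|ys].
    exists [::], x, y, s; split=> //; rewrite pair_ltE; apply/andP; split.
      by apply: contraNneq xy => ->; apply: pair_le_refl.
    by case/orP: (pair_le_total x y) xy => // ->.
  by have [p [x' [y' [s' [E h]]]]] := IH ys; exists (x :: p), x', y', s'; rewrite E.
have Hx := ixpair_lt x; have Hy := ixpair_lt y.
have yxle : pair_le y x by rewrite /pair_le yx orbT.
pose w1 := p ++ y :: x :: s.
have w1m : mon_lt (FMonom w1) m.
  right; split; last by exists p, (x :: s), (y :: s), y, x.
  by rewrite /mon_height mE /= !big_cat !big_cons /= [(_ + (_ + \sum_(_ <- s) _))%N]addnCA.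
set z := fword act s v.
have Em : fword act m v = fword act w1 v + fword act p (act (bracket (fneg K x) (fneg K y)) z).
  by rewrite mE /w1 !fword_cat /= act_bracket ?mxtrace_fneg // (fwordD act_rep) addrC.
case: (eqVneq (fst_ix x) (snd_ix y)) => xy; last first.
  apply: (@initial_of_relation m 1 [:: (-1, w1)]); rewrite ?oner_eq0 //.
    by move=> w; rewrite inE => /eqP ->.
  rewrite big_seq1 scale1r scaleN1r Em bracket_delta (negPf xy).
  rewrite (_ : (fst_ix y == snd_ix x) = false); last first.
    by apply/eqP => E; move: yxle; rewrite pair_leE E -val_eqE /=; lia.
  by rewrite !scale0r subrr (act0 act_rep) (fword0 act_rep) addr0 subrr.
(* The bracket is here the letter t joining y and x. It has the height of both together and lies in
   the row of y, above that of x, so the word it gives is smaller too. *)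
have yz : (fst_ix y < snd_ix x)%N by apply: ltn_trans Hy _; rewrite -xy.
pose t := mkix yz (ltn_ord (snd_ix x)); pose w2 := p ++ t :: s.
apply: (@initial_of_relation m 1 [:: (-1, w1); (-1, w2)]); rewrite ?oner_eq0 //.
  move=> w; rewrite !inE => /orP[/eqP -> //|/eqP ->] /=; right; split.
    rewrite /mon_height mE /= !big_cat !big_cons /=; congr (_ + _)%N.
    rewrite addnA; congr (_ + _)%N.
    by move: Hx Hy; rewrite xy; lia.
  exists p, s, (y :: s), t, x; split=> //.
  by rewrite /pair_lt /= xy Hy.
rewrite big_cons big_seq1 scale1r !scaleN1r Em bracket_delta xy eqxx scale1r.
rewrite (_ : (fst_ix y == snd_ix x) = false); last by rewrite -val_eqE /= ltn_eqF.
rewrite scale0r subr0 /w2 !fword_cat /= -/z.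
rewrite (_ : fneg K t = delta_mx (snd_ix x) (fst_ix y)); last first.
  by congr delta_mx; apply: val_inj.
by rewrite addrACA subrr add0r subrr.
Qed.

End FreeAction.

Lemma ample_multiple_gt0 (R : realType) (I : finType) (P : set {ffun I -> R}) :
  (0 < ample_multiple P)%N.
Proof. by rewrite /ample_multiple; case: xgetP => // k -> []. Qed.

Section StandardMonomials.
Variables (n : nat) (lam : 'I_n.-1 -> nat).
Implicit Types (m : {fmonom ixpair n}).

Definition gt_bound : nat := (\sum_k lam k)%N.

Definition gt_index : Type := {T : {ffun ixpair n -> 'I_gt_bound.+1} |
  `[< gt_point lam [ffun x => T x : nat] >]}.
HB.instance Definition _ := Finite.on gt_index.

Definition gt_exp (j : gt_index) : {ffun ixpair n -> nat} := [ffun x => val j x : nat].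

Lemma gt_expP j : gt_point lam (gt_exp j).
Proof. exact/asboolP/(valP j). Qed.

Lemma gt_exp_inj : injective gt_exp.
Proof.
move=> i j /ffunP E; apply/val_inj/ffunP => x; apply: val_inj.
by have := E x; rewrite !ffunE.
Qed.

Lemma gt_exp_surj T : gt_point lam T -> exists j, gt_exp j = T.
Proof.
move=> hT; pose T' : {ffun ixpair n -> 'I_gt_bound.+1} := [ffun x => inord (T x)].
have T'E : [ffun x => T' x : nat] = T.
  by apply/ffunP => x; rewrite !ffunE inordK // ltnS gt_point_bound.
have hT' : `[< gt_point lam [ffun x => T' x : nat] >] by apply/asboolP; rewrite T'E.
by exists (exist _ T' hT').
Qed.

Definition std_word (j : gt_index) : {fmonom ixpair n} := FMonom (mword (gt_exp j)).

Lemma std_word_inj : injective std_word.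
Proof. by move=> i j [] /mword_inj/gt_exp_inj. Qed.

(** Words of at least this length vanish in the degenerate module, by [pi_long], so exponential
    series can be truncated here. *)
Definition size_bound : nat := (\max_j size (std_word j)).+1.

End StandardMonomials.

Section Coordinates.
Variables (K : numFieldType) (n : nat) (lam : 'I_n.-1 -> nat).
Local Notation gt_index := (gt_index lam).
Local Notation std_word := (@std_word n lam).
Local Notation size_bound := (size_bound lam).
Implicit Types (f g : freealg K n) (m : {fmonom ixpair n}) (j : gt_index).

Definition fact_prod (j : gt_index) : K := \prod_x (gt_exp j x)`!%:R.

Lemma fact_prod_neq0 j : fact_prod j != 0.
Proof. by apply/prodf_neq0 => x _; rewrite pnatr_eq0 -lt0n fact_gt0. Qed.

(** A representative of exp(c) v in the free algebra, where coefficients can be read off. *)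
Definition exp_poly (c : {ffun ixpair n -> K}) (xs : seq (ixpair n)) : freealg K n :=
  foldr (fun x f => \sum_(k < size_bound)
    (k`!%:R^-1 * c x ^+ k) *: (<< FMonom (nseq k x) >> * f)) 1 xs.

Lemma msupp_exp_poly c xs m : m \in msupp (exp_poly c xs) -> {subset (m : seq (ixpair n)) <= xs}.
Proof.
elim: xs m => [|x xs IH] m /=.
  by rewrite -mon1 msuppU1 in_fset1 => /eqP ->.
rewrite -mcoeff_neq0 raddf_sum /= => nz.
have [k nzk] : exists k : 'I_size_bound,
    (<< FMonom (nseq k x) >> * exp_poly c xs : freealg K n)@_m != 0.
  apply/existsP; apply: contraT => /existsPn H; move: nz; rewrite big1 ?eqxx // => k _.
  by rewrite mcoeffZ; have := H k; rewrite negbK => /eqP ->; rewrite mulr0.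
rewrite mcoeff_neq0 in nzk; have [m' /IH m's ->] := msupp_mull nzk.
move=> y /=; rewrite mem_cat in_cons => /orP[/nseqP[-> _]|/m's ->]; by rewrite ?eqxx ?orbT.
Qed.

(** The number of letters x in a word of the k-th term is k, so only k = t contributes. *)
Lemma mcoeff_power_series x (a : nat -> K) D t g (s : seq (ixpair n)) :
  (forall m, m \in msupp g -> x \notin (m : seq _)) -> x \notin s -> (t < D)%N ->
  (\sum_(k < D) a k *: (<< FMonom (nseq k x) >> * g) : freealg K n)@_(FMonom (nseq t x ++ s)) =
  a t * g@_(FMonom s).
Proof.
move=> xg xs tD; rewrite raddf_sum (bigD1 (Ordinal tD)) // big1 => [|k kt].
  by rewrite [LHS]addr0 [LHS]mcoeffZ (mcoeff_mull g (FMonom (nseq t x)) (FMonom s)).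
rewrite [LHS]mcoeffZ (_ : (_ * g)@_ _ = 0) ?mulr0 //.
apply/mcoeff_outdom/negP => /msupp_mull[m' /xg xm'] [] /(congr1 (count_mem x)).
rewrite !count_cat !count_nseq /= eqxx !mul1n (count_memPn xs) (count_memPn xm') !addn0.
by move=> E; case/eqP: kt; apply: val_inj.
Qed.

Lemma mcoeff_exp_poly c xs (T : {ffun ixpair n -> nat}) : uniq xs ->
  (forall x, T x < size_bound)%N ->
  (exp_poly c xs)@_(FMonom (word_of xs T)) = \prod_(x <- xs) ((T x)`!%:R^-1 * c x ^+ T x).
Proof.
move=> + hT; elim: xs => [_|x xs IH /= /andP[xxs uxs]].
  by rewrite big_nil /= -mon1 mcoeffUU.
rewrite big_cons -IH //; apply: (mcoeff_power_series (fun k => k`!%:R^-1 * c x ^+ k)) => //.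
  by move=> m /msupp_exp_poly ms; apply: contra xxs => /ms.
by apply: contra xxs => /mem_word_of.
Qed.

Lemma gt_exp_lt j x : (gt_exp j x < size_bound)%N.
Proof.
rewrite ltnS; apply: leq_trans (@leq_bigmax _ (fun j => size (std_word j)) j).
by rewrite /= -[gt_exp j x]count_mword count_size.
Qed.

Variables (Q : lmodType K) (pi : {linear freealg K n -> Q}) (rep : Q -> freealg K n).
Hypothesis repK : cancel rep pi.
Hypothesis pi_eq0 : forall f, pi f = 0 <-> forall j, f@_(std_word j) = 0.

Lemma mcoeff_rep f j : (rep (pi f))@_(std_word j) = f@_(std_word j).
Proof.
apply/eqP; rewrite -subr_eq0 -mcoeffB; apply/eqP; move: j; apply/pi_eq0.
by rewrite linearB /= repK subrr.
Qed.

(* The factorials turn the coordinates prod c^T/T! of the orbit into monomials *)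
Lemma std_coord_lin j a (q r : Q) :
  fact_prod j * (rep (a *: q + r))@_(std_word j) =
  a * (fact_prod j * (rep q)@_(std_word j)) + fact_prod j * (rep r)@_(std_word j).
Proof.
rewrite -{1}(repK q) -{1}(repK r) -linearP mcoeff_rep mcoeffD mcoeffZ.
by rewrite mulrDr mulrCA.
Qed.

Definition std_coord j : {scalar Q} := make_scalar (std_coord_lin j).

Definition std_vec j : Q := (fact_prod j)^-1 *: pi << std_word j >>.

Lemma std_coordE j q : std_coord j q = fact_prod j * (rep q)@_(std_word j).
Proof. by []. Qed.

Lemma std_coord_vec i j : std_coord i (std_vec j) = (i == j)%:R.
Proof.
rewrite linearZ /= std_coordE mcoeff_rep mcoeffU eq_sym (inj_eq (@std_word_inj n lam)).
by case: eqP => [->|_]; rewrite ?mulr0 // mulr1 mulVf // fact_prod_neq0.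
Qed.

Lemma std_span (q : Q) : q = \sum_j std_coord j q *: std_vec j.
Proof.
have -> : \sum_j std_coord j q *: std_vec j =
    pi (\sum_j (rep q)@_(std_word j) *: (<< std_word j >> : freealg K n)).
  rewrite linear_sum; apply: eq_bigr => j _; rewrite [RHS]linearZ /std_vec scalerA std_coordE.
  by congr (_ *: _); rewrite mulrC mulKf // fact_prod_neq0.
rewrite -{1}(repK q); apply/eqP; rewrite -subr_eq0 -linearB; apply/eqP/pi_eq0 => j.
rewrite [LHS]mcoeffB mcoeff_sum_mon ?subrr //; exact: std_word_inj.
Qed.

Lemma pi_long m f : (size_bound <= size m)%N -> pi (<< m >> * f) = 0.
Proof.
move=> hm; apply/pi_eq0 => j.
apply/mcoeff_outdom/negP => /msupp_mull[m' _ /(congr1 val)/(congr1 size)] /=.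
rewrite size_cat => E; have := @leq_bigmax _ (fun j => size (std_word j)) j.
by rewrite leqNgt -ltnS -/size_bound => /negP; apply; apply: leq_trans hm _; rewrite /= E leq_addr.
Qed.

Variable U : ixpair n -> Q -> Q.
Hypothesis U_pi : forall x f, U x (pi f) = pi (fhat K x * f).

Let piZ_freealg a f : pi (a *: f) = a *: pi f. Proof. exact: linearZ. Qed.

Let piZ a (f : {malg K[{fmonom ixpair n}]}) : pi (a *: f) = a *: pi f.
Proof. exact: piZ_freealg. Qed.

Lemma iter_U (c : K) x k f :
  iter k (fun u => c *: U x u) (pi f) = pi (c ^+ k *: (<< FMonom (nseq k x) >> * f)).
Proof.
elim: k => [|k IH].
  by rewrite expr0 scale1r mon1 mul1r.
by rewrite iterS IH U_pi fhat_mul_power piZ piZ scalerA -exprS.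
Qed.

Lemma exp_series (c : K) x f :
  \sum_(k \in [set: nat]) ((k`!)%:R^-1 : K) *: iter k (fun u => c *: U x u) (pi f) =
  pi (\sum_(k < size_bound) (k`!%:R^-1 * c ^+ k) *: (<< FMonom (nseq k x) >> * f)).
Proof.
rewrite (@fsbigE _ _ _ _ _ (iota 0 size_bound)) ?iota_uniq //; last first.
  move=> k _; rewrite mem_iota add0n -leqNgt => hk.
  by rewrite iter_U piZ pi_long ?size_nseq // !scaler0.
rewrite linear_sum -(big_mkord xpredT
  (fun k => pi ((k`!%:R^-1 * c ^+ k) *: (<< FMonom (nseq k x) >> * f)))) /index_iota subn0.
apply: eq_big => [k|k _]; first by rewrite in_setT.
by rewrite iter_U piZ piZ scalerA.
Qed.

Lemma std_coord_exp (c : {ffun ixpair n -> K}) j :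
  std_coord j (pi (exp_poly c (pairs_sorted n))) = \prod_x c x ^+ gt_exp j x.
Proof.
rewrite std_coordE mcoeff_rep mcoeff_exp_poly ?uniq_pairs_sorted //; last exact: gt_exp_lt.
rewrite (perm_big (index_enum (ixpair n))) /=; last first.
  by rewrite /pairs_sorted perm_sort enumT.
rewrite /fact_prod -big_split; apply: eq_bigr => x _ /=.
by rewrite mulrA mulfV ?mul1r // pnatr_eq0 -lt0n fact_gt0.
Qed.

End Coordinates.

Section DegenerateModule.
Variables (K : numClosedFieldType) (n : nat) (lam : 'I_n.-1 -> nat).
Variables (L : vectType K) (rho : 'M[K]_n -> 'End(L)) (v : L).
Hypothesis n_gt0 : (0 < n)%N.
Hypothesis rho_rep : sl_rep rho.
Hypothesis v_hwv : highest_weight_vector rho lam v.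
Local Notation std_word := (@std_word n lam).
Implicit Types (f g : freealg K n) (m : {fmonom ixpair n}).

Local Notation Ann := (annihilator rho v).
Let act (A : 'M[K]_n) (u : L) : L := rho A u.
Let act_rep : is_rep act := sl_rep_is_rep rho_rep.
Let act_hwv : is_hwv act lam v := hwv_is_hwv v_hwv.

Lemma initial_or_standard m : (exists2 f, Ann f & is_initial f m) \/
  exists2 T, gt_point lam T & m = FMonom (mword T).
Proof.
case: (boolP (sorted (@pair_le n) m)) => sm; last by left; apply: unsorted_initial.
pose T := [ffun x => count_mem x m]; have mE : m = FMonom (mword T).
  by apply: val_inj; rewrite /= /T -sorted_eq_mword.
case: (pselect (gt_point lam T)) => hT; [by right; exists T | left].
have [k [j [kj hkj]]] : exists (k : 'I_n.-1) j,
    (k < j)%N /\ (lam k + rsum T k.+1 j.+1 < rsum T k j)%N.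
  apply: contrapT => H; apply: hT => k j kj; rewrite leqNgt; apply/negP => h.
  by apply: H; exists k, j.
have k1n : (k.+1 < n)%N by rewrite -ltn_predRL.
have [N [ws [wsm E]]] := @violating_word K n L act act_rep lam v act_hwv k
  (Ordinal (ltnW k1n)) (Ordinal k1n) erefl erefl m j sm kj hkj.
apply: (@initial_of_relation _ _ _ rho v m N.+1%:R [seq (1, w) | w <- ws]).
- by rewrite pnatr_eq0.
- by move=> w /mapP[w' /wsm + ->]; rewrite fmK.
- by rewrite big_map -[RHS]E; congr (_ + _); apply: eq_bigr => w _; rewrite scale1r.
Qed.

Lemma standard_not_initial T f : gt_point lam T -> Ann f ->
  ~ is_initial f (FMonom (mword T)).
Proof.
move=> hT fA [ms mx]; move: (ms); rewrite -mcoeff_neq0 => /eqP; apply.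
have v0 : v != 0 by case: v_hwv.
exact: (@mword_not_initial K n L act act_rep lam v act_hwv v0 n_gt0 T
  (fun m => f@_m) (msupp f) (FMonom (mword T)) hT erefl (fset_uniq _) ms mx fA).
Qed.

(** Every word is either initial or standard and never both, so the standard words give a basis of
    the quotient. *)
Lemma initial_spanP f : lspan (initial_monomials Ann) f <-> forall j, f@_(std_word j) = 0.
Proof.
rewrite lspan_initialP; split=> [H j|H m ms].
  apply/mcoeff_outdom/negP => /H[g gA]; exact: standard_not_initial (gt_expP j) gA.
have [//|[T /gt_exp_surj[j jT] mE]] := initial_or_standard m.
by move: ms; rewrite -mcoeff_neq0 mE -jT H eqxx.
Qed.

Lemma initial_Un_mulr f g : lspan (initial_monomials (@Un_ideal K n)) f ->
  lspan (initial_monomials Ann) (f * g).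
Proof.
elim/lspan_ind => {f} [_ [m [f fU fm] <-]||a f f' Hf Hf'].
- rewrite mull_mon big_seq; apply: lspan_sum => p _.
  rewrite monZ.
  apply: lspanZ; apply: lspan_sub; exists (FMonom (m ++ p)) => //.
  exists (f * << p >>); last exact: is_initial_mulr.
  by apply: (Un_ideal_sub rho_rep); apply: Un_ideal_mulr.
- by rewrite mul0r; apply: lspan0.
- rewrite mulrDl.
  rewrite -scalerAl.
  exact: lspanP Hf Hf'.
Qed.

Lemma initial_Ann_mull p f : lspan (initial_monomials Ann) f ->
  lspan (initial_monomials Ann) (<< p >> * f).
Proof.
elim/lspan_ind => {f} [_ [m [f fA fm] <-]||a f f' Hf Hf'].
- rewrite mulr_mon msuppU1 big_seq_fset1 mcoeffUU.
  apply: lspan_sub; exists (FMonom (p ++ m)) => //.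
  exists (<< p >> * f); last exact: is_initial_mull.
  exact: annihilator_mull.
- by rewrite mulr0; apply: lspan0.
- rewrite mulrDr mull_monZ.
  exact: lspanP Hf Hf'.
Qed.

Definition proj_L (f : freealg K n) : Lprec rho v := \pi_(Lprec rho v) f.

Lemma proj_LP f g : proj_L f = proj_L g <-> lspan (initial_monomials Ann) (f - g).
Proof.
split=> [/(quo_piP (initial_monomials Ann) f g)|h]; first by move=> /asboolP.
by apply/(quo_piP (initial_monomials Ann) f g)/asboolP.
Qed.

Lemma proj_L_lin : linear proj_L.
Proof.
move=> a f g; have D := quo_piD (initial_monomials Ann) (a *: f) g.
have Z := quo_piZ (initial_monomials Ann) a f.
exact: etrans D (congr1 (fun q => q + _) Z).
Qed.

HB.instance Definition _ := GRing.isLinear.Build K (freealg K n) (Lprec rho v) *:%R proj_L proj_L_lin.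

Let pi : {linear freealg K n -> Lprec rho v} := proj_L.

Lemma proj_L_repr : cancel (repr : Lprec rho v -> freealg K n) pi.
Proof. exact: reprK. Qed.

Lemma proj_L_eq0 f : pi f = 0 <-> forall j, f@_(std_word j) = 0.
Proof.
rewrite -initial_spanP -[f in lspan _ f]subr0 -proj_LP.
by rewrite (_ : proj_L 0 = 0) //; exact: (linear0 pi).
Qed.

(** The action is defined through chosen representatives. Changing that of [chi] adds an element of
    in(I) times a factor, changing that of the vector adds a multiple of an element of in(I_lam);
    both lie in in(I_lam). *)
Lemma Uprec_act_proj x f : Uprec_act (chi K x) (pi f) = pi (fhat K x * f).
Proof.
apply/proj_LP; set g := repr (pi f).
rewrite (_ : _ - _ = (repr (chi K x) - fhat K x) * g + fhat K x * (g - f)); last first.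
  by rewrite mulrBl mulrBr addrA subrK.
apply: lspanD; last by apply: initial_Ann_mull; apply/proj_LP; apply: proj_L_repr.
apply: initial_Un_mulr; apply/asboolP/quo_piP; exact: reprK.
Qed.

Lemma exp_c_proj (c : {ffun ixpair n -> K}) :
  exp_c c (vprec rho v) = pi (exp_poly lam c (pairs_sorted n)).
Proof.
rewrite /exp_c; elim: (pairs_sorted n) => [//|x xs IH].
rewrite -[RHS](@exp_series K n lam _ pi proj_L_eq0 (fun x u => Uprec_act (chi K x) u)
  Uprec_act_proj (c x) x (exp_poly lam c xs)).
by rewrite -IH.
Qed.

Lemma exp_orbit_closure_toric (R : realType) :
  isomorphic (exp_orbit_closure rho v) (toric_variety K (GT_polytope R lam)).
Proof.
(* Only positivity of the multiple matters, and the default value 1 is positive as well. *)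
rewrite /toric_variety; have := ample_multiple_gt0 (GT_polytope R lam).
case: (ample_multiple _) => // k _.
(* The zero pattern gives the constant coordinate 1, which keeps every exp(c) v away from 0. *)
have [j0 j0E] : exists j0 : gt_index lam, gt_exp j0 = [ffun=> 0%N].
  apply: gt_exp_surj => i j ij; rewrite /rsum big1 // => x _; exact: ffunE.
have exp_coord (c : {ffun ixpair n -> K}) j : std_coord proj_L_repr proj_L_eq0 j
    (exp_c c (vprec rho v)) = \prod_x c x ^+ gt_exp j x.
  by rewrite exp_c_proj std_coord_exp.
apply: (@veronese_isomorphic K (ixpair n) _ (gt_index lam) (@gt_exp n lam)
  (std_coord proj_L_repr proj_L_eq0) (std_vec pi) (std_span proj_L_repr proj_L_eq0)
  (std_coord_vec proj_L_repr proj_L_eq0)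
  (fun c => exp_c c (vprec rho v)) exp_coord j0 _ k).
- by move=> x; rewrite j0E ffunE.
- move=> s; apply/lattice_points_gtP.
  have := gt_point_sum (fun i => gt_expP (s i)); rewrite card_ord => hs.
  by exists [ffun x => \sum_i gt_exp (s i) x]%N => //; apply/ffunP => x; rewrite !ffunE.
- move=> m /lattice_points_gtP[T /gt_point_decompose[s [hs TE]] ->].
  exists (fun i => projT1 (cid (gt_exp_surj (hs i)))); apply/ffunP => x; rewrite !ffunE TE.
  by congr Posz; apply: eq_bigr => i _; case: cid => j /= ->.
Qed.

End DegenerateModule.

Close Scope ring_scope.
Close Scope quotient_scope.
Close Scope classical_set_scope.

Theorem theorem8p7 (R : realType) (n : nat) (hn : 2 <= n)
    (lam : 'I_n.-1 -> nat)
    (L : vectType (complex R)) (rho : 'M[complex R]_n -> 'End(L)) (v : L)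
    (hrep : sl_rep rho) (hirr : irreducible_rep rho)
    (hv : highest_weight_vector rho lam v) :
  isomorphic (exp_orbit_closure rho v)
    (toric_variety (complex R) (GT_polytope R lam)).
Proof. exact: (exp_orbit_closure_toric (ltnW hn) hrep hv). Qed.
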